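(* Let $s\in(0,1)$, let $\Omega\subset\mathbb{R}^n$ be an open set and let $E\subset\mathbb{R}^n$. Then $E$ has locally finite $s$-perimeter in $\Omega$ if and only if there exist a sequence $\{E_h\}_{h\in\mathbb{N}}$ of open subsets of $\mathbb{R}^n$ with smooth boundary and a sequence $\varepsilon_h\to0^+$ such that (i) $E_h\xrightarrow{loc}E$ and $\sup_{h\in\mathbb{N}}P_s(E_h,\Omega')<\infty$ for every open $\Omega'\subset\subset\Omega$; (ii) $\lim_{h\to\infty}P_s(E_h,\Omega')=P_s(E,\Omega')$ for every open $\Omega'\subset\subset\Omega$; (iii) $\partial E_h\subset N_{\varepsilon_h}(\partial E)$ for every $h$. Moreover, if $\Omega=\mathbb{R}^n$ and $E$ is such that $|E|<\infty$ and $P_s(E)<\infty$, then the sequence can be chosen so that in addition $$|E_h\Delta E|\longrightarrow0\qquad\text{and}\qquad\lim_{h\to\infty}P_s(E_h)=P_s(E),$$ and one can also require each set $E_h$ to be bounded, if one does so instead of asking (iii) (that is, there is also a sequence of bounded open sets $E_h$ with smooth boundary satisfying (i), (ii) with $\Omega=\mathbb{R}^n$ and the two displayed convergences).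
   Context: All sets are Lebesgue measurable, $|\cdot|$ is Lebesgue measure. For disjoint $A,B\subset\mathbb{R}^n$ put $\mathcal{L}_s(A,B)=\int_A\int_B\frac{dx\,dy}{|x-y|^{n+s}}\in[0,\infty]$. The $s$-perimeter of $E\subset\mathbb{R}^n$ in an open set $\Omega\subset\mathbb{R}^n$ is, writing $E^c=\mathbb{R}^n\setminus E$, $$P_s(E,\Omega)=\mathcal{L}_s(E\cap\Omega,E^c\cap\Omega)+\mathcal{L}_s(E\cap\Omega,E^c\setminus\Omega)+\mathcal{L}_s(E\setminus\Omega,E^c\cap\Omega),$$ and $P_s(E)=P_s(E,\mathbb{R}^n)$. $E$ has locally finite $s$-perimeter in $\Omega$ if $P_s(E,\Omega')<\infty$ for every open $\Omega'\subset\subset\Omega$, where $A\subset\subset B$ means that $\overline{A}$ is compact and $\overline{A}\subset B$. $E_h\xrightarrow{loc}E$ means $\chi_{E_h}\to\chi_E$ in $L^1_{loc}(\mathbb{R}^n)$. $N_\rho(\Gamma)=\{x\in\mathbb{R}^n : d(x,\Gamma)<\rho\}$ (with $N_\rho(\emptyset)=\emptyset$). Sets are identified up to measure zero, and the representative of $E$ is chosen so that its topological boundary equals its measure theoretic boundary: $\partial E=\{x\in\mathbb{R}^n : 0<|E\cap B_r(x)|<|B_r(x)|\text{ for every }r>0\}$. Smooth means $C^\infty$. *)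

(* Defs.v *)
From HB Require Import structures.
From mathcomp Require Import all_boot all_order all_algebra.
From mathcomp Require Import all_classical all_reals all_analysis.

Set Implicit Arguments.
Unset Strict Implicit.
Unset Printing Implicit Defensive.

Import Order.TTheory GRing.Theory Num.Theory.
Import numFieldNormedType.Exports.

Local Open Scope classical_set_scope.
Local Open Scope ring_scope.

(* The product sigma-algebra on R^n, generated by the coordinate functions. *)
Section measurable_rV.
Context d (T : measurableType d) (n : nat).

Let coord (i : 'I_n) (x : 'rV[T]_n) : T := x ord0 i.

Let rV_set0 : g_sigma_preimage coord set0.
Proof. exact: sigma_algebra0. Qed.

Let rV_setC A : g_sigma_preimage coord A -> g_sigma_preimage coord (~` A).
Proof. exact: sigma_algebraC. Qed.

Let rV_bigcup (F : (set 'rV[T]_n)^nat) :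
  (forall i, g_sigma_preimage coord (F i)) ->
  g_sigma_preimage coord (\bigcup_i F i).
Proof. exact: sigma_algebra_bigcup. Qed.

HB.instance Definition _ := @isMeasurable.Build (measure_tuple_display d)
  'rV[T]_n (g_sigma_preimage coord) rV_set0 rV_setC rV_bigcup.

End measurable_rV.

Lemma measurable_coord d (T : measurableType d) n (i : 'I_n) :
  measurable_fun [set: 'rV[T]_n] (fun x : 'rV[T]_n => x ord0 i).
Proof.
move=> _ Y mY; rewrite setTI; apply: sub_sigma_algebra => /=.
rewrite -bigcup_seq/=; exists i => /=; first by rewrite mem_index_enum.
by exists Y => //; rewrite setTI.
Qed.

Lemma measurable_fun_rV d d' (T : measurableType d) (T' : measurableType d') n
    (f : T' -> 'rV[T]_n) :
  (forall i, measurable_fun setT (fun x => f x ord0 i)) ->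
  measurable_fun setT f.
Proof.
move=> mf; apply: (@measurability _ _ _ _ setT f
  (\big[setU/set0]_(i < n) preimage_set_system setT
     (fun x : 'rV[T]_n => x ord0 i) measurable)) => //.
move=> _ [B + <-]; rewrite -bigcup_seq => -[i _ [Y mY <-]].
by rewrite setTI setTI; rewrite -[X in measurable X]setTI; exact: mf.
Qed.

(* (t, x) in R * R^n |-> (t, x_0, ..., x_{n-1}) in R^{n+1}. *)
Definition consv {T : Type} {n : nat} (p : T * 'rV[T]_n) : 'rV[T]_n.+1 :=
  \row_(i < n.+1) oapp (fun j => p.2 ord0 j) p.1 (unlift ord0 i).

Lemma measurable_consv d (T : measurableType d) n :
  measurable_fun setT (@consv T n).
Proof.
apply: measurable_fun_rV => i; rewrite /consv.
under eq_fun do rewrite mxE.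
case: (unlift ord0 i) => [j|] /=; last exact: measurable_fst.
apply: (@measurableT_comp _ _ _ _ _ _ (fun x : 'rV[T]_n => x ord0 j)).
  exact: measurable_coord.
exact: measurable_snd.
Qed.

Section lebesgue_step.
Context {R : realType} (n : nat).
Variable mu : {sigma_finite_measure set 'rV[R]_n -> \bar R}.
Local Open Scope ereal_scope.

Definition lebesgue_step : set 'rV[R]_n.+1 -> \bar R :=
  pushforward (lebesgue_measure \x mu) consv.

Let m : {measure set 'rV[R]_n.+1 -> \bar R} :=
  measure_function_pushforward__canonical__measure_function_Measure
    (lebesgue_measure \x mu) (@measurable_consv _ R n).

Let step0 : lebesgue_step set0 = 0.
Proof. exact: (measure0 m). Qed.

Let step_ge0 A : 0 <= lebesgue_step A.
Proof. exact: (measure_ge0 m). Qed.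

Let step_sigma_additive : semi_sigma_additive lebesgue_step.
Proof. exact: (@measure_semi_sigma_additive _ _ _ m). Qed.

HB.instance Definition _ := isMeasure.Build _ _ _ lebesgue_step
  step0 step_ge0 step_sigma_additive.

Let step_sigma_finite : sigma_finite setT lebesgue_step.
Proof.
have /sigma_finiteP[F [FT ndF Foo]] := sigma_finiteT (@lebesgue_measure R).
have /sigma_finiteP[G [GT ndG Goo]] := sigma_finiteT mu.
pose unconsv (x : 'rV[R]_n.+1) : measurableTypeR R * 'rV[R]_n :=
  (x ord0 ord0, \row_j x ord0 (lift ord0 j)).
have munconsv : measurable_fun setT unconsv.
  apply: measurable_fun_pair; first exact: measurable_coord.
  apply: measurable_fun_rV => j; under eq_fun do rewrite mxE.
  exact: measurable_coord.
have consvK (p : R * 'rV[R]_n) : unconsv (consv p) = p.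
  case: p => t x; rewrite /unconsv /consv mxE unlift_none/=; congr pair.
  by apply/rowP => j; rewrite !mxE liftK.
exists (fun k => unconsv @^-1` (F k `*` G k)).
  apply/esym; rewrite -subTset => x _.
  have [a _ Fa] : (\bigcup_k F k) (unconsv x).1 by rewrite -FT.
  have [b _ Gb] : (\bigcup_k G k) (unconsv x).2 by rewrite -GT.
  exists (maxn a b) => //; split.
  - by move: Fa; exact/subsetPset/ndF/leq_maxl.
  - by move: Gb; exact/subsetPset/ndG/leq_maxr.
move=> k; have [mFk Fk] := Foo k; have [mGk Gk] := Goo k; split.
  by rewrite -[X in measurable X]setTI; apply: munconsv => //; exact: measurableX.
rewrite /lebesgue_step /pushforward (_ : _ @^-1` _ = F k `*` G k); last first.
  by apply/funext => p; rewrite [LHS](congr1 (F k `*` G k) (consvK p)).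
by rewrite product_measure1E// lte_mul_pinfty// ge0_fin_numE.
Qed.

HB.instance Definition _ := @Measure_isSigmaFinite.Build _ _ _ lebesgue_step
  step_sigma_finite.

End lebesgue_step.

(* Lebesgue measure on the product sigma-algebra of R^n: the unit mass at the
   point when n = 0, and then lambda_{n+1} = lambda_1 x lambda_n. *)
Fixpoint lebesgue_rV (R : realType) (n : nat) {struct n} :
    {sigma_finite_measure set 'rV[R]_n -> \bar R} :=
  match n with
  | 0%N => \d_(0 : 'rV[R]_0)
  | n'.+1 => lebesgue_step (lebesgue_rV R n')
  end.

(* The completion of [lebesgue_rV n].  [lebT R n] is 'rV[R]_n with the
   sigma-algebra of the Lebesgue (Caratheodory) measurable sets. *)
Definition lebT (R : realType) (n : nat) :=
  caratheodory_type (mu_ext (lebesgue_rV R n)).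

HB.instance Definition _ (R : realType) (n : nat) :=
  Measurable.on (lebT R n).

Definition leb (R : realType) (n : nat) : set (lebT R n) -> \bar R :=
  @completed_measure_extension _ _ _ (lebesgue_rV R n).

Arguments leb : clear implicits.

HB.instance Definition _ (R : realType) (n : nat) := Measure.on (leb R n).

Section definitions.
Context {R : realType} {n : nat}.
Implicit Types (E A B K Omega : set 'rV[R]_n) (x y : 'rV[R]_n) (s r rho : R).

Definition leb_measurable A : Prop := measurable (A : set (lebT R n)).

(* The norm carried by 'rV[R]_n in the library is the sup norm, which induces
   the same topology and the same bounded sets as the Euclidean one. *)
Definition enorm x : R := Num.sqrt (\sum_(i < n) x ord0 i ^+ 2).

Definition eball x r : set 'rV[R]_n := [set y | enorm (y - x) < r].

(* Used for disjoint A and B only, where x <> y in the integrand. *)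
Definition L_s s A B : \bar R :=
  (\int[leb R n]_(x in A) \int[leb R n]_(y in B)
     ((enorm (x - y) `^ (n%:R + s))^-1)%:E)%E.

Definition P_s s E Omega : \bar R :=
  (L_s s (E `&` Omega) (~` E `&` Omega)
   + L_s s (E `&` Omega) (~` E `\` Omega)
   + L_s s (E `\` Omega) (~` E `&` Omega))%E.

Definition compactly_contained A B : Prop :=
  compact (closure A) /\ closure A `<=` B.

Definition locally_finite_P_s s E Omega : Prop :=
  forall Omega', open Omega' -> compactly_contained Omega' Omega ->
    (P_s s E Omega' < +oo)%E.

Definition cvg_L1loc (Eh : nat -> set 'rV[R]_n) E : Prop :=
  forall K, compact K ->
    (\int[leb R n]_(x in K) (`|\1_(Eh h) x - \1_E x : R|)%:E)%E
      @[h --> \oo] --> 0%E.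

(* Distance to a set, equal to +oo for the empty set. *)
Definition edist_set x A : \bar R := ereal_inf [set (enorm (x - y))%:E | y in A].

Definition tube rho A : set 'rV[R]_n := [set x | (edist_set x A < rho%:E)%E].

Definition topological_boundary A : set 'rV[R]_n := closure A `\` A°.

(* Invariant under modification of E on a null set: it is the topological
   boundary of E for the representative chosen in the identification of sets up
   to measure zero.  For an open set with smooth boundary it coincides with
   [topological_boundary]. *)
Definition measure_boundary E : set 'rV[R]_n :=
  [set x | forall r, 0 < r ->
    (0 < leb R n (E `&` eball x r) < leb R n (eball x r))%E].

Definition basis_vec (i : 'I_n) : 'rV[R]_n := delta_mx ord0 i.

Fixpoint iter_partial (l : seq 'I_n) (f : 'rV[R]_n -> R) : 'rV[R]_n -> R :=
  if l is i :: l' then fun x => 'D_(basis_vec i) (iter_partial l' f) x else f.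

(* C^oo on an open set: the partial derivatives of all orders exist and are
   continuous. *)
Definition smooth_on (U : set 'rV[R]_n) (f : 'rV[R]_n -> R) : Prop :=
  forall (l : seq 'I_n) x, U x ->
    {for x, continuous (iter_partial l f)} /\
    forall i : 'I_n, derivable (iter_partial l f) x (basis_vec i).

(* Near each boundary point, E is a sublevel set {phi < 0} of a smooth function
   with nonvanishing gradient. *)
Definition smooth_boundary E : Prop :=
  forall x, topological_boundary E x ->
    exists (U : set 'rV[R]_n) (phi : 'rV[R]_n -> R),
      [/\ open U, U x, smooth_on U phi,
          forall y, U y -> exists i : 'I_n, 'D_(basis_vec i) phi y != 0 &
          E `&` U = [set y | U y /\ phi y < 0]].

Definition smooth_open E : Prop := open E /\ smooth_boundary E.

Definition approximates s Omega (Eh : nat -> set 'rV[R]_n) E : Prop :=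
  [/\ cvg_L1loc Eh E,
      forall Omega', open Omega' -> compactly_contained Omega' Omega ->
        (ereal_sup (range (fun h => P_s s (Eh h) Omega')) < +oo)%E &
      forall Omega', open Omega' -> compactly_contained Omega' Omega ->
        P_s s (Eh h) Omega' @[h --> \oo] --> P_s s E Omega'].

Definition boundary_within (eps : nat -> R) (Eh : nat -> set 'rV[R]_n) E : Prop :=
  forall h, topological_boundary (Eh h) `<=` tube (eps h) (measure_boundary E).

Definition cvg_measure_perimeter s (Eh : nat -> set 'rV[R]_n) E : Prop :=
  leb R n (Eh h `+` E) @[h --> \oo] --> 0%E /\
  P_s s (Eh h) setT @[h --> \oo] --> P_s s E setT.

End definitions.

(* Main.v *)
Require Import Defs.
From HB Require Import structures.
From mathcomp Require Import all_boot all_order all_algebra.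
From mathcomp Require Import all_classical all_reals all_analysis.
From mathcomp Require Import measurable_realfun.
From mathcomp Require Import lra ring zify.

(** Let [u] be the indicator of [E].  The sets [E_h] are superlevel sets
  [{w > t}] of [w = u_r + sum_i a_i atan(x_i)], where [u_r] is a mollification of
  [u], the vector [a] is small and [1/4 <= t <= 3/4].

  Regular values: a critical point [x] at level [t] determines [(a, t)] as a
  locally Lipschitz function of [x], so the bad pairs are a null subset of
  [R^(n+1)] and for almost every [a] almost every [t] is regular; this replaces
  Sard's theorem.

  Convergence of the perimeters: the jump indicator [1_F(x) (1 - 1_F(y))] of
  [F = {w > t}] differs from that of [E] for a set of levels [t] of measure at
  most [|(w - u)(x) - (w - u)(y)|].  Averaging over [t] bounds the mean difference
  of the perimeters by the Gagliardo seminorm of [w - u], which in turn is bounded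
  by averages over small [z] of the seminorm of [u(. + z) - u].  The latter tends
  to 0: near the diagonal by finiteness of the perimeter of [E] in a larger set,
  far from it by continuity of translations in measure.

  Boundaries: at a boundary point of [F] one has [0 < u_r < 1], so the ball of
  radius [r] meets both [E] and its complement in positive measure, and a segment
  in it has to cross the measure theoretic boundary of [E]. *)

Set Implicit Arguments.
Unset Strict Implicit.
Unset Printing Implicit Defensive.

Import Order.TTheory GRing.Theory Num.Theory.
Import numFieldNormedType.Exports.

Local Open Scope classical_set_scope.
Local Open Scope ring_scope.

(** * Lebesgue measure on R^n *)

(** The perturbation is built from [atan] because three demands meet there. Its gradient has entries
    [a_i / (1 + x_i^2)] with nonvanishing weights, so that [a] can be read off at a critical point.
    It is bounded, so that the superlevel sets keep to [E] far away, which a linear form would not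
    allow. It is Lipschitz, hence its increments are at most a multiple of [min(1, |x - y|)], a
    weight that the kernel integrates thanks to [0 < s < 1]. The obstacle on the whole space is that
    its seminorm is controlled only over sets of finite measure. When [|E|] is finite, [E] and the
    set where [u_r] exceeds 1/8 carry all errors and have finite measure; otherwise the estimates
    are local. One level has to meet all demands at once: regularity and finite perimeter in balls
    hold at almost every level, and closeness in measure and perimeter follows from Markov's
    inequality. The perimeter error is integrated over all pairs with a point in a large set, so one
    estimate serves every smaller [Omega']. The set [E] itself is replaced by a representative in
    the product sigma-algebra, where Tonelli's theorem is available. *)

Section invariant_measures.
Context d (T : measurableType d) (R : realType).
Variables (m : {measure set T -> \bar R}) (phi : T -> T).
Hypothesis mphi : measurable_fun setT phi.
Hypothesis m_inv : forall A, measurable A -> m (phi @^-1` A) = m A.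

Lemma ge0_integral_invariant (f : T -> \bar R) :
  measurable_fun setT f -> (forall x, (0 <= f x)%E) ->
  (\int[m]_x f (phi x) = \int[m]_x f x)%E.
Proof.
move=> mf f0; rewrite -[LHS](ge0_integral_pushforward mphi m measurableT)//.
by apply: eq_measure_integral => A mA _; exact: m_inv.
Qed.

End invariant_measures.

(** The translated measure takes the same values on half-open intervals, and these determine
    Lebesgue measure. *)
Lemma lebesgue_measure_shift (R : realType) (t : R) (A : set R) :
  measurable A -> lebesgue_measure ((fun x => x + t) @^-1` A) = lebesgue_measure A.
Proof.
move=> mA; apply/esym.
have ms : measurable_fun [set: measurableTypeR R] (fun x : measurableTypeR R => x + t : measurableTypeR R).
  exact: measurable_funD.
pose m : {measure set (measurableTypeR R) -> \bar R} :=
  measure_function_pushforward__canonical__measure_function_Measure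
    (@lebesgue_measure R) ms.
apply: (lebesgue_measure_unique (mu := m)) => // X [[a b] /= _ <-].
rewrite /m /= /pushforward.
have -> : (fun x : R => x + t) @^-1` `]a, b]%classic = `]a - t, b - t]%classic.
  apply/seteqP; split => x /=; rewrite !in_itv/=; lra.
rewrite !lebesgue_measure_itv/= !lte_fin ltrD2r; case: ifP => //.
by rewrite -!EFinB => _; congr EFin; ring.
Qed.

Section rV_norm.
Context {R : realType} {n : nat}.
Implicit Types (x y : 'rV[R]_n) (r : R).

Lemma coord_le_norm x i : `|x ord0 i| <= `|x|.
Proof.
rewrite [leRHS]/Num.norm/= mx_normrE.
by apply: (le_bigmax _ (fun ij : 'I_1 * 'I_n => `|x ij.1 ij.2|) (ord0, i)).
Qed.

Lemma rV_norm_leP x r : 0 <= r -> reflect (forall i, `|x ord0 i| <= r) (`|x| <= r).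
Proof.
move=> r0; apply: (iffP idP) => [xr i|H].
  by rewrite (le_trans (coord_le_norm x i)).
rewrite [leLHS]/Num.norm/= mx_normrE; apply/bigmax_leP; split => // -[i j] _ /=.
by rewrite ord1.
Qed.

Lemma rV_norm_ltP x r : 0 < r -> reflect (forall i, `|x ord0 i| < r) (`|x| < r).
Proof.
move=> r0; apply: (iffP idP) => [xr i|H].
  by rewrite (le_lt_trans (coord_le_norm x i)).
rewrite [ltLHS]/Num.norm/= mx_normrE; apply/bigmax_ltP; split => // -[i j] _ /=.
by rewrite ord1.
Qed.

Lemma rV_ballE x r : ball x r = [set y | `|x - y| < r].
Proof. by rewrite -ball_normE. Qed.

End rV_norm.

Section rV_measurable.
Context {R : realType} {n : nat}.

Lemma measurable_box (I : 'I_n -> set R) : (forall i, measurable (I i)) ->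
  measurable [set x : 'rV[R]_n | forall i, I i (x ord0 i)].
Proof.
move=> mI.
have -> : [set x : 'rV[R]_n | forall i, I i (x ord0 i)] =
    \bigcap_(i in [set: 'I_n]) ((fun x : 'rV[R]_n => x ord0 i) @^-1` I i).
  by apply/seteqP; split => [x xI i _|x xI i]; exact: xI.
apply: fin_bigcap_measurable; first exact: finite_finset.
move=> i _; rewrite -[X in measurable X]setTI.
exact: (@measurable_coord _ _ n i).
Qed.

Lemma rV_ball_box (x : 'rV[R]_n) r : 0 < r ->
  ball x r = [set y : 'rV[R]_n | forall i, ball (x ord0 i) r (y ord0 i)].
Proof.
move=> r0; apply/seteqP; split => y.
  by move=> [_ H] i; exact: (H ord0 i).
by move=> H; split => // i j; rewrite ord1; exact: H.
Qed.

Lemma measurable_rV_ball (x : 'rV[R]_n) r : measurable (ball x r).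
Proof.
have [r0|r0] := ltP 0 r; last first.
  rewrite (_ : ball x r = set0)//; apply/seteqP; split => // y [r1].
  by move: r0; rewrite leNgt r1.
rewrite rV_ball_box//; apply: (@measurable_box (fun i => ball (x ord0 i) r)) => i.
exact: measurable_ball.
Qed.

Definition rat_rV (c : 'rV[rat]_n) : 'rV[R]_n := \row_i ratr (c ord0 i).

Lemma rat_rV_near (x : 'rV[R]_n) (r : R) : 0 < r ->
  exists c : 'rV[rat]_n, ball (rat_rV c) r x.
Proof.
move=> r0.
have H i : exists q : rat, `|x ord0 i - ratr q| < r.
  have xr : x ord0 i - r < x ord0 i + r by lra.
  have [q] := rat_in_itvoo xr; rewrite in_itv/= => /andP[q1 q2]; exists q.
  by rewrite ltr_norml; apply/andP; split; lra.
have [f Hf] := choice H.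
exists (\row_i f i); rewrite rV_ballE/=; apply/rV_norm_ltP => // i.
by rewrite !mxE distrC.
Qed.

(** The union is countable, which is what puts open sets into the product sigma-algebra. *)
Lemma open_rV_bigcup (A : set 'rV[R]_n) : open A ->
  A = \bigcup_(p in [set: 'rV[rat]_n * rat])
    (if pselect (ball (rat_rV p.1) (ratr p.2) `<=` A)
     then ball (rat_rV p.1) (ratr p.2) else set0).
Proof.
move=> oA; apply/seteqP; split => [x Ax|x [[c q] _] /=]; last first.
  by case: pselect => // H /H.
have /nbhs_ballP[r /= r0 rA] : nbhs x A by apply: open_nbhs_nbhs.
have r20 : 0 < r / 2 by rewrite divr_gt0.
have [q] := rat_in_itvoo r20; rewrite in_itv/= => /andP[q1 q2].
have [c cx] := rat_rV_near x q1.
exists (c, q) => //=; case: pselect => // -[] y cy.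
apply: rA; apply: (@le_ball _ _ _ (ratr q + ratr q)); first by lra.
by apply: ball_triangle cy; exact: ball_sym.
Qed.

Lemma measurable_open_rV (A : set 'rV[R]_n) : open A -> measurable A.
Proof.
move=> /open_rV_bigcup ->; apply: countable_bigcupT_measurable => //= p.
by case: (pselect _) => H //=; exact: measurable_rV_ball.
Qed.

Lemma measurable_closed_rV (A : set 'rV[R]_n) : closed A -> measurable A.
Proof.
by move=> cA; rewrite -[A]setCK; apply: measurableC; apply: measurable_open_rV;
  rewrite openC.
Qed.

Lemma continuous_measurable_rV (f : 'rV[R]_n -> R) :
  continuous f -> measurable_fun setT f.
Proof.
move=> cf; apply: (measurability _ (RGenOInfty.measurableE R)).
move=> B [_ [x ->] <-]; rewrite setTI; apply: measurable_open_rV.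
by move/continuousP : cf; apply; rewrite set_itvE; exact: open_gt.
Qed.

Lemma measurable_rVD (z : 'rV[R]_n) :
  measurable_fun setT (fun x : 'rV[R]_n => x + z).
Proof.
apply: measurable_fun_rV => i; under eq_fun do rewrite mxE.
by apply: measurable_funD => //; exact: measurable_coord.
Qed.

Lemma measurable_rV_add :
  measurable_fun setT (fun p : 'rV[R]_n * 'rV[R]_n => p.1 + p.2).
Proof.
apply: measurable_fun_rV => i; under eq_fun do rewrite mxE.
apply: measurable_funD; apply: (measurableT_comp (measurable_coord i)).
  exact: measurable_fst.
exact: measurable_snd.
Qed.

Lemma measurable_rV_sub :
  measurable_fun setT (fun p : 'rV[R]_n * 'rV[R]_n => p.1 - p.2).
Proof.
apply: measurable_fun_rV => i; under eq_fun do rewrite !mxE.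
apply: measurable_funB.
  apply: (measurableT_comp (f := fun x : 'rV[R]_n => x ord0 i)) => //.
  exact: measurable_coord.
apply: (measurableT_comp (f := fun x : 'rV[R]_n => x ord0 i)) => //.
exact: measurable_coord.
Qed.

End rV_measurable.

Lemma lebesgue_rV_box (R : realType) (n : nat) (I : 'I_n -> set R) (l : 'I_n -> R) :
  (forall i, measurable (I i)) -> (forall i, lebesgue_measure (I i) = (l i)%:E) ->
  lebesgue_rV R n [set x : 'rV[R]_n | forall i, I i (x ord0 i)] = (\prod_i l i)%:E.
Proof.
elim: n I l => [|n IH] I l mI lI.
  rewrite big_ord0 /= diracE mem_set//=.
  by case.
rewrite big_ord_recl /= /lebesgue_step /pushforward.
have -> : consv @^-1` [set x : 'rV[R]_n.+1 | forall i, I i (x ord0 i)] =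
    I ord0 `*` [set x : 'rV[R]_n | forall i, I (lift ord0 i) (x ord0 i)].
  apply/seteqP; split => -[t x] /=.
    move=> H; split; first by have := H ord0; rewrite mxE unlift_none.
    by move=> i; have := H (lift ord0 i); rewrite mxE liftK.
  move=> [It Ix] i; rewrite mxE; case: unliftP => [j ->|->] //=.
rewrite product_measure1E; first last.
- exact: (@measurable_box _ _ (fun i => I (lift ord0 i))).
- exact: mI.
by rewrite [X in (X * _)%E]lI (IH (fun i => I (lift ord0 i)) (fun i => l (lift ord0 i))).
Qed.

(** Balls of the sup norm are cubes of side [2 r]. *)
Lemma lebesgue_rV_ball (R : realType) (n : nat) (x : 'rV[R]_n) r : 0 < r ->
  lebesgue_rV R n (ball x r) = ((r *+ 2) ^+ n)%:E.
Proof.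
move=> r0; rewrite rV_ball_box// (@lebesgue_rV_box _ _ (fun i => ball (x ord0 i) r) (fun=> r *+ 2)).
- by rewrite prodr_const card_ord.
- by move=> i; exact: measurable_ball.
- by move=> i; rewrite lebesgue_measure_ball// ltW.
Qed.

(** Through [consv] the shift by [z] becomes a shift by the first entry of [z] on the line and by
    the remaining entries on the sections; the induction hypothesis handles the sections, invariance
    on the line the outer integral. *)
Lemma lebesgue_rV_shift (R : realType) (n : nat) (z : 'rV[R]_n) A :
  measurable A ->
  lebesgue_rV R n ((fun x => x + z) @^-1` A) = lebesgue_rV R n A.
Proof.
elim: n z A => [|n IH] z A mA.
  congr (lebesgue_rV R 0 _); apply/seteqP; split => x /=;
    by rewrite (_ : x + z = x)//; apply/rowP => -[].
rewrite /= /lebesgue_step /pushforward.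
set S := consv @^-1` A.
have mS : measurable S.
  by rewrite -[S]setTI; exact: (@measurable_consv _ (measurableTypeR R) n).
pose z' : 'rV[R]_n := \row_j z ord0 (lift ord0 j).
rewrite [LHS]/product_measure1 [RHS]/product_measure1.
have -> : consv @^-1` ((fun x : 'rV[R]_n.+1 => x + z) @^-1` A) =
    [set p : R * 'rV[R]_n | S (p.1 + z ord0 ord0, p.2 + z')].
  apply/seteqP; split => -[t x] /=; rewrite /S/=;
    rewrite (_ : consv _ + z = consv (t + z ord0 ord0, x + z'))//.
    by apply/rowP => i; rewrite !mxE; case: unliftP => [j ->|->] //=; rewrite !mxE.
  by apply/rowP => i; rewrite !mxE; case: unliftP => [j ->|->] //=; rewrite !mxE.
pose F (t : R) := lebesgue_rV R n (xsection S t).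
have mF : measurable_fun setT F by exact: measurable_fun_xsection.
transitivity (\int[lebesgue_measure]_t F (t + z ord0 ord0)%R)%E.
  apply: eq_integral => t _ /=.
  have mX : measurable (xsection S (t + z ord0 ord0 : R)).
    exact: (@measurable_xsection _ _ _ _ S).
  rewrite /F -(IH z' _ mX).
  by congr (lebesgue_rV R n _).
apply: (@ge0_integral_invariant _ (measurableTypeR R) R lebesgue_measure
  (fun t => (t : R) + z ord0 ord0 : measurableTypeR R)) => //.
  exact: (@measurable_funD _ (measurableTypeR R)).
by move=> B mB; exact: lebesgue_measure_shift.
Qed.

Lemma ge0_integral_shift (R : realType) (n : nat) (z : 'rV[R]_n)
    (f : 'rV[R]_n -> \bar R) :
  measurable_fun setT f -> (forall x, (0 <= f x)%E) ->
  (\int[lebesgue_rV R n]_x f (x + z)%R = \int[lebesgue_rV R n]_x f x)%E.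
Proof.
apply: ge0_integral_invariant; first exact: measurable_rVD.
by move=> A mA; exact: lebesgue_rV_shift.
Qed.

(** * Measurable hulls of Caratheodory measurable sets *)

Section caratheodory_approximation.
Context d (T : measurableType d) (R : realType).
Variable m : {sigma_finite_measure set T -> \bar R}.
Local Open Scope measure_scope.
Local Open Scope ereal_scope.

(** The infimum defining the outer measure is attained: intersect coverings whose measures exceed it
    by at most [1 / (k + 1)]. *)
Lemma measurable_hull (A : set T) : m^* A < +oo ->
  exists2 F, measurable F & A `<=` F /\ m F = m^* A.
Proof.
move=> Aoo.
have Afin : m^* A \is a fin_num by rewrite ge0_fin_numE// outer_measure_ge0.
have cov k : exists F, [/\ measurable F, A `<=` F & m F <= m^* A + (k.+1%:R^-1)%:E].
  have k0 : (0 < k.+1%:R^-1 :> R)%R by rewrite invr_gt0.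
  have [_ [B [mB AB] <-] Bk] := lb_ereal_inf_adherent k0 Afin.
  exists (\bigcup_i B i); split => //; first exact: bigcupT_measurable.
  rewrite (le_trans _ (ltW Bk))//.
  by apply: measure_sigma_subadditive => //; exact: bigcupT_measurable.
have [F HF] := choice cov.
exists (\bigcap_k F k); first by apply: bigcapT_measurable => k; case: (HF k).
have AF : A `<=` \bigcap_k F k by move=> x Ax k _; case: (HF k) => _ + _; exact.
split => //; apply/eqP; rewrite eq_le; apply/andP; split; last first.
  rewrite -measurable_mu_extE; first exact: le_outer_measure.
  by apply: bigcapT_measurable => k; case: (HF k).
apply/lee_addgt0Pr => e e0.
have [k ke] : exists k, (k.+1%:R^-1 < e)%R.
  have := near_infty_natSinv_lt (PosNum e0).
  by move=> [k _ /(_ k (leqnn k))]; exists k.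
have [mFk AFk Fk] := HF k.
rewrite (@le_trans _ _ (m (F k)))//; last first.
  by rewrite (le_trans Fk)// leeD2l// lee_fin ltW.
apply: le_measure; rewrite ?inE//; last exact: bigcap_inf.
by apply: bigcapT_measurable => j; case: (HF j).
Qed.

(** On a piece [S i] of finite measure take a hull [F] of the part of [E] in it. Caratheodory's
    criterion for [E], tested on [F] where all terms are finite, shows that [F] minus [E] has outer
    measure 0 and so lies in a null set. Then the pieces are united. *)
Lemma caratheodory_measurable_approx (E : set T) : m^*.-cara.-measurable E ->
  exists F, exists2 Z, measurable F & [/\ measurable Z, m Z = 0, E `<=` F & F `\` E `<=` Z].
Proof.
move=> mE.
have /sigma_finiteP[S [ST ndS Soo]] := sigma_finiteT m.
have H i : exists p : set T * set T, [/\ measurable p.1, measurable p.2,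
    m p.2 = 0, E `&` S i `<=` p.1 & p.1 `\` E `<=` p.2].
  have [mS Sfin] := Soo i.
  have ESoo : m^* (E `&` S i) < +oo.
    rewrite (@le_lt_trans _ _ (m (S i)))// -(measurable_mu_extE m mS).
    by apply: le_outer_measure; exact: subIsetr.
  have [F0 mF0 [EF0 F0E]] := measurable_hull ESoo.
  pose F := F0 `&` S i.
  have mF : measurable F by exact: measurableI.
  have EF : E `&` S i `<=` F by move=> x [Ex Sx]; split => //; exact: EF0.
  have FE : m F = m^* (E `&` S i).
    apply/eqP; rewrite eq_le; apply/andP; split.
      by rewrite -F0E le_measure ?inE//; exact: subIsetl.
    by rewrite -(measurable_mu_extE m mF) le_outer_measure.
  have FI : F `&` E = E `&` S i.
    apply/seteqP; split => [x [[_ Sx] Ex]|x [Ex Sx]]; first by split.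
    by split => //; exact: EF.
  have FD0 : m^* (F `\` E) = 0.
    have : m^* F = m^* (F `&` E) + m^* (F `&` ~` E) := mE F.
    have -> : m^* F = m^* (E `&` S i) by rewrite -FE; exact: measurable_mu_extE.
    rewrite FI.
    have -> : F `&` ~` E = F `\` E by [].
    have : m^* (E `&` S i) \is a fin_num.
      by rewrite ge0_fin_numE// outer_measure_ge0.
    move=> /fineK <-; move: (outer_measure_ge0 m^* (F `\` E)).
    case: (m^* (F `\` E)) => // r _.
    by rewrite -EFinD => -[] /eqP; rewrite addrC -subr_eq subrr => /eqP <-.
  have [|G mG [FG G0]] := @measurable_hull (F `\` E); first by rewrite FD0.
  by exists (F, G); split => //=; rewrite G0.
have [p Hp] := choice H.
exists (\bigcup_i (p i).1), (\bigcup_i (p i).2).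
  by apply: bigcupT_measurable => i; case: (Hp i).
split.
- by apply: bigcupT_measurable => i; case: (Hp i).
- apply: measure_negligible.
    by apply: bigcupT_measurable => i; case: (Hp i).
  apply: negligible_bigcup => i; exists (p i).2; split => //; by case: (Hp i).
- move=> x Ex; have : [set: T] x by [].
  rewrite ST => -[i _ Sx]; exists i => //; case: (Hp i) => _ _ _ H1 _.
  by apply: H1; split.
- by move=> x [[i _ px] Ex]; exists i => //; case: (Hp i) => _ _ _ _; apply.
Qed.

Lemma mu_ext_eq_mod_null (A B Z : set T) : measurable Z -> m Z = 0 ->
  A `+` B `<=` Z -> m^* A = m^* B.
Proof.
move=> mZ Z0; rewrite -(measurable_mu_extE m mZ) in Z0.
suff H : forall X Y : set T, X `\` Y `<=` Z -> m^* X <= m^* Y.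
  move=> ABZ; apply/eqP; rewrite eq_le !H//.
    by apply: subset_trans ABZ; exact: subsetUr.
  by apply: subset_trans ABZ; exact: subsetUl.
move=> X Y XYZ; rewrite -[leRHS]adde0 -Z0.
rewrite (le_trans _ (outer_measureU2 _ _ _))//.
apply: le_outer_measure => x Xx; have [Yx|Yx] := pselect (Y x); first by left.
by right; exact: XYZ.
Qed.

End caratheodory_approximation.

(** * Comparison of the completed measure [leb] with [mu] *)

Section leb_mu.
Context {R : realType} {n : nat}.
Notation mu := (lebesgue_rV R n).
Local Open Scope ereal_scope.

Lemma measurable_lebT (A : set 'rV[R]_n) : measurable A -> leb_measurable A.
Proof. by move=> mA; apply: caratheodory_measurable_mu_ext. Qed.

Lemma lebE (A : set 'rV[R]_n) : measurable A -> leb R n A = mu A.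
Proof. by move=> mA; rewrite -[RHS]measurable_mu_extE. Qed.

Lemma leb_eq_mod_null (A B Z : set 'rV[R]_n) : measurable Z -> mu Z = 0 ->
  A `+` B `<=` Z -> leb R n A = leb R n B.
Proof. exact: mu_ext_eq_mod_null. Qed.

Lemma measurable_fun_id_lebT :
  measurable_fun setT (id : lebT R n -> 'rV[R]_n).
Proof. by move=> _ A mA; rewrite setTI; exact: measurable_lebT. Qed.

(** The identity from [lebT] to the product sigma-algebra is measurable and carries [leb] to
    [mu]. *)
Lemma ge0_integral_leb (D : set 'rV[R]_n) (f : 'rV[R]_n -> \bar R) :
  measurable D -> measurable_fun setT f -> (forall x, 0 <= f x) ->
  \int[leb R n]_(x in D) f x = \int[mu]_(x in D) f x.
Proof.
move=> mD mf f0.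
rewrite -[LHS](@ge0_integral_pushforward _ _ (lebT R n) 'rV[R]_n R id
  measurable_fun_id_lebT (leb R n) D f)//; last exact: measurable_funTS.
pose m : {measure set 'rV[R]_n -> \bar R} :=
  measure_function_pushforward__canonical__measure_function_Measure
    (leb R n) measurable_fun_id_lebT.
apply: (@eq_measure_integral _ _ _ D mu m f) => A mA _.
exact: (lebE mA).
Qed.

(** Lets a Lebesgue measurable domain be exchanged for a representative in the product
    sigma-algebra. *)
Lemma ge0_integral_leb_mod_null (A B Z : set 'rV[R]_n) (f : 'rV[R]_n -> \bar R) :
  leb_measurable A -> measurable B -> measurable Z -> mu Z = 0 -> A `+` B `<=` Z ->
  measurable_fun setT f -> (forall x, 0 <= f x) ->
  \int[leb R n]_(x in A) f x = \int[mu]_(x in B) f x.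
Proof.
move=> mA mB mZ Z0 ABZ mf f0; rewrite -ge0_integral_leb//.
have mZ' := measurable_lebT mZ; have mB' := measurable_lebT mB.
have Z0' : leb R n Z = 0 by rewrite lebE.
have mf' : measurable_fun setT (f : lebT R n -> \bar R).
  exact: (measurableT_comp mf measurable_fun_id_lebT).
rewrite (ge0_negligible_integral mZ')//; last exact: measurable_funTS.
rewrite [RHS](ge0_negligible_integral mZ')//; last exact: measurable_funTS.
congr (\int[_]_(x in _) _); apply/seteqP; split => x [Ax Zx]; split => //.
  by apply: contrapT => Bx; apply: Zx; apply: ABZ; left.
by apply: contrapT => Bx; apply: Zx; apply: ABZ; right.
Qed.

End leb_mu.

(** * The kernel *)

Lemma ge0_le_integralT d (T : measurableType d) (R : realType)
    (m : {measure set T -> \bar R}) (D : set T) (f g : T -> \bar R) :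
  measurable D -> measurable_fun setT f -> measurable_fun setT g ->
  (forall x, 0 <= f x)%E -> (forall x, D x -> f x <= g x)%E ->
  (\int[m]_(x in D) f x <= \int[m]_(x in D) g x)%E.
Proof.
move=> mD mf mg f0 fg; apply: ge0_le_integral => //; exact: measurable_funTS.
Qed.

Lemma nneseries_geometric_lty (R : realType) (c q : R) : 0 <= c -> 0 <= q < 1 ->
  (\sum_(0 <= j <oo) (c * q ^+ j)%:E < +oo)%E.
Proof.
move=> c0 /andP[q0 q1].
have H : (fun k => \sum_(0 <= j < k) (c * q ^+ j)%:E)%E @ \oo --> (c / (1 - q))%:E.
  rewrite (_ : (fun k => _) = EFin \o series (geometric c q)); last first.
    by apply/funext => k; rewrite /= /series/= sumEFin.
  apply: cvg_EFin; first exact: nearW.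
  by apply: cvg_geometric_series; rewrite ger0_norm.
by rewrite (cvg_lim _ H)// ltry.
Qed.

Section kernel.
Context {R : realType} {n : nat}.
Implicit Types (x y z : 'rV[R]_n) (s r : R).

(** The integrand of [L_s] at [z = x - y]. For [s > 0] it vanishes at the origin, by the conventions
    for powers and inverses of 0. *)
Definition kern s z : R := (enorm z `^ (n%:R + s))^-1.

Lemma enorm_ge0 z : 0 <= enorm z.
Proof. exact: sqrtr_ge0. Qed.

Lemma enormN z : enorm (- z) = enorm z.
Proof.
by rewrite /enorm; congr Num.sqrt; apply: eq_bigr => i _; rewrite mxE sqrrN.
Qed.

Lemma enorm_subC x y : enorm (x - y) = enorm (y - x).
Proof. by rewrite -enormN opprB. Qed.

Lemma le_norm_enorm z : `|z| <= enorm z.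
Proof.
apply/rV_norm_leP => [|i]; first exact: enorm_ge0.
rewrite -sqrtr_sqr; apply: ler_wsqrtr.
rewrite (bigD1 i)//= lerDl; apply: sumr_ge0 => j _; exact: sqr_ge0.
Qed.

Lemma enorm_le_norm z : enorm z <= n%:R * `|z|.
Proof.
rewrite -[leRHS]ger0_norm ?mulr_ge0// -sqrtr_sqr; apply: ler_wsqrtr.
apply: (@le_trans _ _ (\sum_(i < n) `|z| ^+ 2)).
  apply: ler_sum => i _; rewrite -[leLHS]real_normK ?num_real//.
  by rewrite ler_sqr ?nnegrE//; exact: coord_le_norm.
rewrite sumr_const card_ord exprMn -[leLHS]mulr_natl ler_wpM2r ?sqr_ge0//.
by rewrite -natrX ler_nat; case: (n) => // k; rewrite leq_pmull.
Qed.

Lemma measurable_enorm : measurable_fun setT (@enorm R n).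
Proof.
rewrite /enorm; apply: (measurableT_comp (f := @Num.sqrt R)) => //.
  exact: continuous_measurable_fun (@sqrt_continuous R).
apply: measurable_sum => i; apply: measurable_funX; exact: measurable_coord.
Qed.

Lemma measurable_kern s : measurable_fun setT (kern s).
Proof.
rewrite /kern; under eq_fun do rewrite -powRN.
exact: (measurableT_comp (measurable_powR _) measurable_enorm).
Qed.

Lemma kern_ge0 s z : 0 <= kern s z.
Proof. by rewrite invr_ge0 powR_ge0. Qed.

Lemma kernN s z : kern s (- z) = kern s z.
Proof. by rewrite /kern enormN. Qed.

Lemma kern_subC s x y : kern s (x - y) = kern s (y - x).
Proof. by rewrite -kernN opprB. Qed.

Lemma kern_le s r z : 0 <= s -> 0 < r -> r <= `|z| ->
  kern s z <= (r `^ (n%:R + s))^-1.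
Proof.
move=> s0 r0 rz; have rez := le_trans rz (le_norm_enorm z).
rewrite /kern lef_pV2 ?posrE ?powR_gt0//; last exact: lt_le_trans rez.
apply: ge0_ler_powR; rewrite ?nnegrE ?addr_ge0 ?enorm_ge0//; exact: ltW.
Qed.

Notation mu := (lebesgue_rV R n).

Let kern_small s j z : 0 < s -> z != 0 -> (2^-1) ^+ j.+1 <= `|z| ->
  kern s z <= (((2^-1) `^ (n%:R + s))^-1) ^+ j.+1.
Proof.
move=> s0 z0 jz; rewrite (le_trans (kern_le (ltW s0) _ jz)) ?exprn_gt0//.
by rewrite -powR_mulrn// powRAC powR_mulrn ?powR_ge0// exprVn.
Qed.

Let kern_large s j z : 0 < s -> 2 ^+ j <= `|z| ->
  kern s z <= ((2 `^ (n%:R + s))^-1) ^+ j.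
Proof.
move=> s0 jz; rewrite (le_trans (kern_le (ltW s0) _ jz)) ?exprn_gt0//.
by rewrite -powR_mulrn// powRAC powR_mulrn ?powR_ge0// exprVn.
Qed.

(** Dyadic shells. The shell of inner radius [2^-(j+1)] contributes at most a constant times
    [(2^-(1-s))^j], that of inner radius [2^j] at most a constant times [(2^-s)^j]. The first series
    converges because [s < 1], the second because [s > 0]. *)
Lemma kern_integral_lty s : 0 < s -> s < 1 ->
  (\int[mu]_z (Num.min 1 `|z| * kern s z)%:E < +oo)%E.
Proof.
move=> s0 s1.
pose h : R := 2^-1.
pose P := ((h `^ (n%:R + s))^-1); pose Q := ((2 `^ (n%:R + s))^-1) : R.
have P0 : 0 <= P by rewrite invr_ge0 powR_ge0.
have Q0 : 0 <= Q by rewrite invr_ge0 powR_ge0.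
(* [a j] bounds the integrand where [h^(j+1) <= |z| < h^j], and [b j] where [2^j <= |z| < 2^(j+1)].
   The functions [f j] and [g j] spread these bounds over full balls, whose measures are known. *)
pose a j := (h ^+ j * P ^+ j.+1); pose b j := Q ^+ j.
have a0 j : 0 <= a j by rewrite mulr_ge0// exprn_ge0// invr_ge0.
have b0 j : 0 <= b j by rewrite exprn_ge0.
pose f j (z : 'rV[R]_n) : \bar R := (a j * \1_(ball (0 : 'rV[R]_n) (h ^+ j)) z)%:E.
pose g j (z : 'rV[R]_n) : \bar R := (b j * \1_(ball (0 : 'rV[R]_n) (2 ^+ j.+1)) z)%:E.
have mb r : measurable (ball (0 : 'rV[R]_n) r) by exact: measurable_rV_ball.
have mf j : measurable_fun setT (f j).
  by apply/measurable_EFinP/measurable_funM => //; exact: measurable_indic.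
have mg j : measurable_fun setT (g j).
  by apply/measurable_EFinP/measurable_funM => //; exact: measurable_indic.
have f0 j z : (0 <= f j z)%E by rewrite lee_fin mulr_ge0.
have g0 j z : (0 <= g j z)%E by rewrite lee_fin mulr_ge0.
have mnorm : measurable_fun setT (fun z : 'rV[R]_n => `|z|).
  by apply: continuous_measurable_rV; exact: norm_continuous.
have mk : measurable_fun setT (fun z => (Num.min 1 `|z| * kern s z)%:E).
  apply/measurable_EFinP/measurable_funM; last exact: measurable_kern.
  exact: measurable_minr.
have mfs : measurable_fun setT (fun z => \sum_(0 <= j <oo) f j z)%E.
  by apply: ge0_emeasurable_sum => // *; exact: f0.
have mgs : measurable_fun setT (fun z => \sum_(0 <= j <oo) g j z)%E.
  by apply: ge0_emeasurable_sum => // *; exact: g0.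
have fs0 z : (0 <= \sum_(0 <= j <oo) f j z)%E by apply: nneseries_ge0.
have gs0 z : (0 <= \sum_(0 <= j <oo) g j z)%E by apply: nneseries_ge0.
have single (u : nat -> \bar R) k : (forall j, 0 <= u j)%E ->
    (u k <= \sum_(0 <= j <oo) u j)%E.
  move=> u0; rewrite (le_trans _ (nneseries_lim_ge k.+1 _))//.
  by rewrite big_nat_recr//= leeDr// sume_ge0.
apply: (@le_lt_trans _ _ (\int[mu]_z (\sum_(0 <= j <oo) f j z + \sum_(0 <= j <oo) g j z))%E).
  apply: ge0_le_integralT => //.
  - exact: emeasurable_funD.
  - by move=> z; rewrite lee_fin mulr_ge0// ?kern_ge0// le_min ler01 normr_ge0.
  move=> z _; have [->|z0] := eqVneq z 0.
    by rewrite normr0 min_r// mul0r adde_ge0.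
  have nz0 : 0 < `|z| by rewrite normr_gt0.
  have [z1|z1] := ltP `|z| 1.
    have ex : exists j, h ^+ j <= `|z|.
      have : geometric 1 h @ \oo --> (0 : R).
        by apply: cvg_geometric; rewrite ger0_norm /h; lra.
      move=> /cvgr0_norm_le /(_ _ nz0) [j _ /(_ j (leqnn j))] /= H; exists j.
      by move: H; rewrite mul1r ger0_norm// exprn_ge0// /h invr_ge0.
    case: (ex_minnP ex) => -[|j] hj jmin.
      by move: hj; rewrite expr0 leNgt z1.
    have zj : `|z| < h ^+ j.
      by rewrite ltNge; apply/negP => /jmin; rewrite ltnn.
    rewrite (@le_trans _ _ (f j z))//; last first.
      by rewrite (le_trans (single (f ^~ z) j _))// leeDl.
    rewrite lee_fin indicE mem_set ?mulr1; last by rewrite rV_ballE/= sub0r normrN.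
    by apply: ler_pM => //; [exact: kern_ge0|exact: ltW|exact: kern_small].
  have ex : exists j, `|z| < 2 ^+ j.+1.
    exists (Num.truncn `|z|).
    rewrite (lt_le_trans (truncnS_gt _))// -natrX ler_nat.
    exact/ltnW/ltn_expl.
  case: (ex_minnP ex) => j zj jmin.
  have zj' : 2 ^+ j <= `|z|.
    case: j zj jmin => [_ _|j zj jmin]; first by rewrite expr0.
    by rewrite leNgt; apply/negP => /jmin; rewrite ltnn.
  rewrite mul1r (@le_trans _ _ (g j z))//; last first.
    by rewrite (le_trans (single (g ^~ z) j _))// leeDr.
  rewrite lee_fin indicE mem_set ?mulr1; last by rewrite rV_ballE/= sub0r normrN.
  exact: kern_large.
rewrite ge0_integralD// !integral_nneseries//.
have Ib r : 0 < r -> (\int[mu]_x (\1_(ball (0 : 'rV[R]_n) r) x)%:E = ((r *+ 2) ^+ n)%:E)%E.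
  by move=> r0; rewrite integral_indic// setIT; exact: lebesgue_rV_ball.
have If j : (\int[mu]_z f j z = (2 ^+ n * P * (h `^ (1 - s)) ^+ j)%:E)%E.
  rewrite /f; under eq_integral do rewrite EFinM.
  rewrite ge0_integralZl_EFin//; last exact/measurable_EFinP/measurable_indic.
  rewrite Ib; last by rewrite exprn_gt0// invr_gt0.
  have h0 : 0 < h by rewrite /h invr_gt0.
  have hp : h `^ (1 - s) = h * h ^+ n * P.
    transitivity (h `^ 1 * h `^ n%:R * h `^ (- (n%:R + s))).
      rewrite -!powRD; first by congr (_ `^ _); ring.
        by apply/implyP => _; rewrite gt_eqF.
      by apply/implyP => _; rewrite gt_eqF.
    by rewrite powRr1 ?powR_mulrn ?powRN// ltW.
  rewrite -EFinM; congr EFin; rewrite /a hp exprS.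
  have -> : h ^+ j *+ 2 = 2 * h ^+ j by rewrite mulr_natl.
  rewrite !exprMn [(h ^+ j) ^+ n]exprAC; ring.
have Ig j : (\int[mu]_z g j z = (4 ^+ n * (2 `^ (- s)) ^+ j)%:E)%E.
  rewrite /g; under eq_integral do rewrite EFinM.
  rewrite ge0_integralZl_EFin//; last exact/measurable_EFinP/measurable_indic.
  rewrite Ib ?exprn_gt0//.
  have hp : 2 `^ (- s) = 2 ^+ n * Q.
    transitivity ((2 : R) `^ n%:R * 2 `^ (- (n%:R + s))).
      rewrite -!powRD; first by congr (_ `^ _); ring.
      by apply/implyP => _; rewrite gt_eqF.
    by rewrite powR_mulrn ?powRN.
  rewrite -EFinM; congr EFin; rewrite /b hp exprS.
  have -> : 2 * 2 ^+ j *+ 2 = 4 * 2 ^+ j :> R by rewrite -[LHS]mulr_natl; ring.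
  rewrite !exprMn [(2 ^+ j) ^+ n]exprAC; ring.
under eq_eseriesr do rewrite If.
under [X in (_ + X < _)%E]eq_eseriesr do rewrite Ig.
have h01 : 0 < h < 1 by rewrite /h; lra.
have /andP[h0 h1] := h01.
rewrite lte_add_pinfty//.
  apply: nneseries_geometric_lty; first by rewrite mulr_ge0// exprn_ge0.
  rewrite powR_ge0 -[ltRHS](powRr0 h) /=.
  by rewrite /powR gt_eqF// ltr_expR ltr_nM2r ?subr_gt0// ln_lt0.
apply: nneseries_geometric_lty; first by rewrite exprn_ge0.
rewrite powR_ge0 /= powRN invf_lt1 ?powR_gt0//.
by rewrite /powR pnatr_eq0/= -[ltLHS]expR0 ltr_expR mulr_gt0// ln_gt0// ltr1n.
Qed.

(** Where [r <= |z|] the weight [Num.min 1 |z|] is at least [Num.min 1 r], so the previous integral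
    divided by this constant is a bound. *)
Lemma kern_far_integral_lty s r : 0 < s -> s < 1 -> 0 < r ->
  exists C : R, 0 <= C /\
  (\int[mu]_z (\1_[set z : 'rV[R]_n | (r <= `|z|)%R] z * kern s z)%:E <= C%:E)%E.
Proof.
move=> s0 s1 r0.
pose c := Num.min 1 r.
have c0 : 0 < c by rewrite lt_min ltr01.
have mnorm : measurable_fun setT (fun z : 'rV[R]_n => `|z|).
  by apply: continuous_measurable_rV; exact: norm_continuous.
have mS : measurable [set z : 'rV[R]_n | (r <= `|z|)%R].
  rewrite (_ : mkset _ = (fun z : 'rV[R]_n => `|z|) @^-1` `[r, +oo[%classic).
    by rewrite -[X in measurable X]setTI; exact: mnorm.
  by apply/seteqP; split => z /=; rewrite in_itv/= andbT.
have mk : measurable_fun setT (fun z => (Num.min 1 `|z| * kern s z)%:E).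
  apply/measurable_EFinP/measurable_funM; last exact: measurable_kern.
  exact: measurable_minr.
have fin : (\int[mu]_z (Num.min 1 `|z| * kern s z)%:E \is a fin_num)%E.
  rewrite ge0_fin_numE ?kern_integral_lty//; apply: integral_ge0 => z _.
  by rewrite lee_fin mulr_ge0// ?kern_ge0// le_min ler01 normr_ge0.
exists (c^-1 * fine (\int[mu]_z (Num.min 1 `|z| * kern s z)%:E)%E); split.
  rewrite mulr_ge0 ?invr_ge0 ?(ltW c0)// fine_ge0// integral_ge0// => z _.
  by rewrite lee_fin mulr_ge0// ?kern_ge0// le_min ler01 normr_ge0.
rewrite EFinM fineK// -ge0_integralZl_EFin//; last 2 first.
- by move=> z _; rewrite lee_fin mulr_ge0// ?kern_ge0// le_min ler01 normr_ge0.
- by rewrite invr_ge0 ltW.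
apply: ge0_le_integralT => //.
- apply/measurable_EFinP/measurable_funM; last exact: measurable_kern.
  exact: measurable_indic.
- exact: measurable_funeM.
- by move=> z; rewrite lee_fin mulr_ge0// kern_ge0.
move=> z _; rewrite -EFinM lee_fin mulrA ler_wpM2r ?kern_ge0//.
rewrite indicE; have [/set_mem/= rz|_] /= := boolP (_ \in _).
  rewrite ler_pdivlMl// mulr1 le_min; apply/andP; split; first by rewrite ge_min lexx.
  by rewrite ge_min rz orbT.
by rewrite mulr_ge0// ?invr_ge0 ?(ltW c0)// le_min ler01 normr_ge0.
Qed.

End kernel.

(** * Continuity of translations *)

Lemma cvg_ereal_lt (R : realType) (u : nat -> \bar R) (l e : \bar R) :
  u @ \oo --> l -> (l < e)%E -> exists N, forall k, (N <= k)%N -> (u k < e)%E.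
Proof.
move=> ul le; have [N _ HN] : \forall k \near \oo, (u k < e)%E.
  by apply: (ul [set x | (x < e)%E]); apply: open_nbhs_nbhs; split => //;
    exact: open_ereal_lt_ereal.
by exists N => k; exact: HN.
Qed.

Section shift_continuity.
Context {R : realType} {n : nat}.
Notation mu := (lebesgue_rV R n).
Implicit Types (A : set 'rV[R]_n) (z : 'rV[R]_n).
Local Open Scope ereal_scope.

(** The symmetric difference of [A - z] and [A], that is, the set where the indicator of [A] changes
    under the shift by [z]. *)
Definition shiftD A z : set 'rV[R]_n := ((fun x => (x + z)%R) @^-1` A) `+` A.

Lemma measurable_shift A z : measurable A -> measurable ((fun x => (x + z)%R) @^-1` A).
Proof. by move=> mA; rewrite -[X in measurable X]setTI; exact: measurable_rVD. Qed.

Lemma measurable_shiftD A z : measurable A -> measurable (shiftD A z).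
Proof.
move=> mA; have mz := measurable_shift z mA.
by apply: measurableU; apply: measurableD.
Qed.

(** The statement is localised to balls so that it passes to complements. Measurability is part of
    it, as the induction over the sigma-algebra has to carry it along. *)
Let shift_cont A := measurable A /\ forall M e : R, (0 < M)%R -> (0 < e)%R ->
  exists2 r : R, (0 < r)%R &
    forall z, (`|z| < r)%R -> mu (shiftD A z `&` ball (0%R : 'rV[R]_n) M) < e%:E.

Let mball (M : R) : measurable (ball (0%R : 'rV[R]_n) M).
Proof. exact: measurable_rV_ball. Qed.

Let shift_cont_set0 : shift_cont set0.
Proof.
split; first exact: measurable0.
move=> M e M0 e0; exists 1%R => // z _; rewrite (_ : _ `&` _ = set0) ?measure0//.
by apply/seteqP; split => // x [[[]|[]]].
Qed.

Let shift_contC A : shift_cont A -> shift_cont (~` A).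
Proof.
move=> [mA HA]; split; first exact: measurableC.
move=> M e M0 e0; have [r r0 Hr] := HA M e M0 e0; exists r => // z zr.
rewrite (_ : shiftD (~` A) z = shiftD A z); first exact: Hr.
rewrite /shiftD; apply/seteqP; split => x /= [[H1 H2]|[H1 H2]].
- by right; split => //; exact: contrapT.
- by left; split => //; exact: contrapT.
- by right; split => //; exact: contrapT.
- by left; split => //; exact: contrapT.
Qed.

Let shift_contU A B : shift_cont A -> shift_cont B -> shift_cont (A `|` B).
Proof.
move=> [mA HA] [mB HB]; split; first exact: measurableU.
move=> M e M0 e0; have e20 : (0 < e / 2)%R by rewrite divr_gt0.
have [r r0 Hr] := HA M _ M0 e20; have [q q0 Hq] := HB M _ M0 e20.
exists (Num.min r q); first by rewrite lt_min r0.
move=> z; rewrite lt_min => /andP[zr zq].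
have mAz := measurable_shiftD z mA; have mBz := measurable_shiftD z mB.
have mABz := measurable_shiftD z (measurableU _ _ mA mB).
rewrite (@le_lt_trans _ _ (mu ((shiftD A z `&` ball (0%R : 'rV[R]_n) M) `|`
    (shiftD B z `&` ball (0%R : 'rV[R]_n) M))))//.
  apply: le_measure; rewrite ?inE.
  - exact: measurableI.
  - by apply: measurableU; exact: measurableI.
  rewrite -setIUl; apply: setSI; rewrite /shiftD => x /=; tauto.
rewrite (le_lt_trans (measureU2 _ _ _))//; [exact: measurableI..|].
rewrite (_ : e%:E = (e / 2)%:E + (e / 2)%:E); last by rewrite -EFinD -splitr.
by rewrite lteD// ?Hr ?Hq.
Qed.

(** The union differs from the first [N] sets by a remainder [G N] that is small in a ball by
    continuity from above; the remainder adds at most itself and its translate to the symmetric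
    difference. *)
Let shift_cont_bigcup (F : (set 'rV[R]_n)^nat) : (forall k, shift_cont (F k)) ->
  shift_cont (\bigcup_k F k).
Proof.
move=> HF.
have mF k : measurable (F k) by case: (HF k).
have mU : measurable (\bigcup_k F k) by exact: bigcupT_measurable.
split => // M e M0 e0; have e30 : (0 < e / 3)%R by rewrite divr_gt0.
pose G N := \bigcup_k F k `\` \bigcup_(k < N) F k.
have HN N : shift_cont (\bigcup_(k < N) F k).
  elim: N => [|N IH]; first by rewrite bigcup_mkord big_ord0; exact: shift_cont_set0.
  by rewrite bigcup_mkord big_ord_recr/= -bigcup_mkord; exact: shift_contU.
have mN N : measurable (\bigcup_(k < N) F k) by case: (HN N).
have mG N : measurable (G N) by exact: measurableD.
(* The radius [M + 1] leaves room for [x + z] when [|x| < M] and [|z| < 1]. *)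
have M10 : (0 < M + 1)%R by rewrite addr_gt0.
have [N NG] : exists N, mu (G N `&` ball (0%R : 'rV[R]_n) (M + 1)%R) < (e / 3)%:E.
  pose H N := G N `&` ball (0%R : 'rV[R]_n) (M + 1)%R.
  have Hcvg : mu \o H @ \oo --> mu (\bigcap_N H N).
    apply: nonincreasing_cvg_mu.
    - rewrite (@le_lt_trans _ _ (mu (ball (0%R : 'rV[R]_n) (M + 1)%R)))//.
        by apply: le_measure; rewrite ?inE//; [exact: measurableI|exact: subIsetr].
      by rewrite lebesgue_rV_ball// ltry.
    - by move=> k; exact: measurableI.
    - by apply: bigcapT_measurable => k; exact: measurableI.
    - move=> a b ab; apply/subsetPset; apply: setSI => x [Ux Nx]; split => //.
      by apply: contra_not Nx => -[k /= ka Fk]; exists k => //=; exact: leq_trans ka ab.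
  have H0 : \bigcap_N H N = set0.
    apply/seteqP; split => // x Hx.
    have [[[k _ Fkx] _] _] := Hx 0%N I.
    by have [[_ Nx] _] := Hx k.+1 I; apply: Nx; exists k => /=.
  rewrite H0 measure0 in Hcvg.
  have [|N HN'] := cvg_ereal_lt Hcvg (e := (e / 3)%:E); first by rewrite lte_fin.
  by exists N; exact: HN'.
have [r r0 Hr] := (HN N).2 M _ M0 e30.
exists (Num.min r 1%R); first by rewrite lt_min r0 ltr01.
move=> z; rewrite lt_min => /andP[zr z1].
pose G' := G N `&` ball (0%R : 'rV[R]_n) (M + 1)%R.
have mG' : measurable G' by exact: measurableI.
have mNz := measurable_shiftD z (mN N).
have mUz := measurable_shiftD z mU.
rewrite (@le_lt_trans _ _ (mu ((shiftD (\bigcup_(k < N) F k) z `&` ball (0%R : 'rV[R]_n) M) `|`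
    (((fun x => (x + z)%R) @^-1` G') `|` G'))))//.
  apply: le_measure; rewrite ?inE.
  - exact: measurableI.
  - apply: measurableU; first exact: measurableI.
    by apply: measurableU => //; exact: measurable_shift.
  rewrite rV_ballE => x [xU /=]; rewrite sub0r normrN => xM.
  have b1 : ball (0%R : 'rV[R]_n) (M + 1)%R x.
    by rewrite rV_ballE/= sub0r normrN ltr_wpDr.
  have b2 : ball (0%R : 'rV[R]_n) (M + 1)%R (x + z)%R.
    by rewrite rV_ballE/= sub0r normrN (le_lt_trans (ler_normD _ _))// ltrD.
  have [Nx|Nx] := pselect ((\bigcup_(k < N) F k) x);
      have [Nxz|Nxz] := pselect ((\bigcup_(k < N) F k) (x + z)%R).
  - case: xU => -[H1 H2]; exfalso; apply: H2.
      by case: Nx => k _ Fk; exists k.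
    by case: Nxz => k _ Fk; exists k.
  - by left; split; [right|].
  - by left; split; [left|].
  - by right; case: xU => -[H1 H2]; [left|right].
rewrite (le_lt_trans (measureU2 _ _ _))//.
  exact: measurableI.
  by apply: measurableU => //; exact: measurable_shift.
rewrite (_ : e%:E = (e / 3)%:E + ((e / 3)%:E + (e / 3)%:E)); last first.
  by rewrite -!EFinD; congr EFin; lra.
rewrite lteD ?Hr// (le_lt_trans (measureU2 _ _ _))//; first exact: measurable_shift.
by apply: lteD => //; rewrite (_ : _ ((fun x : 'rV[R]_n => _) @^-1` G') = mu G')//; exact: lebesgue_rV_shift.
Qed.

(** Points of the ball at which the shift matters lie in a slab of half width [r] around the
    hyperplane [x_i = c]. *)
Let shift_cont_halfspace (i : 'I_n) (c : R) :
  shift_cont [set x : 'rV[R]_n | (c < x ord0 i)%R].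
Proof.
have mH : measurable [set x : 'rV[R]_n | (c < x ord0 i)%R].
  rewrite (_ : mkset _ = (fun x : 'rV[R]_n => x ord0 i) @^-1` `]c, +oo[%classic).
    by rewrite -[X in measurable X]setTI; apply: measurable_coord.
  by apply/seteqP; split => x /=; rewrite in_itv/= andbT.
split => // M e M0 e0.
pose C := (\prod_(j < n | j != i) (M *+ 2))%R.
have C0 : (0 <= C)%R by apply: prodr_ge0 => j _; rewrite mulrn_wge0// ltW.
(* [C] is the measure of the cross section of the slab; its total measure [2 r C] is then at most
   [e / 2]. *)
pose r := (e / (4 * (C + 1)))%R.
have r0 : (0 < r)%R by rewrite divr_gt0// mulr_gt0// ltr_wpDl.
exists r => // z zr.
pose I j : set R := if j == i then ball c r else ball 0%R M.
have mI j : measurable (I j) by rewrite /I; case: ifP => _; exact: measurable_ball.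
have mbox : measurable [set x : 'rV[R]_n | forall j, I j (x ord0 j)].
  exact: measurable_box.
rewrite (@le_lt_trans _ _ (mu [set x : 'rV[R]_n | forall j, I j (x ord0 j)]))//.
  apply: le_measure; rewrite ?inE//.
    by apply: measurableI => //; exact: measurable_shiftD.
  move=> x [xS]; rewrite rV_ballE/= sub0r normrN => xM j.
  rewrite /I; case: eqP => [->|_].
    rewrite -ball_normE/= ltr_norml.
    have := coord_le_norm z i; move/le_lt_trans => /(_ _ zr).
    move: xS; rewrite /shiftD/= !mxE ltr_norml => xS /andP[z1 z2].
    by case: xS => -[H1 /negP]; rewrite -leNgt => H2; apply/andP; split; lra.
  by rewrite -ball_normE/= sub0r normrN (le_lt_trans (coord_le_norm _ _)).
rewrite (@lebesgue_rV_box _ _ I (fun j => if j == i then r *+ 2 else M *+ 2)%R)//.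
  rewrite (bigD1 i)//= eqxx lte_fin.
  rewrite (eq_bigr (fun=> (M *+ 2)%R)); last by move=> j /negbTE ->.
  rewrite -/C /r -mulr_natl.
  have C1 : (C / (C + 1) < 1)%R by rewrite ltr_pdivrMr ?mul1r ?ltrDl// ltr_wpDl.
  rewrite (_ : 2 * (e / (4 * (C + 1))) * C = e / 2 * (C / (C + 1)))%R; last first.
    by field; rewrite gt_eqF// ltr_wpDl.
  rewrite (@le_lt_trans _ _ (e / 2 * 1)%R)//; last by lra.
  by rewrite ler_wpM2l// ltW// divr_gt0.
move=> j; rewrite /I; case: ifP => _; rewrite lebesgue_measure_ball//; exact: ltW.
Qed.

(** Two inductions: the sigma-algebra is generated by coordinate preimages of measurable subsets of
    the line, and these in turn by open rays, whose preimages are half-spaces. *)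
Let shift_contP A : measurable A -> shift_cont A.
Proof.
have SA : sigma_algebra setT shift_cont.
  split; first exact: shift_cont_set0.
    by move=> B HB; rewrite setTD; exact: shift_contC.
  exact: shift_cont_bigcup.
move=> mA; move: A mA; apply: smallest_sub => // A.
rewrite -bigcup_seq => -[i _ [Y mY <-]]; rewrite setTI.
have SY : sigma_algebra setT [set Y : set R | shift_cont ((fun x : 'rV[R]_n => x ord0 i) @^-1` Y)].
  split => /=.
  - by rewrite preimage_set0; exact: shift_cont_set0.
  - by move=> B HB; rewrite setTD preimage_setC; exact: shift_contC.
  - by move=> F HF; rewrite preimage_bigcup; exact: shift_cont_bigcup.
have : <<s @RGenOInfty.G R >> Y.
  by have := mY; rewrite -[X in X -> _]/(@measurable _ (g_sigma_algebraType R.-ocitv.-measurable) Y) RGenOInfty.measurableE.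
move: Y {mY}; apply: smallest_sub => // _ [c ->] /=.
rewrite (_ : _ @^-1` _ = [set x : 'rV[R]_n | (c < x ord0 i)%R]).
  exact: shift_cont_halfspace.
by apply/seteqP; split => x /=; rewrite in_itv/= andbT.
Qed.

Lemma shift_continuous A (M e : R) : measurable A -> (0 < M)%R -> (0 < e)%R ->
  exists2 r : R, (0 < r)%R &
    forall z, (`|z| < r)%R -> mu (shiftD A z `&` ball (0%R : 'rV[R]_n) M) < e%:E.
Proof. by move=> /shift_contP[_ HA] M0 e0; exact: HA. Qed.

End shift_continuity.

(** * Smooth functions and mollification *)

Section quadratic_derivative.
Context {R : realType} {V : normedModType R}.

(** A quadratic remainder bound survives integration, which is how mollifications are differentiated
    under the integral sign. *)
Lemma is_derive_quadratic (f : V -> R) (x v : V) (d C r : R) : 0 < r ->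
  (forall h : R, `|h| < r -> `|f (x + h *: v) - f x - h * d| <= C * h ^+ 2) ->
  is_derive x v f d.
Proof.
move=> r0 H.
have C0 : 0 <= C.
  have r2 : `|r / 2| < r by rewrite ger0_norm; lra.
  have := le_trans (normr_ge0 _) (H _ r2).
  by rewrite pmulr_lge0// exprn_gt0// divr_gt0.
have L : h^-1 *: (f (h *: v + x) - f x) @[h --> 0^'] --> d.
  apply/cvgrPdist_le => /= e e0; near=> h.
  have h0 : h != 0 by near: h; exact: nbhs_dnbhs_neq.
  have hr : `|h| < r.
    near: h; apply/dnbhs0_lt; exact: r0.
  have he : `|h| <= e / (C + 1).
    near: h; apply: dnbhs0_le; rewrite divr_gt0// ltr_wpDl//.
  have -> : d - h^-1 *: (f (h *: v + x) - f x) = - (h^-1 * (f (x + h *: v) - f x - h * d)).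
    by rewrite /GRing.scale/= [h *: v + x]addrC; field.
  rewrite normrN normrM normfV ler_pdivrMl ?normr_gt0//.
  rewrite (le_trans (H h hr))// -real_normK ?num_real// expr2 mulrA mulrC ler_wpM2l//.
  have C1 : 0 < C + 1 by rewrite ltr_wpDl.
  rewrite (le_trans (ler_wpM2l C0 he))// mulrCA ler_piMr ?(ltW e0)//.
  by rewrite ler_pdivrMr// mul1r lerDl.
apply: DeriveDef; first by apply/cvg_ex; exists d.
exact/cvg_lim.
Unshelve. all: by end_near. Qed.

End quadratic_derivative.

Section smooth_functions_line.
Context {R : realType}.
Implicit Types (f g : R -> R) (x : R) (k : nat).

(** Only [k]-fold differentiability is asked; imposed for all [k] it amounts to C^oo. *)
Fixpoint Ck k f : Prop :=
  if k is k'.+1 then exists2 f', (forall x, is_derive x 1 f (f' x)) & Ck k' f'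
  else True.

Lemma CkW k f : Ck k.+1 f -> Ck k f.
Proof.
elim: k f => [//|k IH] f [f' ff' Cf']; exists f' => //; exact: IH.
Qed.

Lemma Ck_cst k c : Ck k (fun=> c).
Proof.
elim: k c => [//|k IH] c; exists (fun=> 0) => // x; exact: is_derive_cst.
Qed.

Lemma Ck_id k : Ck k id.
Proof.
case: k => // k; exists (fun=> 1); last exact: Ck_cst.
by move=> x; exact: is_derive_id.
Qed.

Lemma CkD k f g : Ck k f -> Ck k g -> Ck k (fun x => f x + g x).
Proof.
elim: k f g => [//|k IH] f g [f' ff' Cf'] [g' gg' Cg'].
exists (fun x => f' x + g' x); last exact: IH.
by move=> x; apply: is_deriveD.
Qed.

Lemma CkM k f g : Ck k f -> Ck k g -> Ck k (fun x => f x * g x).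
Proof.
elim: k f g => [//|k IH] f g Cf Cg; have Cf1 := CkW Cf; have Cg1 := CkW Cg.
move: Cf Cg => [f' ff' Cf'] [g' gg' Cg'].
exists (fun x => f x * g' x + g x * f' x); last by apply: CkD; exact: IH.
by move=> x; apply: is_deriveM.
Qed.

Lemma is_derive_affine (a b x : R) : is_derive x 1 (fun x => a + b * x) b.
Proof.
apply: (@is_derive_quadratic _ _ _ _ _ _ 0 1) => // h _.
rewrite (_ : _ - _ = 0) ?normr0 ?mul0r// /GRing.scale/=; ring.
Qed.

Lemma Ck_comp_affine k f a b : Ck k f -> Ck k (fun x => f (a + b * x)).
Proof.
elim: k f => [//|k IH] f [f' ff' Cf'].
exists (fun x => f' (a + b * x) * b).
  move=> x; apply: (@is_derive1_comp _ f (fun x => a + b * x)).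
  exact: is_derive_affine.
apply: CkM; first exact: IH.
exact: Ck_cst.
Qed.

Lemma Ck_derive1 k f : Ck k.+1 f -> Ck k (derive1 f).
Proof.
move=> [f' ff' Cf']; rewrite (_ : derive1 f = f')//; apply/funext => x.
by rewrite derive1E; case: (ff' x) => _ ->.
Qed.

Lemma Ck_derive1n f : (forall k, Ck k f) -> forall j k, Ck k (derive1n j f).
Proof.
move=> Cf; elim=> [|j IH] k //.
by rewrite derive1nS; exact: Ck_derive1.
Qed.

Lemma is_derive1n f : (forall k, Ck k f) ->
  forall j x, is_derive x 1 (derive1n j f) (derive1n j.+1 f x).
Proof.
move=> Cf j x; have [g Hg _] := Ck_derive1n Cf j 1.
by rewrite derive1nS derive1E; apply: DeriveDef.
Qed.

Lemma continuous_derive1n f : (forall k, Ck k f) -> forall j, continuous (derive1n j f).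
Proof.
move=> Cf j x; apply: differentiable_continuous; apply/derivable1_diffP.
by case: (is_derive1n Cf j x).
Qed.

Lemma MVT_bound f (f' : R -> R) (M x y : R) :
  (forall z : R, is_derive z 1 f (f' z)) -> (forall z, `|f' z| <= M) ->
  `|f x - f y| <= M * `|x - y|.
Proof.
move=> ff' fM; wlog xy : x y / y < x.
  move=> H; have [xy|xy|->] := ltgtP x y; last by rewrite !subrr normr0 mulr0.
    by rewrite distrC [`|x - y|]distrC; exact: H.
  exact: H.
have cf : {within `[y, x], continuous f}.
  apply: continuous_subspaceT => z; apply: differentiable_continuous.
  by apply/derivable1_diffP; case: (ff' z).
have [c _ ->] := MVT xy (fun z _ => ff' z) cf.
by rewrite normrM ler_wpM2r.
Qed.

(** The mean value theorem for [g t = f (x + t) - t * f' x], and then for [f']. The constant is [M]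
    instead of the optimal half of it. *)
Lemma Taylor1_bound f (f' f'' : R -> R) (M x h : R) :
  (forall z : R, is_derive z 1 f (f' z)) -> (forall z : R, is_derive z 1 f' (f'' z)) ->
  (forall z, `|f'' z| <= M) ->
  `|f (x + h) - f x - h * f' x| <= M * h ^+ 2.
Proof.
move=> ff' ff'' fM.
have M0 : 0 <= M := le_trans (normr_ge0 _) (fM 0).
pose g t := f (x + t) - t * f' x.
have sh (t : R) : is_derive t 1 (fun t => x + t) 1.
  apply: (@is_derive_quadratic _ _ _ _ _ _ 0 1) => // k _.
    by rewrite (_ : _ - _ = 0) ?normr0 ?mul0r// /GRing.scale/=; ring.
have gg' (t : R) : is_derive t 1 g (f' (x + t) - f' x).
  have H1 : is_derive t 1 (fun t => f (x + t)) (f' (x + t) * 1).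
    exact: (@is_derive1_comp _ f (fun t => x + t)).
  rewrite mulr1 in H1; rewrite /g.
  have H2 : is_derive t 1 (fun t => t * f' x) (f' x).
    apply: (@is_derive_quadratic _ _ _ _ _ _ 0 1) => // k _.
    by rewrite (_ : _ - _ = 0) ?normr0 ?mul0r// /GRing.scale/=; ring.
  exact: is_deriveB.
have cg (u v : R) : {within `[u, v], continuous g}.
  apply: continuous_subspaceT => z; apply: differentiable_continuous.
  by apply/derivable1_diffP; case: (gg' z).
have -> : f (x + h) - f x - h * f' x = g h - g 0 by rewrite /g; rewrite addr0; ring.
have main c : `|c| <= `|h| -> `|(f' (x + c) - f' x) * h| <= M * h ^+ 2.
  move=> ch; rewrite normrM (_ : M * h ^+ 2 = M * `|h| * `|h|); last first.
    by rewrite -mulrA -expr2 real_normK// num_real.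
  rewrite ler_wpM2r// (le_trans (MVT_bound _ _ ff'' fM))// ler_wpM2l//.
  by rewrite [x + c]addrC addrK.
have [h0|h0|->] := ltgtP h 0; last by rewrite subrr normr0 expr0n mulr0.
- have [c] := MVT h0 (fun z _ => gg' z) (cg _ _).
  rewrite in_itv/= => /andP[hc c0] E; rewrite distrC E sub0r mulrN normrN.
  by apply: main; rewrite !ler0_norm; lra.
- have [c] := MVT h0 (fun z _ => gg' z) (cg _ _).
  rewrite in_itv/= => /andP[hc c0] E; rewrite E subr0.
  by apply: main; rewrite !ger0_norm; lra.
Qed.

End smooth_functions_line.

(** * Flat functions and smooth bumps *)

Section flat.
Context {R : realType}.
Implicit Types (P Q : {poly R}) (x y : R).

(** For [k > 0], raise [y / k <= expR (y / k)] to the power [k]. *)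
Lemma pow_expRN_bound k : exists2 C : R, 0 <= C &
  forall y, 0 <= y -> y ^+ k * expR (- y) <= C.
Proof.
exists (k%:R ^+ k) => [|y y0]; first exact: exprn_ge0.
case: k => [|k].
  by rewrite !expr0 mul1r -expR0 ler_expR oppr_le0.
rewrite expRN ler_pdivrMr ?expR_gt0//.
have -> : y = k.+1%:R * (y / k.+1%:R) by rewrite mulrC divfK.
rewrite expRM_natl exprMn ler_wpM2l ?exprn_ge0//.
have yk : 0 <= y / k.+1%:R by rewrite divr_ge0.
rewrite lerXn2r ?nnegrE ?expR_ge0//.
by rewrite (le_trans _ (expR_ge1Dx _))// lerDr.
Qed.

Lemma poly_expRN_bound P : exists2 C : R, 0 <= C &
  forall y, 0 <= y -> `|P.[y] * expR (- y)| <= C.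
Proof.
have H i : exists C : R, 0 <= C /\ forall y, 0 <= y -> y ^+ i * expR (- y) <= C.
  by have [C C0 HC] := pow_expRN_bound i; exists C.
have [C HC] := choice H.
exists (\sum_(i < size P) `|P`_i| * C i) => [|y y0].
  by apply: sumr_ge0 => i _; rewrite mulr_ge0//; case: (HC i).
rewrite horner_coef mulr_suml (le_trans (ler_norm_sum _ _ _))//.
apply: ler_sum => i _; rewrite -mulrA normrM ler_wpM2l//.
by rewrite ger0_norm ?mulr_ge0 ?exprn_ge0 ?expR_ge0//; case: (HC i) => _; apply.
Qed.

(** The classical function [exp(-1/x)] extended by 0, with a polynomial factor in [1/x] that makes
    the family stable under differentiation. *)
Definition flat P x : R := if 0 < x then P.[x^-1] * expR (- x^-1) else 0.

(** From [d/dx (P(1/x) exp(-1/x)) = x^-2 (P - P')(1/x) exp(-1/x)]. *)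
Let dflat P : {poly R} := 'X^2 * (P - P^`()).

Let is_derive_flat P x : is_derive x 1 (flat P) (flat (dflat P) x).
Proof.
have [x0|x0|->] := ltgtP x 0.
- rewrite {2}/flat ltNge (ltW x0)/=.
  apply: (@near_eq_is_derive _ _ _ (fun _ : R => 0 : R)).
  near=> y; rewrite /flat ifN// -leNgt ltW//.
  by near: y; exact: lt_nbhsl.
- have -> : flat (dflat P) x = P.[x^-1] * (x ^- 2 * expR (- x^-1))
      + expR (- x^-1) * (P^`().[x^-1] * - x ^- 2).
    rewrite /flat x0 /dflat hornerM hornerXn hornerD hornerN -exprVn; ring.
  apply: (@near_eq_is_derive _ _ _ (fun x => P.[x^-1] * expR (- x^-1))).
    by near=> y; rewrite /flat ifT//; near: y; exact: lt_nbhsr.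
  have dV : is_derive x 1 (fun x : R => x^-1) (- x ^- 2).
    apply: is_derive_eq; first by apply: is_deriveV; rewrite gt_eqF.
    by rewrite /GRing.scale/= mulr1.
  have dP : is_derive x 1 (fun x => P.[x^-1]) (P^`().[x^-1] * - x ^- 2).
    exact: (@is_derive1_comp _ (horner P) (fun x => x^-1)).
  have dN : is_derive x 1 (fun x : R => - x^-1) (x ^- 2).
    rewrite -[X in is_derive _ _ _ X]opprK.
    exact: is_deriveN.
  have dE : is_derive x 1 (fun x => expR (- x^-1)) (expR (- x^-1) * x ^- 2).
    exact: (@is_derive1_comp _ expR (fun x => - x^-1)).
  apply: (is_derive_eq (is_deriveM dP dE)).
  by rewrite /GRing.scale/= [expR _ * x ^- 2]mulrC.
(* At 0 the derivative is 0: boundedness of [y^2 P(y) exp(-y)] at [y = 1/h] says that [flat P h] is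
   at most [C h^2] in absolute value. *)
- have [C C0 HC] := poly_expRN_bound ('X^2 * P).
  rewrite {2}/flat ltxx; apply: (@is_derive_quadratic _ _ _ _ _ _ C 1) => // h _.
  rewrite add0r /GRing.scale/= mulr1 {2}/flat ltxx !subr0 mulr0 subr0 /flat.
  case: ifPn => h0; last by rewrite normr0 mulr_ge0 ?sqr_ge0.
  have hV : 0 <= h^-1 by rewrite invr_ge0 ltW.
  have := HC _ hV; rewrite hornerM hornerXn -mulrA normrM.
  rewrite ger0_norm ?exprn_ge0// exprVn ler_pdivrMl ?exprn_gt0// mulrC.
  by rewrite [C * _]mulrC.
Unshelve. all: by end_near. Qed.

Lemma Ck_flat k P : Ck k (flat P).
Proof. elim: k P => [//|k IH] P.
by exists (flat (dflat P)); [exact: is_derive_flat | exact: IH]. Qed.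

(** Each factor cuts off one side, so the bump is positive exactly on the open interval of radius
    [r]. The coefficients [1] and [-1] are written out to match [Ck_comp_affine]. *)
Definition bumpfun (r x : R) : R := flat 1 (r + 1 * x) * flat 1 (r + (-1) * x).

Lemma Ck_bump r k : Ck k (bumpfun r).
Proof. by apply: CkM; apply: Ck_comp_affine; exact: Ck_flat. Qed.

Lemma bump_ge0 r x : 0 <= bumpfun r x.
Proof.
have H y : 0 <= flat 1 y.
  by rewrite /flat; case: ifP => // _; rewrite hornerC mul1r expR_ge0.
by rewrite mulr_ge0.
Qed.

Lemma bump_gt0 r x : (0 < bumpfun r x) = (`|x| < r).
Proof.
have H y : (0 < flat 1 y) = (0 < y).
  by rewrite /flat; case: ifP => // _; rewrite ?ltxx// hornerC mul1r expR_gt0.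
have H0 y : 0 <= flat 1 y.
  by rewrite /flat; case: ifP => // _; rewrite hornerC mul1r expR_ge0.
rewrite /bumpfun lt0r mulf_eq0 negb_or mulr_ge0// andbT.
rewrite -[_ != 0](andbT) -[in X in X && _](H0 (r + 1 * x)) -lt0r H.
rewrite -[_ != 0](andbT) -[in X in _ && X](H0 (r + -1 * x)) -lt0r H.
by rewrite ltr_norml; apply/andP/andP => -[]; split; lra.
Qed.

Lemma bump_derive_out r j x : r < `|x| -> derive1n j (bumpfun r) x = 0.
Proof.
elim: j x => [|j IH] x rx.
  by apply/eqP; rewrite eq_le bump_ge0 andbT leNgt bump_gt0 -leNgt ltW.
rewrite derive1nS derive1E.
have -> : 'D_1 (derive1n j (bumpfun r)) x = 'D_1 (fun=> 0) x.
  apply: near_eq_derive; near=> y; apply: IH.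
  near: y; have := @norm_continuous _ _ x.
  by move=> /cvgr_gt; apply.
exact: derive_cst.
Unshelve. all: by end_near. Qed.

Lemma bump_derive_bounded r j : exists2 M : R, 0 <= M &
  forall x, `|derive1n j (bumpfun r) x| <= M.
Proof.
have [r0|r0] := ltP r 0.
  exists 0 => // x; rewrite bump_derive_out ?normr0//.
  by rewrite (lt_le_trans r0).
have c : {within `[- r, r], continuous (fun x => `|derive1n j (bumpfun r) x|)}.
  apply: continuous_subspaceT => x; apply: continuous_comp.
    exact: (continuous_derive1n (Ck_bump r)).
  exact: norm_continuous.
have rr : - r <= r by lra.
have [m _ Hm] := EVT_max rr c.
exists `|derive1n j (bumpfun r) m| => // x.
have [xr|rx] := leP `|x| r; last by rewrite bump_derive_out ?normr0.
by apply: Hm; rewrite in_itv/= -ler_norml.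
Qed.

End flat.

(** The derivative [q = 1 / (1 + x^2)] satisfies [q' = -2 x q^2], so each further order of
    differentiability follows from the previous one by the product rule. *)
Lemma Ck_atan (R : realType) k : Ck k (@atan R).
Proof.
case: k => // k; exists (fun x => (1 + x ^+ 2)^-1); first by move=> x; exact: is_derive1_atan.
elim: k => [//|k IH].
exists (fun x => ((1 + x ^+ 2)^-1 * (1 + x ^+ 2)^-1) * ((-2) * x)); last first.
  by apply: CkM; [exact: CkM|apply: CkM; [exact: Ck_cst|exact: Ck_id]].
move=> x; have x2 : 1 + x ^+ 2 != 0 by rewrite gt_eqF// ltr_pwDl// sqr_ge0.
have d2 : is_derive x 1 (fun x : R => 1 + x ^+ 2) (2 * x).
  apply: (@is_derive_quadratic _ _ _ _ _ _ 1 1) => // h _.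
  rewrite (_ : _ - _ = h ^+ 2) ?mul1r ?ger0_norm ?sqr_ge0// /GRing.scale/=; ring.
have dd := @is_deriveV _ (fun x => 1 + x ^+ 2) x _ _ x2 d2; apply: (is_derive_eq dd).
by rewrite /GRing.scale/= -exprVn; ring.
Qed.

Lemma atan_lipschitz (R : realType) (x y : R) : `|atan x - atan y| <= `|x - y|.
Proof.
rewrite -[leRHS]mul1r.
apply: (@MVT_bound R atan (fun t : R => (1 + t ^+ 2)^-1)) => z.
rewrite ger0_norm ?invr_ge0 ?addr_ge0 ?sqr_ge0//.
by rewrite invf_le1 ?ltr_pwDl ?sqr_ge0// lerDl sqr_ge0.
Qed.

Section smooth_functions.
Context {R : realType} {n : nat}.
Implicit Types (f g : 'rV[R]_n -> R) (x : 'rV[R]_n) (i : 'I_n).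

(** A global counterpart of [smooth_on] in which all iterated partial derivatives are supplied
    together as a witness, indexed like [iter_partial]; sums and multiples are then formed on the
    witnesses. *)
Definition smooth_fun f := exists F : seq 'I_n -> 'rV[R]_n -> R,
  [/\ F [::] = f, forall l, continuous (F l) &
      forall l i x, is_derive x (basis_vec i : 'rV[R]_n) (F l) (F (i :: l) x)].

Lemma smooth_fun_on f U : smooth_fun f -> smooth_on U f.
Proof.
move=> [F [F0 cF dF]] l.
have iterE m : iter_partial m f = F m.
  elim: m => [|i m IH] /=; first by rewrite F0.
  by apply/funext => y; rewrite IH; case: (dF m i y).
move=> x _; rewrite iterE; split; first exact: cF.
by move=> i; case: (dF l i x).
Qed.

Lemma smooth_fun_derive f i : smooth_fun f ->
  continuous (fun x => 'D_(basis_vec i : 'rV[R]_n) f x).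
Proof.
move=> [F [F0 cF dF]]; rewrite (_ : (fun x => _) = F [:: i]); first exact: cF.
by apply/funext => x; rewrite -F0; case: (dF [::] i x).
Qed.

Lemma smooth_fun_continuous f : smooth_fun f -> continuous f.
Proof. by move=> [F [<- cF dF]]; exact: cF. Qed.

Lemma smooth_fun_is_derive f i x : smooth_fun f ->
  is_derive x (basis_vec i : 'rV[R]_n) f ('D_(basis_vec i : 'rV[R]_n) f x).
Proof.
by move=> [F [<- cF dF]]; apply: DeriveDef => //; case: (dF [::] i x).
Qed.

Lemma smooth_cst c : smooth_fun (fun=> c).
Proof.
exists (fun l => if l is _ :: _ then fun=> 0 else fun=> c); split => //.
  by case=> [|? ?] x; exact: cst_continuous.
by move=> [|? ?] i x; exact: is_derive_cst.
Qed.

Lemma smoothD f g : smooth_fun f -> smooth_fun g -> smooth_fun (fun x => f x + g x).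
Proof.
move=> [F [F0 cF dF]] [G [G0 cG dG]].
exists (fun l x => F l x + G l x); split.
- by rewrite F0 G0.
- by move=> l x; apply: continuousD; [exact: cF|exact: cG].
- by move=> l i x; apply: is_deriveD.
Qed.

Lemma smoothZ c f : smooth_fun f -> smooth_fun (fun x => c * f x).
Proof.
move=> [F [F0 cF dF]]; exists (fun l x => c * F l x); split.
- by rewrite F0.
- by move=> l x; apply: continuousM; [exact: cst_continuous|exact: cF].
- by move=> l i x; apply: is_deriveZ.
Qed.

Lemma smooth_sum (I : Type) (r : seq I) (h : I -> 'rV[R]_n -> R) :
  (forall j, smooth_fun (h j)) -> smooth_fun (fun x => \sum_(j <- r) h j x).
Proof.
move=> Hh; elim: r => [|j r IH].
  rewrite (_ : (fun x => _) = fun=> 0); first exact: smooth_cst.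
  by apply/funext => x; rewrite big_nil.
rewrite (_ : (fun x => _) = fun x => h j x + \sum_(j <- r) h j x).
  exact: smoothD.
by apply/funext => x; rewrite big_cons.
Qed.

Lemma coord_continuous_rV i : continuous (fun x : 'rV[R]_n => x ord0 i).
Proof. exact: coord_continuous. Qed.

Lemma addr_basisE x (t : R) i j :
  (x + t *: basis_vec i) ord0 j = x ord0 j + t * (i == j)%:R.
Proof. by rewrite !mxE eqxx/= eq_sym. Qed.

Lemma is_derive_coord (h : R -> R) (d : R) i j x : is_derive (x ord0 i) (1 : R) h d ->
  is_derive x (basis_vec j : 'rV[R]_n) (fun x : 'rV[R]_n => h (x ord0 i)) (if j == i then d else 0).
Proof.
move=> D; have [->|ji] := eqVneq j i; last first.
  apply: (@is_derive_quadratic R 'rV[R]_n _ _ _ (0 : R) 0 1) => // t _.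
  have -> : (x + t *: basis_vec j) ord0 i = x ord0 i.
    by rewrite addr_basisE (negbTE ji) mulr0n mulr0 addr0.
  by rewrite subrr mulr0 subrr normr0 mul0r.
have E : (fun t : R => t^-1 *: (h ((t *: basis_vec i + x) ord0 i) - h (x ord0 i))) =
    (fun t : R => t^-1 *: (h (t *: (1 : R) + x ord0 i) - h (x ord0 i))).
  apply/funext => t.
  have -> // : (t *: basis_vec i + x) ord0 i = t *: (1 : R) + x ord0 i.
  by rewrite addrC addr_basisE eqxx mulr1 [RHS]addrC /GRing.scale/= mulr1.
case: D => D1 D2.
by apply: DeriveDef; [move: D1|rewrite -D2]; rewrite /derivable /derive E.
Qed.

Lemma smooth_coord (h : R -> R) i : (forall k, Ck k h) ->
  smooth_fun (fun x => h (x ord0 i)).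
Proof.
move=> Ch.
(* A mixed derivative vanishes as soon as one direction differs from [i]. *)
exists (fun l x => if all (pred1 i) l then derive1n (size l) h (x ord0 i) else 0).
split => //.
  move=> l; case: (all _ l); last by move=> x; exact: cst_continuous.
  move=> x; apply: (@continuous_comp _ _ _ (fun x : 'rV[R]_n => x ord0 i)).
    exact: coord_continuous_rV.
  exact: continuous_derive1n.
move=> l j x /=.
have D := is_derive_coord j (is_derive1n Ch (size l) (x ord0 i)).
case: (all _ l); last by rewrite andbF; exact: is_derive_cst.
by move: D; rewrite andbT; case: (j == i).
Qed.

End smooth_functions.

Lemma lipschitz_continuous (R : realType) (V : normedModType R) (f : V -> R) (L : R) :
  0 <= L -> (forall x y, `|f x - f y| <= L * `|x - y|) -> continuous f.
Proof.
move=> L0 HL z; apply/cvgrPdist_le => /= e e0.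
near=> y; rewrite (le_trans (HL _ _))//.
have zy : `|z - y| <= e / (L + 1).
  by near: y; apply: cvgr_dist_le => //; rewrite divr_gt0// ltr_wpDl.
rewrite (le_trans (ler_wpM2l L0 zy))// mulrCA ler_piMr ?(ltW e0)//.
by rewrite ler_pdivrMr ?ltr_wpDl// mul1r lerDl.
Unshelve. all: by end_near. Qed.

(** Telescoping, one factor at a time; [1 <= M] lets [M ^+ n] absorb every partial product. *)
Lemma prod_diff_bound (R : realDomainType) n (a b : 'I_n -> R) (M : R) : 1 <= M ->
  (forall i, `|a i| <= M) -> (forall i, `|b i| <= M) ->
  `|\prod_i a i - \prod_i b i| <= M ^+ n * \sum_i `|a i - b i|.
Proof.
move=> M1; have M0 : 0 <= M := le_trans ler01 M1.
elim: n a b => [|n IH] a b aM bM; first by rewrite !big_ord0 subrr normr0 mulr0.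
rewrite !big_ord_recr/=; set A := \prod_(_ < _) a _; set B := \prod_(_ < _) b _.
have -> : A * a ord_max - B * b ord_max =
    (A - B) * a ord_max + B * (a ord_max - b ord_max) by ring.
rewrite (le_trans (ler_normD _ _))// [leRHS]mulrDr; apply: lerD.
  rewrite normrM exprSr mulrAC; apply: ler_pM => //.
  by apply: IH => i; [exact: aM|exact: bM].
rewrite normrM; apply: ler_pM => //.
rewrite normr_prod (le_trans (_ : _ <= \prod_(i < n) M))//.
  by apply: ler_prod => i _; rewrite normr_ge0 bM.
by rewrite prodr_const card_ord exprS ler_peMl// exprn_ge0.
Qed.

Section bounded_support_integral.
Context {R : realType} {n : nat}.
Notation mu := (lebesgue_rV R n).

Section bounds.
Variables (f : 'rV[R]_n -> R) (x : 'rV[R]_n) (C r : R).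
Hypotheses (r0 : 0 < r) (mf : measurable_fun setT f).
Hypothesis fC : forall y, `|f y| <= C * \1_(ball x r) y.
Local Open Scope ereal_scope.

Let le : \int[mu]_y `|(f y)%:E| <= (C * (r *+ 2) ^+ n)%:E.
Proof.
have C0 : (0 <= C)%R.
  have := le_trans (normr_ge0 _) (fC x).
  by rewrite indicE mem_set ?mulr1//; exact: ballxx.
have mb := measurable_rV_ball x r.
have <- : \int[mu]_y (C * \1_(ball x r) y)%:E = (C * (r *+ 2) ^+ n)%:E.
  under eq_integral do rewrite EFinM.
  rewrite ge0_integralZl_EFin//; last exact/measurable_EFinP/measurable_indic.
  by rewrite integral_indic// setIT EFinM; congr (_ * _); exact: lebesgue_rV_ball.
apply: ge0_le_integralT => //.
- by apply: measurableT_comp => //; exact/measurable_EFinP.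
- by apply/measurable_EFinP; apply: measurable_funM => //; exact: measurable_indic.
- by move=> y _; rewrite lee_fin.
Qed.

Lemma integrable_bounded_support : mu.-integrable setT (EFin \o f).
Proof.
apply/integrableP; split; first exact/measurable_EFinP.
by rewrite (le_lt_trans le)// ltry.
Qed.

Lemma Rintegral_bounded_support :
  (`|\int[mu]_y f y| <= C * (r *+ 2) ^+ n)%R.
Proof.
rewrite (le_trans (le_normr_Rintegral _ integrable_bounded_support))//.
rewrite -lee_fin /Rintegral fineK//.
by rewrite ge0_fin_numE ?integral_ge0// (le_lt_trans le)// ltry.
Qed.

End bounds.

End bounded_support_integral.

(** * Mollification by a product of bumps *)

Section mollification.
Context {R : realType} {n : nat}.
Notation mu := (lebesgue_rV R n).
Variables (r : R) (E : set 'rV[R]_n).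
Hypothesis r_gt0 : 0 < r.
Hypothesis mE : measurable E.
Implicit Types (k : 'I_n -> nat) (x y z : 'rV[R]_n) (i : 'I_n).

(** The partial derivative of multi-index [k] of the unnormalised kernel [prod_i bumpfun r z_i]. *)
Definition kbump k z : R := \prod_i derive1n (k i) (bumpfun r) (z ord0 i).

Let bd j := sval (cid2 (@bump_derive_bounded R r j)).
Let bd_ge0 j : 0 <= bd j. Proof. by rewrite /bd; case: cid2. Qed.
Let bdP j (x : R) : `|derive1n j (bumpfun r) x| <= bd j.
Proof. by rewrite /bd; case: cid2 => /=. Qed.

(** One bound for the orders [k i], [k i + 1] and [k i + 2] in all coordinates; the two extra orders
    are for the Lipschitz and Taylor estimates. Being at least 1, its powers increase with the
    exponent. *)
Let kM k : R := 1 + \sum_i (bd (k i) + bd (k i).+1 + bd (k i).+2).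

Let kM_ge k i : [/\ bd (k i) <= kM k, bd (k i).+1 <= kM k, bd (k i).+2 <= kM k & 1 <= kM k].
Proof.
have H : bd (k i) + bd (k i).+1 + bd (k i).+2 <= \sum_i (bd (k i) + bd (k i).+1 + bd (k i).+2).
  by rewrite (bigD1 i)//= lerDl sumr_ge0// => j _; rewrite !addr_ge0.
have := bd_ge0 (k i); have := bd_ge0 (k i).+1; have := bd_ge0 (k i).+2.
by rewrite /kM; move: H; set S := \sum_(_ < _) _ => *; split; lra.
Qed.

Let kM_ge1 k : 1 <= kM k.
Proof. by rewrite lerDl sumr_ge0// => i _; rewrite !addr_ge0. Qed.

Let kM_ge0 k : 0 <= kM k := le_trans ler01 (kM_ge1 k).

Lemma kbump_out k z : r < `|z| -> kbump k z = 0.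
Proof.
move=> rz; have [i zi] : exists i, r < `|z ord0 i|.
  apply: contrapT => H; move: rz; rewrite ltNge => /negP; apply.
  apply/rV_norm_leP; first exact: ltW.
  by move=> i; rewrite leNgt; apply/negP => ?; apply: H; exists i.
by rewrite /kbump (bigD1 i)//= bump_derive_out// mul0r.
Qed.

Lemma kbump_bounded k z : `|kbump k z| <= kM k ^+ n.
Proof.
rewrite /kbump normr_prod (le_trans (_ : _ <= \prod_(i < n) kM k))//.
  by apply: ler_prod => i _; rewrite normr_ge0 (le_trans (bdP _ _))//; case: (kM_ge k i).
by rewrite prodr_const card_ord.
Qed.

Lemma kbump_lipschitz k z z' : `|kbump k z - kbump k z'| <= kM k ^+ n * (kM k * n%:R) * `|z - z'|.
Proof.
rewrite /kbump (le_trans (prod_diff_bound (kM_ge1 k) _ _))//.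
- by move=> i; rewrite (le_trans (bdP _ _))//; case: (kM_ge k i).
- by move=> i; rewrite (le_trans (bdP _ _))//; case: (kM_ge k i).
rewrite -mulrA ler_wpM2l ?exprn_ge0//.
rewrite (le_trans (_ : _ <= \sum_(i < n) kM k * `|z - z'|))//.
  apply: ler_sum => i _.
  rewrite (le_trans (MVT_bound _ _ (is_derive1n (Ck_bump r) _) (bdP _)))//.
  apply: ler_pM => //; first by case: (kM_ge k i).
  by have := coord_le_norm (z - z') i; rewrite !mxE.
by rewrite sumr_const card_ord -[leLHS]mulr_natl mulrA [_%:R * _]mulrC.
Qed.

Lemma kbump_continuous k : continuous (kbump k).
Proof.
apply: (@lipschitz_continuous R _ _ (kM k ^+ n * (kM k * n%:R))).
  by rewrite !mulr_ge0 ?exprn_ge0.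
exact: kbump_lipschitz.
Qed.

Definition incr k i : 'I_n -> nat := fun j => (k j + (i == j))%N.

(** Only the [i]-th factor moves, so this is [Taylor1_bound] in one variable with step [- h], the
    other factors being bounded. *)
Lemma kbump_Taylor k i z h :
  `|kbump k (z - h *: basis_vec i) - kbump k z + h * kbump (incr k i) z|
    <= kM k ^+ n * kM k * h ^+ 2.
Proof.
rewrite /kbump (bigD1 i)//= [X in _ - X + _](bigD1 i)//= [X in _ + _ * X](bigD1 i)//=.
pose P := \prod_(j < n | j != i) derive1n (k j) (bumpfun r) (z ord0 j).
rewrite (eq_bigr (fun j => derive1n (k j) (bumpfun r) (z ord0 j))); last first.
  by move=> j ji; rewrite -scaleNr addr_basisE eq_sym (negbTE ji) mulr0n mulr0 addr0.
rewrite [X in _ + h * (_ * X)](eq_bigr (fun j => derive1n (k j) (bumpfun r) (z ord0 j))); last first.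
  by move=> j ji; rewrite /incr eq_sym (negbTE ji) addn0.
rewrite -/P /incr eqxx addn1 -scaleNr addr_basisE eqxx mulr1.
set b := derive1n (k i) (bumpfun r); set b' := derive1n (k i).+1 (bumpfun r).
have -> : b (z ord0 i - h) * P - b (z ord0 i) * P + h * (b' (z ord0 i) * P) =
   P * (b (z ord0 i + - h) - b (z ord0 i) - (- h) * b' (z ord0 i)) by ring.
rewrite normrM -mulrA; apply: ler_pM => //.
  rewrite /P normr_prod (le_trans (_ : _ <= \prod_(j < n | j != i) kM k))//.
    by apply: ler_prod => j _; rewrite normr_ge0 (le_trans (bdP _ _))//; case: (kM_ge k j).
  rewrite prodr_const; apply: ler_weXn2l => //.
  by rewrite (leq_trans (max_card _))// card_ord.
apply: (le_trans (@Taylor1_bound R b b' (derive1n (k i).+2 (bumpfun r))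
    (bd (k i).+2) (z ord0 i) (- h) _ _ _)).
- exact: is_derive1n (Ck_bump r) _.
- exact: is_derive1n (Ck_bump r) _.
- exact: bdP.
- by rewrite sqrrN ler_wpM2r ?sqr_ge0//; case: (kM_ge k i).
Qed.

(** The variable [x] enters through [y - x], so every differentiation in [x] contributes a sign. *)
Definition moll k x : R := \int[mu]_y (\1_E y * kbump k (y - x)).

Let mker k x : measurable_fun setT (fun y => kbump k (y - x)).
Proof.
apply: (measurableT_comp (f := kbump k)); last exact: measurable_rVD.
exact: continuous_measurable_rV (kbump_continuous (k:=k)).
Qed.

Let mint k x : measurable_fun setT (fun y => \1_E y * kbump k (y - x)).
Proof. by apply: measurable_funM => //; exact: measurable_indic. Qed.

Let int_moll k x : mu.-integrable setT (EFin \o (fun y => \1_E y * kbump k (y - x))).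
Proof.
have r1 : 0 < r + 1 by rewrite addr_gt0.
apply: (integrable_bounded_support (x := x) (C := kM k ^+ n) r1 (mint k x)) => y.
rewrite normrM ger0_norm//.
have [xy|xy] := leP `|y - x| r.
  rewrite [X in _ <= _ * X]indicE mem_set; last first.
    by rewrite rV_ballE/= distrC (le_lt_trans xy)// ltrDl.
  rewrite mulr1 -[leRHS]mul1r; apply: ler_pM => //; exact: kbump_bounded.
by rewrite kbump_out// normr0 mulr0 mulr_ge0// exprn_ge0.
Qed.

(** For [|x - x'| >= 1] boundedness suffices; for closer points the Lipschitz bound of the kernel is
    integrated over a common support. *)
Lemma moll_lipschitz k : exists2 L : R, 0 <= L &
  forall x x', `|moll k x - moll k x'| <= L * `|x - x'|.
Proof.
(* The ball of radius [r + 2] around [x] contains the supports of both kernels when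
   [|x - x'| < 1]. *)
pose D := 2 * (kM k ^+ n * (kM k * n%:R)) * ((r + 2) *+ 2) ^+ n.
pose D2 := 2 * (kM k ^+ n * ((r + 2) *+ 2) ^+ n).
have rr : 0 <= (r + 2) *+ 2 by rewrite mulrn_wge0// addr_ge0// ltW.
have D0 : 0 <= D by rewrite !mulr_ge0 ?exprn_ge0.
have D20 : 0 <= D2 by rewrite !mulr_ge0 ?exprn_ge0.
have bnd x : `|moll k x| <= kM k ^+ n * ((r + 2) *+ 2) ^+ n.
  have r2 : 0 < r + 2 by rewrite addr_gt0.
  apply: (Rintegral_bounded_support (x := x) r2 (mint k x)) => y.
  rewrite normrM ger0_norm//.
  have [xy|xy] := leP `|y - x| r.
    rewrite [X in _ <= _ * X]indicE mem_set; last first.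
      by rewrite rV_ballE/= distrC (le_lt_trans xy)// ltrDl.
    rewrite mulr1 -[leRHS]mul1r; apply: ler_pM => //; exact: kbump_bounded.
  by rewrite kbump_out// normr0 mulr0 mulr_ge0// exprn_ge0.
exists (D + D2); first exact: addr_ge0.
move=> x x'; have [xx|xx] := leP 1 `|x - x'|.
  rewrite (le_trans (ler_normB _ _))// (le_trans (lerD (bnd x) (bnd x')))//.
  rewrite [X in X <= _](_ : _ = D2); last by rewrite /D2; ring.
  rewrite mulrDl (le_trans (_ : _ <= D2 * `|x - x'|))//.
    by rewrite ler_peMr.
  by rewrite lerDr mulr_ge0.
rewrite mulrDl (le_trans (_ : _ <= D * `|x - x'|))//; last by rewrite lerDl mulr_ge0.
rewrite /moll -RintegralB//.
have r2 : 0 < r + 2 by rewrite addr_gt0.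
pose L := kM k ^+ n * (kM k * n%:R).
have L0 : 0 <= L by rewrite !mulr_ge0 ?exprn_ge0.
apply: (le_trans (Rintegral_bounded_support (x := x) (C := L * `|x - x'|) r2 _ _)).
- by apply: measurable_funB; exact: mint.
- move=> y; rewrite -mulrBr normrM ger0_norm//.
  have [xy|xy] := ltP `|x - y| (r + 2).
    rewrite [X in _ <= _ * X]indicE mem_set ?rV_ballE//= mulr1 -[leRHS]mul1r.
    apply: ler_pM => //.
    rewrite (le_trans (kbump_lipschitz _ _ _))// -/L.
    rewrite (_ : y - x - (y - x') = - (x - x')) ?normrN//.
    by apply/rowP => j; rewrite !mxE; ring.
  rewrite [X in _ <= _ * X]indicE memNset; last first.
    by rewrite rV_ballE/= => H; move: xy; rewrite leNgt H.
  rewrite mulr0 !kbump_out ?subrr ?normr0 ?mulr0//; last by rewrite distrC; lra.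
  by have := ler_distD x' x y; rewrite [`|x' - y|]distrC; lra.
- rewrite [leRHS](_ : _ = 2 * (L * `|x - x'| * ((r + 2) *+ 2) ^+ n)); last first.
    by rewrite /D -/L; ring.
  by rewrite ler_peMl ?mulr_ge0 ?exprn_ge0// ler1n.
Qed.

Lemma moll_continuous k : continuous (moll k).
Proof.
by have [L L0 HL] := moll_lipschitz k; exact: (lipschitz_continuous L0).
Qed.

(** The bound of [kbump_Taylor] is uniform in [y]; integrated over a ball it yields the quadratic
    remainder required by [is_derive_quadratic]. *)
Lemma moll_is_derive k i x :
  is_derive x (basis_vec i : 'rV[R]_n) (moll k) (- moll (incr k i) x).
Proof.
have r2 : 0 < r + 2 by rewrite addr_gt0.
apply: (@is_derive_quadratic _ _ _ _ _ _ (kM k ^+ n * kM k * ((r + 2) *+ 2) ^+ n) 1) => //.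
move=> h h1.
have bi : `|basis_vec i : 'rV[R]_n| <= 1.
  apply/rV_norm_leP => // j; rewrite mxE eqxx/=.
  by case: eqP => _; rewrite ?normr1 ?normr0.
have -> : moll k (x + h *: basis_vec i) - moll k x - h * - moll (incr k i) x =
   \int[mu]_y (\1_E y * kbump k (y - (x + h *: basis_vec i)) - \1_E y * kbump k (y - x)
     + h * (\1_E y * kbump (incr k i) (y - x))).
  rewrite RintegralD//; last 2 first.
  - have H := integrableB measurableT (int_moll k (x + h *: basis_vec i)) (int_moll k x).
    by apply: (eq_integrable measurableT _ _ _ H) => y _; rewrite /= EFinB.
  - have H := integrableZl measurableT h (int_moll (incr k i) x).
    by apply: (eq_integrable measurableT _ _ _ H) => y _; rewrite /= EFinM.
  rewrite RintegralB// RintegralZl// /moll mulrN opprK; ring.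
rewrite [leRHS](_ : _ = kM k ^+ n * kM k * h ^+ 2 * ((r + 2) *+ 2) ^+ n); last by ring.
apply: (Rintegral_bounded_support (x := x) (C := kM k ^+ n * kM k * h ^+ 2) r2 _ _).
  apply: measurable_funD; first by apply: measurable_funB; exact: mint.
  by apply: measurable_funM => //; exact: mint.
move=> y.
have -> : \1_E y * kbump k (y - (x + h *: basis_vec i)) - \1_E y * kbump k (y - x)
     + h * (\1_E y * kbump (incr k i) (y - x)) =
  \1_E y * (kbump k ((y - x) - h *: basis_vec i) - kbump k (y - x) + h * kbump (incr k i) (y - x)).
  rewrite opprD addrA; ring.
rewrite normrM ger0_norm//.
have [xy|xy] := ltP `|x - y| (r + 2).
  rewrite [X in _ <= _ * X]indicE mem_set ?rV_ballE//= mulr1 -[leRHS]mul1r.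
  apply: ler_pM => //.
  exact: kbump_Taylor.
rewrite [X in _ <= _ * X]indicE memNset; last first.
  by rewrite rV_ballE/= => H; move: xy; rewrite leNgt H.
rewrite mulr0 !kbump_out ?subrr ?mulr0 ?addr0 ?normr0 ?mulr0//.
- by rewrite distrC; lra.
- by rewrite distrC; lra.
- have hb : `|h *: (basis_vec i : 'rV[R]_n)| <= 1.
    by rewrite normrZ -[leRHS]mulr1; apply: ler_pM => //; exact: ltW.
  have := ler_normD (y - x - h *: basis_vec i) (h *: basis_vec i).
  by rewrite subrK [`|y - x|]distrC; lra.
Qed.

Lemma smooth_moll k : smooth_fun (moll k).
Proof.
pose F (l : seq 'I_n) x := (-1) ^+ size l * moll (fun j => k j + count_mem j l)%N x.
exists F; split.
- apply/funext => x; rewrite /F/= mul1r; congr (moll _ x).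
  by apply/funext => j; rewrite addn0.
- move=> l x; rewrite /F; apply: (@continuousM _ _ (fun=> (-1) ^+ size l) (moll _));
    [exact: cst_continuous|exact: moll_continuous].
- move=> l i x; rewrite /F.
  have D := moll_is_derive (fun j => k j + count_mem j l)%N i x.
  have -> : (-1) ^+ size (i :: l) * moll (fun j => k j + count_mem j (i :: l))%N x
    = (-1) ^+ size l *: (- moll (incr (fun j => k j + count_mem j l)%N i) x).
    rewrite /= exprS mulN1r mulNr /GRing.scale/= mulrN; congr (- (_ * moll _ x)).
    by apply/funext => j; rewrite /incr; lia.
  exact: is_deriveZ.
Qed.

End mollification.

(** * Generic regular values *)

Section bounded_lipschitz.
Context {R : realType} {V : normedModType R}.
Variable S : set V.
Implicit Types f g : V -> R.

(** Boundedness is included so that products stay in the class. It is relative to a set [S] because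
    the critical coefficients contain [x_i ^+ 2] and are controlled on balls only. *)
Definition bounded_lipschitz f := exists2 C : R, 0 <= C &
  (forall x, S x -> `|f x| <= C) /\
  (forall x y, S x -> S y -> `|f x - f y| <= C * `|x - y|).

Lemma bounded_lipschitz_cst c : bounded_lipschitz (fun=> c).
Proof.
exists `|c| => //; split => // x y _ _; rewrite subrr normr0.
by rewrite mulr_ge0.
Qed.

Lemma bounded_lipschitzD f g : bounded_lipschitz f -> bounded_lipschitz g ->
  bounded_lipschitz (fun x => f x + g x).
Proof.
move=> [C C0 [f1 f2]] [D D0 [g1 g2]]; exists (C + D); first exact: addr_ge0.
split => [x Sx|x y Sx Sy].
  by rewrite (le_trans (ler_normD _ _))// lerD ?f1 ?g1.
rewrite opprD addrACA mulrDl (le_trans (ler_normD _ _))// lerD ?f2 ?g2//.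
Qed.

Lemma bounded_lipschitzM f g : bounded_lipschitz f -> bounded_lipschitz g ->
  bounded_lipschitz (fun x => f x * g x).
Proof.
move=> [C C0 [f1 f2]] [D D0 [g1 g2]]; exists (C * D + C * D).
  by rewrite addr_ge0// mulr_ge0.
split => [x Sx|x y Sx Sy].
  rewrite normrM (le_trans (_ : _ <= C * D))//; last by rewrite lerDl mulr_ge0.
  by apply: ler_pM; rewrite ?f1 ?g1.
have -> : f x * g x - f y * g y = f x * (g x - g y) + (f x - f y) * g y by ring.
rewrite (le_trans (ler_normD _ _))// [leRHS]mulrDl; apply: lerD; rewrite normrM.
  by rewrite -mulrA; apply: ler_pM; rewrite ?f1 ?g2.
by rewrite mulrAC; apply: ler_pM; rewrite ?f2 ?g1.
Qed.

Lemma bounded_lipschitz_sum (I : Type) (r : seq I) (h : I -> V -> R) :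
  (forall i, bounded_lipschitz (h i)) ->
  bounded_lipschitz (fun x => \sum_(i <- r) h i x).
Proof.
move=> H; elim: r => [|i r IH].
  rewrite (_ : (fun x => _) = fun=> 0); first exact: bounded_lipschitz_cst.
  by apply/funext => x; rewrite big_nil.
rewrite (_ : (fun x => _) = fun x => h i x + \sum_(j <- r) h j x).
  exact: bounded_lipschitzD.
by apply/funext => x; rewrite big_cons.
Qed.

Lemma bounded_lipschitzN f : bounded_lipschitz f -> bounded_lipschitz (fun x => - f x).
Proof.
move=> Hf; rewrite (_ : (fun x => _) = fun x => (-1) * f x).
  by apply: bounded_lipschitzM => //; exact: bounded_lipschitz_cst.
by apply/funext => x; rewrite mulN1r.
Qed.

End bounded_lipschitz.

Lemma measure_bigsetU_le d (T : measurableType d) (R : realType)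
    (m : {measure set T -> \bar R}) (I : Type) (s : seq I) (A : I -> set T) (c : R) :
  (forall i, measurable (A i)) -> (forall i, m (A i) <= c%:E)%E ->
  (m (\big[setU/set0]_(i <- s) A i) <= ((size s)%:R * c)%:E)%E.
Proof.
move=> mA Ac; elim: s => [|i s IH]; first by rewrite big_nil measure0 mul0r.
rewrite big_cons (le_trans (measureU2 _ _ _))//; first exact: bigsetU_measurable.
rewrite /= -natr1 mulrDl mul1r addrC EFinD; exact: leeD.
Qed.

Section easy_sard.
Context {R : realType} {n : nat}.
Notation mu := (lebesgue_rV R n).
Notation lam := (@lebesgue_measure R).

(** The cube is cut into [K^n] cells of half side [M / K]; the index in direction [i] is the integer
    part of [(x_i + M) K / (2 M)]. *)
Lemma cube_cells (M : R) (K : nat) (x : 'rV[R]_n) : 0 < M -> (0 < K)%N -> `|x| < M ->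
  exists c : {ffun 'I_n -> 'I_K}, forall i,
    `|x ord0 i - (- M + (2 * (c i)%:R + 1) * M / K%:R)| <= M / K%:R.
Proof.
move=> M0 K0 xM; have K0' : 0 < K%:R :> R by rewrite ltr0n.
have H (i : 'I_n) : exists j : 'I_K,
    `|x ord0 i - (- M + (2 * j%:R + 1) * M / K%:R)| <= M / K%:R.
  have := le_lt_trans (coord_le_norm x i) xM; rewrite ltr_norml => /andP[xi1 xi2].
  pose y := (x ord0 i + M) * K%:R / (2 * M).
  have y0 : 0 <= y by rewrite divr_ge0 ?mulr_ge0//; [lra|exact: ltW].
  have yK : y < K%:R.
    rewrite ltr_pdivrMr ?mulr_gt0// mulrC ltr_pM2l//; lra.
  have tK : (Num.truncn y < K)%N.
    by rewrite -(ltr_nat R) (le_lt_trans _ yK)//; have /andP[] := truncn_itv y0.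
  exists (Ordinal tK) => /=.
  have := truncn_itv y0 => /andP[]; set j := (Num.truncn y)%:R.
  rewrite -natr1 -/j => j1 j2.
  have xy : x ord0 i = - M + 2 * y * (M / K%:R).
    by rewrite /y; field; rewrite gt_eqF//= gt_eqF.
  rewrite xy.
  have -> : - M + 2 * y * (M / K%:R) - (- M + (2 * j + 1) * M / K%:R) =
    (2 * (y - j) - 1) * (M / K%:R) by ring.
  have MK0 : 0 <= M / K%:R by exact: divr_ge0 (ltW M0) (ltW K0').
  rewrite normrM (ger0_norm MK0) ler_piMl//.
  by rewrite ler_norml; apply/andP; split; lra.
have [f Hf] := choice H.
by exists [ffun i => f i] => i; rewrite ffunE.
Qed.

(** The image is [n]-dimensional in a space of dimension [n + 1]: of order [K^n] cells, each mapped
    into a box of measure of order [K^-(n+1)], leave a total of order [1 / K]. *)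
Lemma lipschitz_image_null (M : R) (A : 'I_n -> 'rV[R]_n -> R) (B : 'rV[R]_n -> R) :
  0 < M -> (forall i, bounded_lipschitz (ball (0 : 'rV[R]_n) M) (A i)) ->
  bounded_lipschitz (ball (0 : 'rV[R]_n) M) B ->
  exists N : set ('rV[R]_n * measurableTypeR R), [/\ measurable N, (mu \x lam)%E N = 0%E &
    forall x, ball (0 : 'rV[R]_n) M x -> N (\row_i A i x, B x)].
Proof.
move=> M0 HA HB.
have [L L0 [LA LB]] : exists2 L : R, 0 <= L &
    (forall i x y, ball (0 : 'rV[R]_n) M x -> ball (0 : 'rV[R]_n) M y ->
       `|A i x - A i y| <= L * `|x - y|) /\
    (forall x y, ball (0 : 'rV[R]_n) M x -> ball (0 : 'rV[R]_n) M y ->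
       `|B x - B y| <= L * `|x - y|).
  have H i : exists C : R, 0 <= C /\ forall x y, ball (0 : 'rV[R]_n) M x ->
      ball (0 : 'rV[R]_n) M y -> `|A i x - A i y| <= C * `|x - y|.
    by have [C C0 [_ HC]] := HA i; exists C.
  have [C HC] := choice H; have [D D0 [_ HD]] := HB.
  have C0 i : 0 <= C i by case: (HC i).
  exists (D + \sum_i C i); first by rewrite addr_ge0// sumr_ge0.
  split => [i x y Sx Sy|x y Sx Sy].
    case: (HC i) => _ /(_ x y Sx Sy) /le_trans; apply; rewrite ler_wpM2r//.
    rewrite (bigD1 i)//= addrCA lerDl addr_ge0// sumr_ge0//.
  by rewrite (le_trans (HD x y Sx Sy))// ler_wpM2r// lerDl sumr_ge0.
(* [2 L M / (K + 1)] is the Lipschitz constant times the diameter of a cell; the added 1 makes the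
   box strictly larger than the image, even if [L = 0]. *)
pose rho (K : nat) := (2 * L * M + 1) / K.+1%:R.
have rho0 K : 0 < rho K.
  by rewrite divr_gt0// ltr_wpDl// !mulr_ge0// ltW.
pose Q (K : nat) (c : {ffun 'I_n -> 'I_K.+1}) := [set x | ball (0 : 'rV[R]_n) M x /\
  forall i, `|x ord0 i - (- M + (2 * (c i)%:R + 1) * M / K.+1%:R)| <= M / K.+1%:R].
(* The box is centred at the image of a chosen point of the cell; a cell without points contributes
   the empty set. *)
pose bx K (c : {ffun 'I_n -> 'I_K.+1}) : set ('rV[R]_n * measurableTypeR R) :=
  if pselect (exists x, Q K c x) is left H then
    ball (\row_i A i (sval (cid H))) (rho K) `*` ball (B (sval (cid H))) (rho K)
  else set0.
have mbx K c : measurable (bx K c).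
  rewrite /bx; case: pselect => // H; apply: measurableX.
    exact: measurable_rV_ball.
  exact: measurable_ball.
have bxle K c : ((mu \x lam) (bx K c) <= ((rho K *+ 2) ^+ n.+1)%:E)%E.
  rewrite /bx; case: pselect => [H|_]; last first.
    by rewrite measure0 lee_fin exprn_ge0// mulrn_wge0// ltW.
  rewrite product_measure1E; last 2 first.
  - exact: measurable_rV_ball.
  - exact: measurable_ball.
  rewrite [leLHS](_ : _ = (((rho K *+ 2) ^+ n)%:E * (rho K *+ 2)%:E)%E).
    by rewrite -EFinM -exprSr.
  congr (_ * _)%E; first exact: lebesgue_rV_ball.
  exact/lebesgue_measure_ball/ltW.
pose U K := \big[setU/set0]_(c <- enum {: {ffun 'I_n -> 'I_K.+1}}) bx K c.
have mU K : measurable (U K) by exact: bigsetU_measurable.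
have US K x : ball (0 : 'rV[R]_n) M x -> U K (\row_i A i x, B x).
  move=> Sx; have xM : `|x| < M by move: Sx; rewrite rV_ballE/= sub0r normrN.
  have [c Hc] := cube_cells M0 (ltn0Sn K) xM.
  rewrite /U -bigcup_seq/=; exists c; first by rewrite /= mem_enum.
  have Hx : exists x, Q K c x by exists x; split.
  rewrite /bx; case: pselect => // H.
  have [Sy Hy] := svalP (cid H); set y := sval (cid H) in Sy Hy *.
  have xy : `|y - x| <= 2 * M / K.+1%:R.
    apply/rV_norm_leP => [|i]; first by rewrite divr_ge0// mulr_ge0// ltW.
    rewrite !mxE.
    have := Hc i; have := Hy i; rewrite -[2 * M / _]mulrA.
    set p := (- M + _); set q := M / _ => yp xp.
    by have := ler_distD p (y ord0 i) (x ord0 i); rewrite [`|p - _|]distrC; lra.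
  have yx : L * `|y - x| < rho K.
    rewrite (le_lt_trans (ler_wpM2l L0 xy))// /rho.
    by rewrite mulrA ltr_pM2r ?invr_gt0// mulrA [L * 2]mulrC ltrDl.
  split => /=.
    rewrite rV_ballE/=; apply/rV_norm_ltP => // i; rewrite !mxE.
    by rewrite (le_lt_trans (LA _ _ _ Sy Sx)).
  by rewrite -ball_normE/= (le_lt_trans (LB _ _ Sy Sx)).
exists (\bigcap_K U K); split.
- exact: bigcapT_measurable.
- apply/eqP; rewrite eq_le measure_ge0 andbT.
  pose C := (2 * (2 * L * M + 1)) ^+ n.+1.
  have C0 : 0 <= C by rewrite exprn_ge0// mulr_ge0// addr_ge0// !mulr_ge0// ltW.
  apply/lee_addgt0Pr => e e0; rewrite add0e.
  have [K KE] : exists K : nat, C / e < K.+1%:R.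
    by exists (Num.truncn (C / e)); exact: truncnS_gt.
  rewrite (@le_trans _ _ ((mu \x lam)%E (U K)))//.
    by apply: le_measure; rewrite ?inE//; [exact: bigcapT_measurable|exact: bigcap_inf].
  apply: (le_trans (measure_bigsetU_le _ (@mbx K) (@bxle K))).
  rewrite -cardE card_ffun !card_ord lee_fin natrX.
  have -> : rho K *+ 2 = 2 * (2 * L * M + 1) / K.+1%:R by rewrite /rho -mulr_natl mulrA.
  rewrite exprMn -/C exprVn exprS mulrCA invfM [K.+1%:R^-1 * _]mulrC [X in C * X]mulrA.
  rewrite mulfV ?expf_neq0// mul1r ler_pdivrMr// mulrC -ler_pdivrMr//; exact: ltW.
- by move=> x Sx K _; exact: US.
Qed.

Variables (u : 'rV[R]_n -> R) (G : 'I_n -> 'rV[R]_n -> R).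
Hypothesis u_lip : exists2 C : R, 0 <= C & forall x y, `|u x - u y| <= C * `|x - y|.
Hypothesis G_lip : forall i, exists2 C : R, 0 <= C &
  forall x y, `|G i x - G i y| <= C * `|x - y|.

Definition atan_pert (a : 'rV[R]_n) (x : 'rV[R]_n) : R :=
  \sum_(i < n) a ord0 i * atan (x ord0 i).

Let lip_ball f M : (exists2 C : R, 0 <= C & forall x y, `|f x - f y| <= C * `|x - y|) ->
  0 < M -> bounded_lipschitz (ball (0 : 'rV[R]_n) M) f.
Proof.
move=> [C C0 HC] M0; exists (C + (C * M + `|f 0|)).
  by rewrite !addr_ge0// mulr_ge0// ltW.
split => [x|x y _ _].
  rewrite rV_ballE/= => xM.
  rewrite (le_trans (_ : _ <= C * M + `|f 0|))//; last by rewrite lerDr.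
  have := ler_normD (f x - f 0) (f 0); rewrite subrK => /le_trans; apply.
  rewrite lerD2r (le_trans (HC _ _))// ler_wpM2l//.
  by rewrite distrC ltW.
by rewrite (le_trans (HC _ _))// ler_wpM2r// lerDl addr_ge0// mulr_ge0// ltW.
Qed.

(* A critical point [x] of [u + atan_pert a] at level [t] determines
   [a i = - (1 + x_i ^+ 2) * G i x] and then [t]. *)
Lemma generic_regular_value (delta : R) : 0 < delta ->
  exists2 a : 'rV[R]_n, `|a| < delta &
  exists Z : set (measurableTypeR R), [/\ measurable Z, lam Z = 0%E &
    forall t, ~ Z t -> forall x, u x + atan_pert a x = t ->
      exists i, G i x + a ord0 i / (1 + x ord0 i ^+ 2) != 0].
Proof.
move=> d0.
pose A i (x : 'rV[R]_n) : R := - ((1 + x ord0 i ^+ 2) * G i x).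
pose B (x : 'rV[R]_n) : R := u x + \sum_(i < n) A i x * atan (x ord0 i).
have Lcoord M i : 0 < M -> bounded_lipschitz (ball (0 : 'rV[R]_n) M) (fun x => x ord0 i).
  apply: lip_ball; exists 1 => // x y; rewrite mul1r.
  by have := coord_le_norm (x - y) i; rewrite !mxE.
have LA M i : 0 < M -> bounded_lipschitz (ball (0 : 'rV[R]_n) M) (A i).
  move=> M0; apply/bounded_lipschitzN/bounded_lipschitzM; last exact: lip_ball.
  apply: bounded_lipschitzD; first exact: bounded_lipschitz_cst.
  by apply: bounded_lipschitzM; exact: Lcoord.
have Latan M i : 0 < M -> bounded_lipschitz (ball (0 : 'rV[R]_n) M) (fun x => atan (x ord0 i)).
  apply: lip_ball; exists 1 => // x y.
  rewrite (le_trans (atan_lipschitz _ _))// mul1r.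
  by have := coord_le_norm (x - y) i; rewrite !mxE.
have LB M : 0 < M -> bounded_lipschitz (ball (0 : 'rV[R]_n) M) B.
  move=> M0; apply: bounded_lipschitzD; first exact: lip_ball.
  apply: bounded_lipschitz_sum => i.
  by apply: bounded_lipschitzM; [exact: LA|exact: Latan].
have H (M : nat) : exists N : set ('rV[R]_n * measurableTypeR R),
   [/\ measurable N, (mu \x lam)%E N = 0%E &
    forall x, ball (0 : 'rV[R]_n) M.+1%:R x -> N (\row_i A i x, B x)].
  by apply: lipschitz_image_null => //; [move=> i; exact: LA|exact: LB].
have [N HN] := choice H.
pose NN := \bigcup_M N M.
have mNN : measurable NN by apply: bigcupT_measurable => M; case: (HN M).
have NN0 : (mu \x lam)%E NN = 0%E.
  apply: measure_negligible => //; apply: negligible_bigcup => M.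
  by exists (N M); split => //; case: (HN M).
have NNall x : NN (\row_i A i x, B x).
  exists (Num.truncn `|x|) => //; have [_ _] := HN (Num.truncn `|x|); apply.
  by rewrite rV_ballE/= sub0r normrN truncnS_gt.
have [Z0 [mZ0 Z00 HZ0]] : {ae mu, forall a, lam (xsection NN a) = 0%E}.
  have mx := @measurable_fun_xsection _ _ 'rV[R]_n (measurableTypeR R) R lam NN mNN.
  have := (ae_eq_integral_abs mu measurableT mx).1.
  have -> : (\int[mu]_x `|(lam \o xsection NN) x| = 0)%E.
    rewrite -[RHS]NN0 /product_measure1; apply: eq_integral => a _.
    by rewrite gee0_abs.
  by move=> /(_ erefl); apply: filterS => a /= /(_ I).
have [a ad Za] : exists2 a : 'rV[R]_n, `|a| < delta & lam (xsection NN a) = 0%E.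
  apply: contrapT => Hno.
  have sub : ball (0 : 'rV[R]_n) delta `<=` Z0.
    move=> a; rewrite rV_ballE/= sub0r normrN => ad.
    by apply: HZ0 => Ha; apply: Hno; exists a.
  have : (mu (ball (0%R : 'rV[R]_n) delta) <= mu Z0)%E.
    by apply: le_measure; rewrite ?inE//; exact: measurable_rV_ball.
  have -> : mu Z0 = 0%E by [].
  by rewrite lebesgue_rV_ball// lee_fin leNgt exprn_gt0// mulrn_wgt0.
exists a => //; exists (xsection NN a); split => //.
  exact: measurable_xsection.
move=> t Zt x ut; apply: contrapT => Hno; apply: Zt.
have aA i : a ord0 i = A i x.
  have : G i x + a ord0 i / (1 + x ord0 i ^+ 2) = 0.
    by apply/eqP; apply: contrapT => /negP Hi; apply: Hno; exists i.
  have x2 : 1 + x ord0 i ^+ 2 != 0 by rewrite gt_eqF// ltr_pwDl// sqr_ge0.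
  move/eqP; rewrite addrC addr_eq0 => /eqP H1.
  by rewrite /A -mulrN -H1 mulrC divfK.
have -> : a = \row_i A i x by apply/rowP => i; rewrite mxE aA.
have -> : t = B x.
  by rewrite -ut /B /atan_pert; congr (_ + _); apply: eq_bigr => i _; rewrite aA.
apply/mem_set; exact: NNall.
Qed.

End easy_sard.

(** * Integrals against the kernel *)

Section pair_integral.
Context {R : realType} {n : nat}.
Notation mu := (lebesgue_rV R n).
Notation V := 'rV[R]_n.
Variable s : R.
Hypotheses (s0 : 0 < s) (s1 : s < 1).
Implicit Types (g h : V * V -> R) (A B E F : set V) (S : set (V * V)).
Local Open Scope ereal_scope.

(** Perimeters, Gagliardo seminorms and error terms are all integrals of this shape, with different
    weights [g] on pairs. *)
Definition pint g : \bar R :=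
  \int[mu \x mu]_p (g p * kern s (p.1 - p.2)%R)%:E.

Lemma measurable_pkern g : measurable_fun setT g ->
  measurable_fun setT (fun p : V * V => (g p * kern s (p.1 - p.2)%R)%:E).
Proof.
move=> mg; apply/measurable_EFinP/measurable_funM => //.
apply: (measurableT_comp (measurable_kern s)); exact: measurable_rV_sub.
Qed.

Lemma pint_ge0 g : (forall p, (0 <= g p)%R) -> 0 <= pint g.
Proof.
by move=> g0; apply: integral_ge0 => p _; rewrite lee_fin mulr_ge0// kern_ge0.
Qed.

Lemma pint_le g h : measurable_fun setT g -> measurable_fun setT h ->
  (forall p, (0 <= g p)%R) -> (forall p, (g p <= h p)%R) -> pint g <= pint h.
Proof.
move=> mg mh g0 gh; apply: ge0_le_integralT => //.
- exact: measurable_pkern.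
- exact: measurable_pkern.
- by move=> p; rewrite lee_fin mulr_ge0// kern_ge0.
- by move=> p _; rewrite lee_fin ler_wpM2r// kern_ge0.
Qed.

Lemma pintD g h : measurable_fun setT g -> measurable_fun setT h ->
  (forall p, (0 <= g p)%R) -> (forall p, (0 <= h p)%R) ->
  pint (fun p => g p + h p)%R = pint g + pint h.
Proof.
move=> mg mh g0 h0; rewrite /pint -ge0_integralD//.
- by apply: eq_integral => p _; rewrite mulrDl EFinD.
- by move=> p _; rewrite lee_fin mulr_ge0// kern_ge0.
- exact: measurable_pkern.
- by move=> p _; rewrite lee_fin mulr_ge0// kern_ge0.
- exact: measurable_pkern.
Qed.

Lemma pkern_ge0 g : (forall p, (0 <= g p)%R) ->
  forall p, 0 <= (g p * kern s (p.1 - p.2)%R)%:E.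
Proof. by move=> g0 p; rewrite lee_fin mulr_ge0// kern_ge0. Qed.

Lemma pint_fubini1 g : measurable_fun setT g -> (forall p, (0 <= g p)%R) ->
  pint g = \int[mu]_x \int[mu]_y (g (x, y) * kern s (x - y)%R)%:E.
Proof. by move=> mg g0; exact: (@fubini_tonelli1 _ _ V V R mu mu _ (measurable_pkern mg) (pkern_ge0 g0)). Qed.

Lemma pint_fubini2 g : measurable_fun setT g -> (forall p, (0 <= g p)%R) ->
  pint g = \int[mu]_y \int[mu]_x (g (x, y) * kern s (x - y)%R)%:E.
Proof. by move=> mg g0; exact: (@fubini_tonelli2 _ _ V V R mu mu _ (measurable_pkern mg) (pkern_ge0 g0)). Qed.

Lemma measurable_pswap : measurable_fun setT (fun p : V * V => (p.2, p.1)).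
Proof. exact: measurable_fun_pair. Qed.

Lemma pint_swap g : measurable_fun setT g -> (forall p, (0 <= g p)%R) ->
  pint (fun p => g (p.2, p.1)) = pint g.
Proof.
move=> mg g0; have mg' : measurable_fun setT (fun p : V * V => g (p.2, p.1)).
  exact: (measurableT_comp mg measurable_pswap).
rewrite (pint_fubini1 mg' (fun=> g0 _)) (pint_fubini2 mg g0).
by apply: eq_integral => x _; apply: eq_integral => y _ /=; rewrite kern_subC.
Qed.

Lemma pint_shift g z : measurable_fun setT g -> (forall p, (0 <= g p)%R) ->
  pint (fun p => g (p.1 + z, p.2 + z)%R) = pint g.
Proof.
move=> mg g0.
have mg' : measurable_fun setT (fun p : V * V => g (p.1 + z, p.2 + z)%R).
  apply: (measurableT_comp mg); apply: measurable_fun_pair.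
    apply: (measurableT_comp (measurable_rVD z)); exact: measurable_fst.
  apply: (measurableT_comp (measurable_rVD z)); exact: measurable_snd.
rewrite (pint_fubini1 mg' (fun=> g0 _)) (pint_fubini1 mg g0).
pose H x := \int[mu]_y (g (x, y) * kern s (x - y)%R)%:E.
have mH : measurable_fun setT H.
  exact: (measurable_fun_fubini_tonelli_F _ (measurable_pkern mg) (pkern_ge0 g0)).
transitivity (\int[mu]_x H (x + z)%R); last first.
  apply: ge0_integral_shift => // x; apply: integral_ge0 => y _.
  exact: (pkern_ge0 g0 (x, y)).
apply: eq_integral => x _; rewrite /H.
have mHx : measurable_fun setT (fun y => (g (x + z, y) * kern s (x + z - y)%R)%:E).
  apply: (measurableT_comp (measurable_pkern mg) (g := fun y => (x + z, y)%R)).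
  exact: measurable_fun_pair.
apply: etrans; last exact: (ge0_integral_shift z mHx (fun y => pkern_ge0 g0 (x + z, y)%R)).
by apply: eq_integral => y _ /=; rewrite opprD addrACA subrr addr0.
Qed.

(** The substitution [y = x + z] separates the variables. *)
Lemma pint_fst A (h : V -> R) : measurable A -> measurable_fun setT h ->
  (forall z, (0 <= h z)%R) ->
  pint (fun p => \1_A p.1 * h (p.2 - p.1))%R = mu A * \int[mu]_z (h z * kern s z)%:E.
Proof.
move=> mA mh h0.
have mi : measurable_fun setT (fun p : V * V => \1_A p.1 : R).
  exact: measurableT_comp (measurable_indic mA) measurable_fst.
have ms : measurable_fun setT (fun p : V * V => h (p.2 - p.1)%R).
  apply: (measurableT_comp mh).
  exact: (measurableT_comp measurable_rV_sub measurable_pswap).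
have mg := measurable_funM mi ms.
rewrite (pint_fubini1 mg); last by move=> p; rewrite mulr_ge0.
have mhk : measurable_fun setT (fun z => (h z * kern s z)%:E).
  by apply/measurable_EFinP/measurable_funM => //; exact: measurable_kern.
have hk0 z : 0 <= (h z * kern s z)%:E by rewrite lee_fin mulr_ge0// kern_ge0.
transitivity (\int[mu]_x ((\1_A x)%:E * \int[mu]_z (h z * kern s z)%:E)).
  apply: eq_integral => x _ /=.
  transitivity (\int[mu]_y ((\1_A x)%:E * (h (y + - x) * kern s (y + - x))%:E)).
    by apply: eq_integral => y _; rewrite kern_subC -mulrA EFinM.
  have mhx : measurable_fun setT (fun y : V => (h (y + - x) * kern s (y + - x))%:E).
    exact: (measurableT_comp mhk (measurable_rVD (- x)%R)).
  have hkx0 (y : V) : setT y -> 0 <= (h (y + - x) * kern s (y + - x))%:E by move=> _; exact: hk0.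
  have A0 : (0 <= (\1_A x : R))%R by [].
  have I2 : \int[mu]_y (h (y + - x) * kern s (y + - x))%:E = \int[mu]_z (h z * kern s z)%:E.
    exact: (ge0_integral_shift (- x)%R mhk hk0).
  apply: (etrans (ge0_integralZl_EFin mu measurableT hkx0 mhx A0)).
  exact: (congr1 (fun t => (\1_A x)%:E * t) I2).
rewrite ge0_integralZr//.
- by rewrite integral_indic// setIT.
- by apply/measurable_EFinP; exact: measurable_indic.
- by apply: integral_ge0.
Qed.

(** The pairs whose interaction is counted by a perimeter relative to [A]. *)
Definition Dm A : set (V * V) := [set p | A p.1 \/ A p.2].

Lemma measurable_fst_pre A : measurable A -> measurable [set p : V * V | A p.1].
Proof. by move=> mA; rewrite -[X in measurable X]setTI; exact: measurable_fst. Qed.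

Lemma measurable_snd_pre A : measurable A -> measurable [set p : V * V | A p.2].
Proof. by move=> mA; rewrite -[X in measurable X]setTI; exact: measurable_snd. Qed.

Lemma measurable_Dm A : measurable A -> measurable (Dm A).
Proof.
move=> mA; apply: measurableU; [exact: measurable_fst_pre|exact: measurable_snd_pre].
Qed.

Lemma measurable_pdist : measurable_fun setT (fun p : V * V => `|p.1 - p.2|%R).
Proof.
apply: (measurableT_comp (f := fun z : V => `|z|%R)); last exact: measurable_rV_sub.
by apply: continuous_measurable_rV; exact: norm_continuous.
Qed.

Lemma measurable_pnear (r : R) : measurable [set p : V * V | (`|p.1 - p.2| < r)%R].
Proof.
rewrite (_ : mkset _ = (fun p : V * V => `|p.1 - p.2|%R) @^-1` `]-oo, r[%classic).
  by rewrite -[X in measurable X]setTI; exact: measurable_pdist.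
by apply/seteqP; split => p /=; rewrite in_itv.
Qed.

(** Dominated convergence: at every pair the integrand is eventually 0, and [g] times the kernel
    dominates. *)
Lemma pint_cvg0 g (S_ : nat -> set (V * V)) : measurable_fun setT g ->
  (forall p, (0 <= g p)%R) -> pint g < +oo ->
  (forall k, measurable (S_ k)) ->
  (forall p, g p != 0%R -> exists N, forall k, (N <= k)%N -> ~ S_ k p) ->
  forall e : \bar R, 0 < e -> exists k, pint (fun p => \1_(S_ k) p * g p)%R < e.
Proof.
move=> mg g0 goo mS HS e e0.
have mk := measurable_pkern mg.
have gk0 p : 0 <= (g p * kern s (p.1 - p.2)%R)%:E by rewrite lee_fin mulr_ge0// kern_ge0.
have mSg k : measurable_fun setT (fun p => \1_(S_ k) p * g p)%R.
  by apply: measurable_funM => //; exact: measurable_indic.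
have [|||||_ _] := @dominated_convergence _ _ R (mu \x mu) setT measurableT
  (fun k p => ((\1_(S_ k) p * g p) * kern s (p.1 - p.2)%R)%:E) (fun=> 0)
  (fun p => (g p * kern s (p.1 - p.2)%R)%:E).
- by move=> k; exact: measurable_pkern.
- exact: measurable_cst.
- apply: aeW => p _; have [gp|/HS[N HN]] := eqVneq (g p) 0%R.
    by under eq_fun do rewrite gp mulr0 mul0r; exact: cvg_cst.
  apply: cvg_near_cst; exists N => //= k Nk.
  by rewrite indicE memNset ?mul0r//; exact: HN.
- apply/integrableP; split => //.
  by rewrite (le_lt_trans _ goo)// le_eqVlt; apply/orP; left; apply/eqP;
    apply: eq_integral => p _; rewrite gee0_abs.
- apply: aeW => p k _; rewrite gee0_abs ?lee_fin.
    by rewrite -mulrA ler_piMl ?mulr_ge0// ?kern_ge0// indicE; case: (_ \in _).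
  by rewrite !mulr_ge0// kern_ge0.
rewrite integral0 => /cvg_ereal_lt /(_ e0) [N HN].
by exists N; exact: (HN N).
Qed.

(** The strips shrink to the diagonal, where [g] vanishes. *)
Lemma pint_near_small g : measurable_fun setT g -> (forall p, (0 <= g p)%R) ->
  pint g < +oo -> (forall x, g (x, x) = 0%R) -> forall e : R, (0 < e)%R ->
  exists2 r : R, (0 < r)%R & pint (fun p => \1_[set p | (`|p.1 - p.2| < r)%R] p * g p)%R < e%:E.
Proof.
move=> mg g0 goo gd e e0.
have [||k Hk] := @pint_cvg0 g (fun k => [set p | (`|p.1 - p.2| < k.+1%:R^-1)%R])
  mg g0 goo _ _ e%:E e0.
- by move=> k; exact: measurable_pnear.
- move=> [x y] gxy.
  have xy : (0 < `|x - y|)%R.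
    rewrite normr_gt0 subr_eq0; apply/eqP => xy; move: gxy.
    by rewrite xy gd eqxx.
  exists (Num.truncn (`|x - y|^-1)%R) => k Nk /=; apply/negP; rewrite -leNgt.
  rewrite invf_ple ?posrE// ltW// (lt_le_trans (truncnS_gt _))// ler_nat ltnS; exact: Nk.
- by exists (k.+1%:R^-1)%R.
Qed.

(** Away from the diagonal the kernel is integrable in the second variable, uniformly in the first;
    hence a constant independent of [A]. *)
Lemma pint_far_fst (r : R) : (0 < r)%R -> exists2 C : R, (0 <= C)%R &
  forall A, measurable A ->
    pint (fun p => \1_A p.1 * \1_(~` [set p | (`|p.1 - p.2| < r)%R]) p)%R <= mu A * C%:E.
Proof.
move=> r0; have [C [C0 HC]] := @kern_far_integral_lty R n s r s0 s1 r0.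
exists C => // A mA.
rewrite (_ : (fun p => _) = (fun p : V * V => \1_A p.1 * \1_[set z0 : V | (r <= `|z0|)%R] (p.2 - p.1))%R).
  have mS : measurable [set z : V | (r <= `|z|)%R].
    rewrite (_ : mkset _ = (fun z : V => `|z|%R) @^-1` `[r, +oo[%classic).
      rewrite -[X in measurable X]setTI; apply: continuous_measurable_rV => //.
      exact: norm_continuous.
    by apply/seteqP; split => z /=; rewrite in_itv/= andbT.
  have mi : measurable_fun setT (\1_[set z : V | (r <= `|z|)%R] : V -> R).
    exact: measurable_indic.
  have i0 z : (0 <= (\1_[set z : V | (r <= `|z|)%R] z : R))%R by [].
  by rewrite [leLHS](pint_fst mA mi i0) lee_wpmul2l.
apply/funext => p; congr (_ * _)%R; rewrite !indicE; congr (_%:R); congr nat_of_bool.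
apply/idP/idP => /set_mem/= H; apply/mem_set => /=.
  by rewrite distrC leNgt; apply/negP.
by apply/negP; rewrite -leNgt distrC.
Qed.

End pair_integral.

(** * Small translations in the Gagliardo seminorm *)

Section translation.
Context {R : realType} {n : nat}.
Notation mu := (lebesgue_rV R n).
Notation V := 'rV[R]_n.
Variable s : R.
Hypotheses (s0 : 0 < s) (s1 : s < 1).
Implicit Types (A E W : set V) (z : V).
Local Open Scope ereal_scope.

Lemma tail_small E (e : R) : measurable E -> mu E < +oo -> (0 < e)%R ->
  exists k : nat, mu (E `\` ball (0%R : V) k.+1%:R) < e%:E.
Proof.
move=> mE Eoo e0; pose H (k : nat) := E `\` ball (0%R : V) k.+1%:R.
have mH k : measurable (H k) by apply: measurableD => //; exact: measurable_rV_ball.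
have Hcvg : mu \o H @ \oo --> mu (\bigcap_k H k).
  apply: nonincreasing_cvg_mu => //.
  - by rewrite (le_lt_trans _ Eoo)//; apply: le_measure; rewrite ?inE//; exact: subDsetl.
  - by apply: bigcapT_measurable.
  - move=> a b ab; apply/subsetPset; apply: setDS; apply: le_ball.
    by rewrite ler_nat.
have H0 : \bigcap_k H k = set0.
  apply/seteqP; split => // x /(_ (Num.truncn `|x|%R) I)[_]; apply.
  by rewrite rV_ballE/= sub0r normrN truncnS_gt.
rewrite H0 measure0 in Hcvg.
have e0' : 0 < e%:E by rewrite lte_fin.
by have [N HN] := cvg_ereal_lt Hcvg e0'; exists N; exact: (HN N).
Qed.

(** The global form of [shift_continuous] for sets of finite measure: the part of [E] outside a
    large ball is small, and so is its translate. *)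
Lemma shiftD_small E (e : R) : measurable E -> mu E < +oo -> (0 < e)%R ->
  exists2 q : R, (0 < q)%R & forall z, (`|z| < q)%R -> mu (shiftD E z) < e%:E.
Proof.
move=> mE Eoo e0; have e30 : (0 < e / 3)%R by rewrite divr_gt0.
have [k Hk] := tail_small mE Eoo e30.
pose T := E `\` ball (0%R : V) k.+1%:R.
have mT : measurable T by apply: measurableD => //; exact: measurable_rV_ball.
(* The radius is one more than that of the tail, so that outside this ball both [x] and [x + z] are
   in the tail region when [|z| < 1]. *)
have [q q0 Hq] := @shift_continuous R n E k.+2%:R _ mE (ltr0Sn _ _) e30.
exists (Num.min q 1%R); first by rewrite lt_min q0 ltr01.
move=> z; rewrite lt_min => /andP[zq z1].
have mB : measurable (shiftD E z `&` ball (0%R : V) k.+2%:R).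
  by apply: measurableI; [exact: measurable_shiftD|exact: measurable_rV_ball].
have mTz := measurable_shift z mT.
rewrite (@le_lt_trans _ _ (mu ((shiftD E z `&` ball (0%R : V) k.+2%:R) `|`
    (((fun x => (x + z)%R) @^-1` T) `|` T))))//.
  apply: le_measure; rewrite ?inE; [exact: measurable_shiftD| |].
    by apply: measurableU => //; exact: measurableU.
  move=> x Ex; have [xM|xM] := pselect (ball (0%R : V) k.+2%:R x); first by left.
  right; move: xM; rewrite rV_ballE/= sub0r normrN => /negP; rewrite -leNgt => xM.
  case: Ex => -[H1 H2]; [left|right]; split => //; rewrite rV_ballE/= sub0r normrN;
    apply/negP; rewrite -leNgt.
    have := ler_normB (x + z)%R z; rewrite addrK => H.
    have := le_trans xM H; rewrite -natr1 => H'.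
    by rewrite -(lerD2r 1) (le_trans H')// lerD2l ltW.
  by rewrite (le_trans _ xM)// ler_nat.
rewrite (le_lt_trans (measureU2 _ _ _))//; first exact: measurableU.
rewrite (_ : e%:E = (e / 3)%:E + ((e / 3)%:E + (e / 3)%:E)); last first.
  by rewrite -!EFinD; congr EFin; lra.
rewrite lteD ?Hq// (le_lt_trans (measureU2 _ _ _))//.
by apply: lteD => //; rewrite (_ : _ ((fun x : V => _) @^-1` T) = mu T)//; exact: lebesgue_rV_shift.
Qed.

Notation near r := [set p : V * V | (`|p.1 - p.2| < r)%R].

Lemma measurable_ind (d : measure_display) (T : measurableType d) (S : set T) :
  measurable S -> measurable_fun setT (\1_S : T -> R).
Proof. by move=> mS; exact: measurable_indic. Qed.

Lemma measurable_ind_fst A : measurable A -> measurable_fun setT (fun p : V * V => \1_A p.1 : R).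
Proof. by move=> mA; exact: measurableT_comp (measurable_ind mA) measurable_fst. Qed.

Lemma measurable_ind_snd A : measurable A -> measurable_fun setT (fun p : V * V => \1_A p.2 : R).
Proof. by move=> mA; exact: measurableT_comp (measurable_ind mA) measurable_snd. Qed.

Lemma measurable_far (r : R) : measurable (~` near r).
Proof. by apply: measurableC; exact: measurable_pnear. Qed.

Lemma ind_le (T : Type) (S S' : set T) (x : T) : (S x -> S' x) -> (\1_S x <= \1_S' x :> R)%R.
Proof.
move=> SS; rewrite !indicE; by have [/set_mem/SS/mem_set ->|_] := boolP (x \in S).
Qed.

Lemma indDm_le A (p : V * V) : (\1_(Dm A) p <= \1_A p.1 + \1_A p.2 :> R)%R.
Proof.
rewrite !indicE; have [/set_mem[]/= /mem_set ->|_] := boolP (p \in Dm A).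
- by rewrite lerDl; case: (_ \in _).
- by rewrite lerDr; case: (_ \in _).
- by rewrite addr_ge0.
Qed.

Lemma pint_sym2 (g : V * V -> R) : measurable_fun setT g -> (forall p, 0 <= g p)%R ->
  pint s (fun p => g p + g (p.2, p.1))%R = 2%:E * pint s g.
Proof.
move=> mg g0; rewrite pintD//; last exact: (measurableT_comp mg measurable_pswap).
rewrite pint_swap// (_ : 2%:E = 1%:E + 1%:E); last by rewrite -EFinD.
by rewrite ge0_muleDl ?lee_fin// !mul1e.
Qed.

Lemma pint_far_lty A (r : R) : measurable A -> mu A < +oo -> (0 < r)%R ->
  pint s (fun p => \1_(Dm A) p * \1_(~` near r) p)%R < +oo.
Proof.
move=> mA Aoo r0; have [C C0 HC] := pint_far_fst (n := n) s0 s1 r0.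
have mf := measurable_far r.
pose g (p : V * V) : R := (\1_A p.1 * \1_(~` near r) p)%R.
have mg : measurable_fun setT g.
  by apply: measurable_funM; [exact: measurable_ind_fst|exact: measurable_ind].
have g0 p : (0 <= g p)%R by rewrite mulr_ge0.
apply: (@le_lt_trans _ _ (pint s (fun p => g p + g (p.2, p.1))%R)).
  apply: pint_le.
  - by apply: measurable_funM; apply: measurable_ind => //; exact: measurable_Dm.
  - by apply: measurable_funD => //; exact: (measurableT_comp mg measurable_pswap).
  - by move=> p; rewrite mulr_ge0.
  - move=> p; rewrite /g/= (_ : \1_(~` near r) (p.2, p.1) = \1_(~` near r) p); last first.
      by rewrite !indicE; congr (_%:R); congr nat_of_bool; apply/idP/idP => /set_mem/= H;
        apply/mem_set => /=; rewrite distrC.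
    by rewrite -mulrDl ler_wpM2r// indDm_le.
rewrite pint_sym2// lte_mul_pinfty ?lee_fin//.
by rewrite (le_lt_trans (HC _ mA))// lte_mul_pinfty// ?ltry// ge0_fin_numE.
Qed.

(** If [mu A] is finite, the far pairs touching [A] have a finite integral, so those with first
    point outside a large ball are negligible and local continuity of translations serves in the
    ball. If [mu E] is finite, [shiftD E z] is small as a whole. *)
Lemma far_small A E (r e : R) : measurable A -> measurable E ->
  mu A < +oo \/ mu E < +oo -> (0 < r)%R -> (0 < e)%R ->
  exists2 q : R, (0 < q)%R & forall z, (`|z| < q)%R ->
    pint s (fun p => \1_(Dm A) p * \1_(~` near r) p * \1_(shiftD E z) p.1)%R < e%:E.
Proof.
move=> mA mE AE r0 e0; have [C C0 HC] := pint_far_fst (n := n) s0 s1 r0.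
have mf := measurable_far r; have mD := measurable_Dm mA.
have mg z : measurable_fun setT (fun p : V * V =>
    \1_(Dm A) p * \1_(~` near r) p * \1_(shiftD E z) p.1 : R)%R.
  apply: measurable_funM; last by apply: measurable_ind_fst; exact: measurable_shiftD.
  by apply: measurable_funM; exact: measurable_ind.
(* A set of measure below [e'] costs at most [e / 2] against the far kernel constant [C]. *)
pose e' := (e / 2 / (C + 1))%R.
have C1 : (0 < C + 1)%R by rewrite ltr_wpDl.
have e'0 : (0 < e')%R by rewrite !divr_gt0.
have Ce (S : set V) : measurable S -> mu S < e'%:E ->
    pint s (fun p => \1_S p.1 * \1_(~` near r) p)%R <= (e / 2)%:E.
  move=> mS Se; rewrite (le_trans (HC _ mS))//.
  rewrite (@le_trans _ _ (e'%:E * (C + 1)%:E))//; last by rewrite -EFinM divfK ?gt_eqF.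
  by apply: lee_pmul => //; rewrite ?lee_fin ?lerDl//; exact: ltW.
have e2 : (e / 2)%:E < e%:E by rewrite lte_fin; lra.
case: AE => [Aoo|Eoo].
  have goo := pint_far_lty mA Aoo r0.
  have mgA : measurable_fun setT (fun p : V * V => \1_(Dm A) p * \1_(~` near r) p : R)%R.
    by apply: measurable_funM; exact: measurable_ind.
  have gA0 (p : V * V) : (0 <= \1_(Dm A) p * \1_(~` near r) p :> R)%R by rewrite mulr_ge0.
  have mS (k : nat) : measurable (fst @^-1` (~` ball (0%R : V) k.+1%:R) : set (V * V)).
    by apply: (@measurable_fst_pre R n (~` _)); apply: measurableC; exact: measurable_rV_ball.
  have e20 : 0 < (e / 2)%:E by rewrite lte_fin divr_gt0.
  have [|k Hk] := pint_cvg0 mgA gA0 goo mS _ e20.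
    move=> [x y] _; exists (Num.truncn `|x|%R) => k Nk; apply.
    by rewrite rV_ballE/= sub0r normrN (lt_le_trans (truncnS_gt _))// ler_nat ltnS; exact: Nk.
  have [q q0 Hq] := @shift_continuous R n E k.+1%:R _ mE (ltr0Sn _ _) e'0.
  exists q => // z zq.
  have mB : measurable (shiftD E z `&` ball (0%R : V) k.+1%:R).
    by apply: measurableI; [exact: measurable_shiftD|exact: measurable_rV_ball].
  have m1 : measurable_fun setT (fun p : V * V => \1_(shiftD E z `&` ball (0%R : V) k.+1%:R) p.1 * \1_(~` near r) p : R)%R.
    by apply: measurable_funM; [exact: measurable_ind_fst|exact: measurable_ind].
  have m2 : measurable_fun setT (fun p : V * V => \1_(fst @^-1` (~` ball (0%R : V) k.+1%:R)) p * (\1_(Dm A) p * \1_(~` near r) p) : R)%R.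
    by apply: measurable_funM => //; exact: measurable_ind.
  apply: (@le_lt_trans _ _ (pint s (fun p => \1_(shiftD E z `&` ball (0%R : V) k.+1%:R) p.1 * \1_(~` near r) p
     + \1_(fst @^-1` (~` ball (0%R : V) k.+1%:R)) p * (\1_(Dm A) p * \1_(~` near r) p))%R)).
    apply: pint_le => //.
    - exact: measurable_funD.
    - move=> p; have [pB|pB] := pselect (ball (0%R : V) k.+1%:R p.1).
        rewrite (@le_trans _ _ (\1_(shiftD E z `&` ball (0%R : V) k.+1%:R) p.1 * \1_(~` near r) p)%R)//.
          rewrite -mulrA [X in (_ * X)%R]mulrC.
          apply: (@le_trans _ _ (\1_(shiftD E z) p.1 * \1_(~` near r) p)%R).
            by rewrite ler_piMl ?mulr_ge0// indicE; case: (_ \in _).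
          by rewrite ler_wpM2r//; exact: ind_le.
        by rewrite lerDl !mulr_ge0.
      rewrite (@le_trans _ _ (\1_(fst @^-1` (~` ball (0%R : V) k.+1%:R)) p * (\1_(Dm A) p * \1_(~` near r) p))%R)//.
        by rewrite [X in (_ <= X * _)%R]indicE mem_set// mul1r ler_piMr ?mulr_ge0.
      by rewrite lerDr !mulr_ge0.
  rewrite pintD//; [|by move=> p; rewrite !mulr_ge0..].
  rewrite (_ : e%:E = (e / 2)%:E + (e / 2)%:E); last by rewrite -EFinD -splitr.
  by rewrite (le_lt_trans (leeD2r _ (Ce _ mB (Hq z zq))))// lteD2lE.
have [q q0 Hq] := shiftD_small mE Eoo e'0.
exists q => // z zq; have mz := measurable_shiftD z mE.
apply: le_lt_trans e2; apply: le_trans (Ce _ mz (Hq z zq)).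
apply: pint_le => //.
- by apply: measurable_funM; [exact: measurable_ind_fst|exact: measurable_ind].
- by move=> p; rewrite mulrC ler_wpM2l// ler_piMl.
Qed.

Lemma ind_shiftD_le E z (x : V) : (`|\1_E (x + z) - \1_E x| <= \1_(shiftD E z) x :> R)%R.
Proof.
rewrite !indicE; have [xz|xz] := boolP ((x + z)%R \in E); have [xE|xE] := boolP (x \in E).
- by rewrite subrr normr0.
- rewrite subr0 normr1 mem_set//; left; split; first exact: set_mem.
  by move=> /mem_set xE'; rewrite xE' in xE.
- rewrite sub0r normrN normr1 mem_set//; right; split; first exact: set_mem.
  by move=> /= /mem_set xE'; rewrite xE' in xz.
- by rewrite subrr normr0.
Qed.

(** The increment between [p.1] and [p.2] of the change of the indicator under the shift by [z];
    against the kernel it gives the seminorm of that change. *)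
Definition incrE E z (p : V * V) : R :=
  `|(\1_E (p.1 + z) - \1_E p.1) - (\1_E (p.2 + z) - \1_E p.2)|%R.

Definition oscE E (p : V * V) : R := `|\1_E p.1 - \1_E p.2|%R.

Lemma measurable_oscE E : measurable E -> measurable_fun setT (oscE E).
Proof.
move=> mE; apply: measurableT_comp => //.
by apply: measurable_funB; [exact: measurable_ind_fst|exact: measurable_ind_snd].
Qed.

Lemma measurable_incrE E z : measurable E -> measurable_fun setT (incrE E z).
Proof.
move=> mE; have mz := measurable_shift z mE.
have := measurable_ind_fst mz; have := measurable_ind_snd mz => m2 m1.
apply: measurableT_comp => //; apply: measurable_funB; apply: measurable_funB => //.
- exact: measurable_ind_fst.
- exact: measurable_ind_snd.
Qed.

(** For close pairs the double increment is at most the oscillation of the indicator at the pair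
    plus that at the shifted pair, both of which touch [W], and shifting a pair leaves the kernel
    unchanged. For far pairs it is at most the sum of the changes at the two points. *)
Lemma translate_small A W E (rho e : R) : measurable A -> measurable W -> measurable E ->
  (0 < rho)%R -> (forall x z, A x -> (`|z| < rho)%R -> W (x + z)%R) ->
  pint s (fun p => \1_(Dm W) p * oscE E p)%R < +oo ->
  mu A < +oo \/ mu E < +oo -> (0 < e)%R ->
  exists2 q : R, (0 < q)%R & forall z, (`|z| < q)%R ->
    pint s (fun p => \1_(Dm A) p * incrE E z p)%R <= e%:E.
Proof.
move=> mA mW mE rho0 AW Woo AE e0.
have e40 : (0 < e / 4)%R by rewrite divr_gt0.
pose g (p : V * V) : R := (\1_(Dm W) p * oscE E p)%R.
have mg : measurable_fun setT g.
  by apply: measurable_funM; [apply: measurable_ind; exact: measurable_Dm|exact: measurable_oscE].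
have g0 p : (0 <= g p)%R by rewrite mulr_ge0// /oscE.
have [|r r0 Hr] := pint_near_small mg g0 Woo _ e40.
  by move=> x; rewrite /g /oscE subrr normr0 mulr0.
have [q q0 Hq] := far_small mA mE AE r0 e40.
exists (Num.min q rho); first by rewrite lt_min q0.
move=> z; rewrite lt_min => /andP[/Hq{}Hq zrho].
pose N (p : V * V) : R := (\1_(near r) p * g p)%R.
have mN : measurable_fun setT N.
  by apply: measurable_funM => //; apply: measurable_ind; exact: measurable_pnear.
have N0 p : (0 <= N p)%R by rewrite mulr_ge0.
pose Fa (p : V * V) : R := (\1_(Dm A) p * \1_(~` near r) p * \1_(shiftD E z) p.1)%R.
have mFa : measurable_fun setT Fa.
  apply: measurable_funM; last by apply: measurable_ind_fst; exact: measurable_shiftD.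
  apply: measurable_funM; apply: measurable_ind; [exact: measurable_Dm|exact: measurable_far].
have Fa0 p : (0 <= Fa p)%R by rewrite !mulr_ge0.
have mFs : measurable_fun setT (fun p : V * V => Fa (p.2, p.1)).
  exact: (measurableT_comp mFa measurable_pswap).
pose Nz (p : V * V) := N (p.1 + z, p.2 + z)%R.
have mNz : measurable_fun setT Nz.
  apply: (measurableT_comp mN); apply: measurable_fun_pair.
    by apply: (measurableT_comp (measurable_rVD z)); exact: measurable_fst.
  by apply: (measurableT_comp (measurable_rVD z)); exact: measurable_snd.
(* Four terms of size [e / 4]: the near part and its translate, the far part and its mirror
   image. *)
apply: (@le_trans _ _ (pint s (fun p => (Nz p + N p) + (Fa p + Fa (p.2, p.1)))%R)); last first.
  have NN0 p : (0 <= Nz p + N p)%R by rewrite addr_ge0// N0.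
  have FF0 p : (0 <= Fa p + Fa (p.2, p.1))%R by rewrite addr_ge0// Fa0.
  rewrite (pintD s (measurable_funD mNz mN) (measurable_funD mFa mFs) NN0 FF0).
  rewrite pint_sym2// pintD//; last by move=> p; exact: N0.
  rewrite pint_shift// (_ : e%:E = ((e / 4)%:E + (e / 4)%:E) + 2%:E * (e / 4)%:E); last first.
    by rewrite -EFinM -!EFinD; congr EFin; lra.
  by apply: leeD; [apply: leeD; exact: ltW|apply: lee_pmul => //; [exact: pint_ge0|exact: ltW]].
apply: pint_le.
- by apply: measurable_funM; [apply: measurable_ind; exact: measurable_Dm|exact: measurable_incrE].
- by apply: measurable_funD; exact: measurable_funD.
- by move=> p; rewrite mulr_ge0// /incrE.
move=> p; have [pA|pA] := boolP (p \in Dm A); last first.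
  by rewrite indicE (negbTE pA) mul0r !addr_ge0// N0.
have {}pA := set_mem pA.
rewrite indicE mem_set// mul1r.
have z00 : (`|0 : V| < rho)%R by rewrite normr0.
have W1 : \1_(Dm W) p = 1%R :> R.
  rewrite indicE mem_set//; case: pA => /AW/(_ z00); rewrite addr0; [by left|by right].
have W2 : \1_(Dm W) (p.1 + z, p.2 + z)%R = 1%R :> R.
  by rewrite indicE mem_set//; case: pA => /AW/(_ zrho); [left|right].
have [pr|pr] := ltP `|p.1 - p.2|%R r.
  rewrite (@le_trans _ _ (Nz p + N p)%R)//; last by rewrite lerDl addr_ge0.
  rewrite /Nz /N /g W1 W2 !mul1r !indicE !mem_set//=; last by rewrite opprD addrACA subrr addr0.
  rewrite !mul1r /oscE /incrE/=.
  rewrite (le_trans _ (ler_normB _ _))// le_eqVlt; apply/orP; left; apply/eqP.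
  by congr (`|_|)%R; ring.
rewrite (@le_trans _ _ (Fa p + Fa (p.2, p.1))%R)//; last by rewrite lerDr addr_ge0// N0.
have f1 : \1_(~` near r) p = 1%R :> R.
  by rewrite indicE mem_set//=; apply/negP; rewrite -leNgt.
have f2 : \1_(~` near r) (p.2, p.1) = 1%R :> R.
  by rewrite indicE mem_set//=; apply/negP; rewrite -leNgt distrC.
have pA' : Dm A (p.2, p.1) by case: pA; [right|left].
rewrite /Fa f1 f2 !indicE !(mem_set pA) !(mem_set pA') !mul1r/=.
by rewrite (le_trans (ler_normB _ _))// lerD// ind_shiftD_le.
Qed.

End translation.

(** * Averaging over levels *)

Section level_sets.
Context {R : realType}.
Notation lam := (@lebesgue_measure R).
Local Open Scope ereal_scope.

Lemma lebesgue_measure_cc (a b : R) : lam `[a, b]%classic = (Num.max 0 (b - a))%:E.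
Proof.
rewrite lebesgue_measure_itv/= lte_fin.
have [ab|ab] := ltP a b; first by rewrite -EFinB max_r// subr_ge0 ltW.
by rewrite max_l// subr_le0.
Qed.

Definition window : set R := `[4^-1%R, (3 / 4)%R]%classic.

Lemma lam_window : lam window = (2^-1)%:E.
Proof. by rewrite lebesgue_measure_cc max_r; [congr EFin|]; lra. Qed.

(** The levels that disagree with [e] lie in [[w, 3/4]] when [e] is true and in [[1/4, w]] when it
    is false. *)
Lemma level_measure_le (T : set R) (w : R) (e : bool) :
  measurable T -> (forall t, T t -> window t /\ (t < w)%R != e) ->
  lam T <= `|w - e%:R|%:E.
Proof.
move=> mT HT; case: e HT => HT.
  rewrite (@le_trans _ _ (lam `[w, (3 / 4)%R]%classic))//.
    apply: le_measure; rewrite ?inE// => t /HT[]; rewrite /window/= !in_itv/=.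
    by move=> /andP[_ ->]; rewrite leNgt; case: (_ < _)%R.
  rewrite lebesgue_measure_cc lee_fin ge_max normr_ge0/=.
  by rewrite distrC (le_trans _ (ler_norm _))//; lra.
rewrite (@le_trans _ _ (lam `[4^-1%R, w]%classic))//.
  apply: le_measure; rewrite ?inE// => t /HT[]; rewrite /window/= !in_itv/=.
  by move=> /andP[-> _]; case: ltP => // /ltW ->.
rewrite lebesgue_measure_cc lee_fin ge_max normr_ge0/= subr0.
by rewrite (le_trans _ (ler_norm _))//; lra.
Qed.

(* Restricting to levels in [1/4, 3/4] leaves room for [w] to exceed [0, 1] by 1/4. *)
Lemma level_jump_measure_le (T : set R) (w1 w2 : R) (e1 e2 : bool) :
  measurable T -> (- 4^-1 <= w1 <= 5 / 4)%R -> (- 4^-1 <= w2 <= 5 / 4)%R ->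
  (forall t, T t -> window t /\ ((t < w1)%R && (w2 <= t)%R) != (e1 && ~~ e2)) ->
  lam T <= `|(w1 - e1%:R) - (w2 - e2%:R)|%:E.
Proof.
move=> mT /andP[w1l w1u] /andP[w2l w2u] HT.
have [e12|e12] := boolP (e1 && ~~ e2).
  have /andP[-> /negbTE ->] := e12; rewrite e12 in HT.
  apply: (@le_trans _ _ (lam (`[w1, (3 / 4)%R] `|` `[4^-1%R, w2])%classic)).
    apply: le_measure; rewrite ?inE//; first exact: measurableU.
    move=> t /HT[]; rewrite /window/= !in_itv/= => /andP[-> ->].
    by rewrite andbT; case: ltP => [_|]; [|by left]; case: leP => // /ltW; right.
  apply: (le_trans (measureU2 _ _ _)) => //.
  have := lebesgue_measure_cc w1 (3 / 4)%R; have := lebesgue_measure_cc 4^-1%R w2.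
  rewrite /= => -> ->; rewrite lee_fin subr0.
  rewrite -normrN.
  have := ler_norm (- (w1 - 1 - w2))%R.
  have := normr_ge0 (- (w1 - 1 - w2))%R.
  by case: (leP 0%R (3 / 4 - w1)%R); case: (leP 0%R (w2 - 4^-1)%R) => /= ? ? ? ?; lra.
rewrite (negbTE e12) in HT.
apply: (@le_trans _ _ (lam `[w2, w1]%classic)).
  apply: le_measure; rewrite ?inE// => t /HT[_]; rewrite /= !in_itv/=.
  by case: ltP => //= /ltW -> /eqP; case: (_ <= _)%R.
rewrite lebesgue_measure_cc lee_fin ge_max normr_ge0/=.
rewrite (le_trans _ (ler_norm _))//.
by move: e12; case: e1 {HT}; case: e2 => //= _; lra.
Qed.

(** Markov's inequality: the window has length 1/2, so if [h >= e] held at almost all of its levels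
    the integral would reach [e / 2]. *)
Lemma exists_good_level (P : R -> Prop) (h : R -> \bar R) (e : R) :
  {ae lam, forall t, P t} -> measurable_fun setT h -> (forall t, 0 <= h t) ->
  \int[lam]_t h t < (e / 2)%:E -> (0 < e)%R ->
  exists t, [/\ window t, P t & h t < e%:E].
Proof.
move=> [N [mN N0 PN]] mh h0 he e0; apply: contrapT => Hno.
have : (e / 2)%:E <= \int[lam]_t h t; last by rewrite leNgt he.
have mW : measurable (window : set (measurableTypeR R)) by exact: measurable_itv.
have mI : measurable (window `\` N) by exact: measurableD.
rewrite (_ : (e / 2)%:E = \int[lam]_t (e%:E * (\1_(window `\` N) t)%:E)); last first.
  rewrite ge0_integralZl_EFin//; [|by apply/measurable_EFinP; exact: measurable_indic|exact: ltW].
  rewrite integral_indic// setIT.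
  rewrite (_ : _ (window `\` N) = lam window); last first.
    rewrite measureD//; last by rewrite -[X in X < _]/(lam window) lam_window ltry.
    rewrite (_ : _ (window `&` N) = 0) ?sube0//; apply: (subset_measure0 _ _ _ N0) => //.
    exact: measurableI.
  by rewrite -[X in _ * X]/(lam window) lam_window.
apply: ge0_le_integralT => //.
- by apply: measurable_funeM; apply/measurable_EFinP; exact: measurable_indic.
- by move=> t; rewrite mule_ge0// lee_fin// ltW.
move=> t _; rewrite indicE; have [/set_mem[It Nt]|_] := boolP (t \in _); last by rewrite mule0.
rewrite mule1 leNgt; apply/negP => ht; apply: Hno; exists t; split => //.
by apply: contrapT => Pt; apply: Nt; exact: PN.
Qed.

End level_sets.

Section product_sigma_finite.
Context d1 d2 (T1 : measurableType d1) (T2 : measurableType d2) (R : realType).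
Variables (m1 : {sigma_finite_measure set T1 -> \bar R})
  (m2 : {sigma_finite_measure set T2 -> \bar R}).

(* The library's sigma-finite structure on [m1 \x m2] is shadowed by the one for
   subprobabilities; this copy carries it. *)
Definition prodm : set (T1 * T2) -> \bar R := (m1 \x m2)%E.

HB.instance Definition _ := Measure.on prodm.

Let prodm_sigma_finite : sigma_finite setT prodm.
Proof.
have /sigma_finiteP[F [TF ndF Foo]] := sigma_finiteT m1.
have /sigma_finiteP[G [TG ndG Goo]] := sigma_finiteT m2.
exists (fun k => F k `*` G k) => [|k].
  apply/esym; rewrite -subTset => -[x y] _.
  have [i _ Fi] : (\bigcup_k F k) x by rewrite -TF.
  have [j _ Gj] : (\bigcup_k G k) y by rewrite -TG.
  exists (maxn i j) => //; split.
  - by move: Fi; exact/subsetPset/ndF/leq_maxl.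
  - by move: Gj; exact/subsetPset/ndG/leq_maxr.
have [mF Fk] := Foo k; have [mG Gk] := Goo k; split; first exact: measurableX.
by rewrite /prodm product_measure1E// lte_mul_pinfty// ge0_fin_numE.
Qed.

HB.instance Definition _ := Measure_isSigmaFinite.Build _ _ _ prodm prodm_sigma_finite.

End product_sigma_finite.

Section averages.
Context {R : realType} {n : nat} d (T : measurableType d).
Variable m : {sigma_finite_measure set T -> \bar R}.
Notation lam := (@lebesgue_measure R).
Notation mu := (lebesgue_rV R n).
Local Open Scope ereal_scope.

(** Tonelli: for a fixed point, integrating over the levels first leaves the measure of a section of
    [S]. *)
Lemma level_average_le (S : set (measurableTypeR R * T)) (q c : T -> R) :
  measurable S -> measurable_fun setT q -> (forall p, 0 <= q p)%R ->
  measurable_fun setT c -> (forall p, 0 <= c p)%R ->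
  (forall p, lam (ysection S p) <= (c p)%:E) ->
  measurable_fun setT (fun t : measurableTypeR R => \int[m]_p (\1_S (t, p) * q p)%:E) /\
  \int[lam]_t \int[m]_p (\1_S (t, p) * q p)%:E <= \int[m]_p (c p * q p)%:E.
Proof.
move=> mS mq q0 mc c0 Sc.
have mf : measurable_fun setT (fun tp : measurableTypeR R * T => (\1_S tp * q tp.2)%:E).
  apply/measurable_EFinP/measurable_funM; first exact: measurable_indic.
  exact: (measurableT_comp mq measurable_snd).
have f0 tp : 0 <= (\1_S tp * q tp.2)%:E by rewrite lee_fin mulr_ge0.
split; first exact: (@measurable_fun_fubini_tonelli_F _ _ (measurableTypeR R) T R m _ mf f0).
rewrite (@fubini_tonelli _ _ (measurableTypeR R) T R lam m _ mf f0).
have mg := @measurable_fun_fubini_tonelli_G _ _ (measurableTypeR R) T R lam _ mf f0.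
apply: ge0_le_integralT => //.
- by apply/measurable_EFinP/measurable_funM.
- by move=> p; apply: integral_ge0.
move=> p _ /=; under eq_integral do rewrite mulrC EFinM.
rewrite ge0_integralZl_EFin//; last first.
  apply/measurable_EFinP; apply: (measurableT_comp (measurable_indic mS)).
  exact: measurable_fun_pair.
rewrite mulrC EFinM lee_wpmul2l ?lee_fin//.
rewrite (_ : \int[lam]_x _ = lam (ysection S p))//.
rewrite -[ysection S p]setIT -integral_indic//; last exact: measurable_ysection.
apply: eq_integral => t _; rewrite !indicE; congr (_%:R%:E); congr nat_of_bool.
by apply/idP/idP => [/set_mem H|/set_mem]; [apply/mem_set; rewrite /ysection/=; apply/mem_set
  |rewrite /ysection/=].
Qed.

(** Since [b] is a probability density, the average is at most a bound valid wherever [b] does not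
    vanish. *)
Lemma kernel_average_le (b : 'rV[R]_n -> R) (F : T * 'rV[R]_n -> R) (e : \bar R) :
  measurable_fun setT b -> (forall z, 0 <= b z)%R -> \int[mu]_z (b z)%:E = 1 ->
  measurable_fun setT F -> (forall p, 0 <= F p)%R ->
  (forall z, b z != 0%R -> \int[m]_t (F (t, z))%:E <= e) -> 0 <= e ->
  \int[m]_t \int[mu]_z (b z * F (t, z))%:E <= e.
Proof.
move=> mb b0 b1 mF F0 HF e0.
have mf : measurable_fun setT (fun tz : T * 'rV[R]_n => (b tz.2 * F tz)%:E).
  apply/measurable_EFinP/measurable_funM => //.
  exact: (measurableT_comp mb measurable_snd).
have f0 tz : 0 <= (b tz.2 * F tz)%:E by rewrite lee_fin mulr_ge0.
rewrite (@fubini_tonelli _ _ T 'rV[R]_n R m mu _ mf f0).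
rewrite -[leRHS]mule1 -b1 -ge0_integralZl//; last 2 first.
- exact/measurable_EFinP.
- by move=> z _; rewrite lee_fin.
have mg := @measurable_fun_fubini_tonelli_G _ _ T 'rV[R]_n R m _ mf f0.
apply: ge0_le_integralT => //.
- by apply: measurable_funeM; exact/measurable_EFinP.
- by move=> z; apply: integral_ge0 => t _; exact: (f0 (t, z)).
move=> z _ /=; under eq_integral do rewrite EFinM.
rewrite ge0_integralZl_EFin//; last 2 first.
- by move=> t _; rewrite lee_fin.
- apply/measurable_EFinP; apply: (measurableT_comp mF); exact: measurable_fun_pair.
have [->|bz] := eqVneq (b z) 0%R; first by rewrite mul0e mule0.
by rewrite muleC lee_wpmul2r ?lee_fin//; exact: HF.
Qed.

End averages.

(** * The mollified indicator *)

Section mollified_indicator.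
Context {R : realType} {n : nat}.
Notation mu := (lebesgue_rV R n).
Notation V := 'rV[R]_n.
Variables (r : R) (E : set V).
Hypothesis r_gt0 : 0 < r.
Hypothesis mE : measurable E.
Implicit Types (x y z : V) (phi : V -> R).

Let k0 : 'I_n -> nat := fun=> 0%N.
Let kb := kbump r k0.

Let kb_ge0 z : 0 <= kb z.
Proof. by apply: prodr_ge0 => i _; exact: bump_ge0. Qed.

Let kb_gt0 z : `|z| < r -> 0 < kb z.
Proof.
move=> zr; apply: prodr_gt0 => i _; rewrite /= bump_gt0.
exact: le_lt_trans (coord_le_norm _ _) zr.
Qed.

Let mkb : measurable_fun setT kb.
Proof. exact: continuous_measurable_rV (kbump_continuous (r:=r) (k:=k0)). Qed.

Let kb_bound : exists2 C : R, 0 < C & forall z, kb z <= C * \1_(ball (0 : V) (r *+ 2)) z.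
Proof.
have [K KB] : exists K, forall z, `|kb z| <= K by eexists => z; exact: kbump_bounded.
exists (Num.max 1 K).
  by rewrite lt_max ltr01.
move=> z; have [zr|zr] := leP `|z| r; last first.
  by rewrite /kb kbump_out// mulr_ge0// le_max ler01.
rewrite indicE mem_set ?mulr1; last first.
  by rewrite rV_ballE/= sub0r normrN (le_lt_trans zr)// mulr2n ltrDl.
by rewrite (le_trans (ler_norm _))// (le_trans (KB z))// le_max lexx orbT.
Qed.

Let r2 : 0 < r *+ 2. Proof. by rewrite mulrn_wgt0. Qed.

Let kb_phi_int phi (M : R) : measurable_fun setT phi -> (forall z, `|phi z| <= M) ->
  mu.-integrable setT (EFin \o (fun z => kb z * phi z)).
Proof.
move=> mphi phiM; have [C C0 HC] := kb_bound.
apply: (@integrable_bounded_support _ _ _ (0 : V) (C * M) _ r2).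
  exact: measurable_funM.
move=> z; rewrite normrM mulrAC ler_pM//.
by rewrite ger0_norm.
Qed.

Let kb_int : mu.-integrable setT (EFin \o kb).
Proof.
rewrite (_ : kb = fun z => kb z * 1); last by apply/funext => z; rewrite mulr1.
by apply: (@kb_phi_int (fun=> 1) 1) => // z; rewrite normr1.
Qed.

Definition bmass : R := \int[mu]_z kb z.

(** Otherwise the kernel would vanish almost everywhere, although it is positive on a ball. *)
Lemma bmass_gt0 : 0 < bmass.
Proof.
rewrite lt_neqAle eq_sym; apply/andP; split; last by apply: Rintegral_ge0 => z _.
apply/eqP => c0.
have I0 : (\int[mu]_z `|(kb z)%:E| = 0)%E.
  transitivity (\int[mu]_z (kb z)%:E)%E.
    by apply: eq_integral => z _; rewrite gee0_abs// lee_fin.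
  rewrite -[LHS]fineK; last exact: integrable_fin_num kb_int.
  by rewrite -[fine _]/bmass c0.
have mkb' : measurable_fun setT (EFin \o kb) by exact/measurable_EFinP.
have /(ae_eq_integral_abs mu measurableT mkb')[N [mN N0 HN]] := I0.
have : (mu (ball (0%R : V) r) <= mu N)%E.
  apply: le_measure; rewrite ?inE//; first exact: measurable_rV_ball.
  move=> z; rewrite rV_ballE/= sub0r normrN => /kb_gt0 zr; apply: HN => /(_ I)[].
  by move=> kz; rewrite kz ltxx in zr.
rewrite [X in (_ <= X)%E](_ : _ = 0%E)// lebesgue_rV_ball// lee_fin leNgt.
by rewrite exprn_gt0.
Qed.

Let c0 := bmass_gt0.

Definition bker z : R := kb z / bmass.

Lemma bker_ge0 z : 0 <= bker z.
Proof. by rewrite divr_ge0// ltW. Qed.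

Lemma bker_out z : r < `|z| -> bker z = 0.
Proof. by move=> rz; rewrite /bker /kb kbump_out// mul0r. Qed.

Lemma measurable_bker : measurable_fun setT bker.
Proof. by rewrite /bker; apply: measurable_funM. Qed.

Let bker_phi_int phi (M : R) : measurable_fun setT phi -> (forall z, `|phi z| <= M) ->
  mu.-integrable setT (EFin \o (fun z => bker z * phi z)).
Proof.
move=> mphi phiM; rewrite (_ : _ \o _ = (fun z => (bmass^-1)%:E * (kb z * phi z)%:E)%E).
  by apply: integrableZl => //; exact: kb_phi_int mphi phiM.
by apply/funext => z; rewrite /bker/= -EFinM; congr EFin; rewrite mulrAC mulrC.
Qed.

Lemma bker_integral : (\int[mu]_z (bker z)%:E = 1)%E.
Proof.
rewrite /bker; under eq_integral do rewrite mulrC EFinM.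
rewrite ge0_integralZl_EFin//; last 3 first.
- by move=> z _; rewrite lee_fin.
- exact/measurable_EFinP.
- by rewrite invr_ge0 ltW.
rewrite -[X in (_ * X)%E]fineK; last exact: integrable_fin_num kb_int.
by rewrite -[fine _]/bmass -EFinM mulVf// gt_eqF.
Qed.

Definition umoll x : R := moll r E k0 x / bmass.

Let mshift x : measurable_fun setT (fun z => \1_E (x + z) : R).
Proof.
apply: (measurableT_comp (measurable_ind mE)).
rewrite (_ : +%R x = fun z => z + x); last by apply/funext => z; rewrite addrC.
exact: measurable_rVD.
Qed.

Let ind_le1 (A : set V) y : `|\1_A y : R| <= 1.
Proof. by rewrite indicE; case: (_ \in _); rewrite ?normr1 ?normr0. Qed.

Lemma umollE x : umoll x = \int[mu]_z (bker z * \1_E (x + z)).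
Proof.
rewrite /umoll; have -> : moll r E k0 x = \int[mu]_z (kb z * \1_E (x + z)).
  congr fine; pose f y : \bar R := (\1_E y * kb (y - x))%:E.
  have mf : measurable_fun setT f.
    apply/measurable_EFinP/measurable_funM; first exact: measurable_ind.
    by apply: (measurableT_comp mkb); exact: measurable_rVD.
  have f0 y : (0 <= f y)%E by rewrite lee_fin mulr_ge0.
  rewrite -[LHS](ge0_integral_shift x mf f0); apply: eq_integral => z _.
  by rewrite /f addrK mulrC [(x + z)%R]addrC.
rewrite mulrC -RintegralZl//; last exact: kb_phi_int (mshift x) _.
by apply: eq_Rintegral => z _; rewrite /bker mulrA [bmass^-1 * _]mulrC.
Qed.

Let fineI phi (M : R) : measurable_fun setT phi -> (forall z, `|phi z| <= M) ->
  (`|\int[mu]_z (bker z * phi z)|%:E <= \int[mu]_z (bker z * `|phi z|)%:E)%E.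
Proof.
move=> mphi phiM; have I := bker_phi_int mphi phiM.
rewrite (le_trans (_ : _ <= (\int[mu]_z `|bker z * phi z|)%:E)%E)//.
  by rewrite lee_fin; exact: le_normr_Rintegral.
rewrite /Rintegral fineK; last exact: integrable_fin_num (integrable_norm I).
by apply: ge0_le_integralT => //=; [apply/measurable_EFinP/measurableT_comp => //;
  apply: measurable_funM => //; exact: measurable_bker | apply/measurable_EFinP/measurable_funM;
  [exact: measurable_bker|exact: measurableT_comp] | move=> z _; rewrite normrM [`|bker z|]ger0_norm// bker_ge0].
Qed.

Let bkerB phi (psi : V -> R) (M N : R) : measurable_fun setT phi -> measurable_fun setT psi ->
  (forall z, `|phi z| <= M) -> (forall z, `|psi z| <= N) ->
  \int[mu]_z (bker z * phi z) - \int[mu]_z (bker z * psi z)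
  = \int[mu]_z (bker z * (phi z - psi z)).
Proof.
move=> mphi mpsi phiM psiN.
rewrite -(RintegralB measurableT (bker_phi_int mphi phiM) (bker_phi_int mpsi psiN)).
by apply: eq_Rintegral => z _; rewrite mulrBr.
Qed.

(** Writes a constant as an average, so that [umoll x - \1_E x] becomes the average of a
    difference. *)
Let bker_cst (a : R) : a = \int[mu]_z (bker z * a).
Proof.
have I := @bker_phi_int (fun=> a) `|a| (measurable_cst _) (fun=> lexx _).
rewrite /Rintegral (_ : (fun z => _) = (fun z => (bker z)%:E * a%:E)%E); last first.
  by apply/funext => z; rewrite EFinM.
have I1 : mu.-integrable setT (EFin \o bker).
  rewrite (_ : bker = fun z => bker z * 1); last by apply/funext => z; rewrite mulr1.
  by apply: (@bker_phi_int (fun=> 1) 1) => // z; rewrite normr1.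
by rewrite integralZr// bker_integral mul1e.
Qed.

Lemma umoll_ge0 x : 0 <= umoll x.
Proof. by rewrite umollE; apply: Rintegral_ge0 => z _; rewrite mulr_ge0// bker_ge0. Qed.

Lemma umoll_le1 x : umoll x <= 1.
Proof.
rewrite umollE [leRHS]bker_cst; apply: le_Rintegral => //.
- exact: bker_phi_int (mshift x) _.
- by apply: (@bker_phi_int _ 1) => // z; rewrite normr1.
- move=> z _; rewrite ler_wpM2l ?bker_ge0// indicE; by case: (_ \in _).
Qed.

Let umollB x : umoll x - \1_E x = \int[mu]_z (bker z * (\1_E (x + z) - \1_E x)).
Proof.
rewrite umollE [X in _ - X](bker_cst (\1_E x)).
exact: (bkerB (mshift x) (measurable_cst _) (fun z => ind_le1 E (x + z)) (fun=> ind_le1 E x)).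
Qed.

Let bound2 x z : `|\1_E (x + z) - \1_E x : R| <= 2.
Proof. by rewrite (le_trans (ler_normB _ _))// (_ : 2 = 1 + 1)// lerD. Qed.

Let mshiftB x : measurable_fun setT (fun z => \1_E (x + z) - \1_E x : R).
Proof. exact: measurable_funB. Qed.

Lemma umoll_diff_le x : (`|umoll x - \1_E x|%:E <=
  \int[mu]_z (bker z * `|\1_E (x + z) - \1_E x|)%:E)%E.
Proof. by rewrite umollB; exact: fineI (mshiftB x) (bound2 x). Qed.

Lemma umoll_incr_le x y : (`|(umoll x - \1_E x) - (umoll y - \1_E y)|%:E <=
  \int[mu]_z (bker z * incrE E z (x, y))%:E)%E.
Proof.
have -> : (umoll x - \1_E x) - (umoll y - \1_E y) =
    \int[mu]_z (bker z * ((\1_E (x + z) - \1_E x) - (\1_E (y + z) - \1_E y))).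
  rewrite [X in X - _]umollB [X in _ - X]umollB.
  exact: (@bkerB (fun z => \1_E (x + z) - \1_E x) (fun z => \1_E (y + z) - \1_E y) 2 2 (mshiftB x) (mshiftB y) (bound2 x) (bound2 y)).
apply: (@fineI (fun z => (\1_E (x + z) - \1_E x) - (\1_E (y + z) - \1_E y)) 4).
  exact: measurable_funB.
by move=> z; rewrite (le_trans (ler_normB _ _))// (_ : 4 = 2 + 2) ?lerD//; ring.
Qed.

Lemma umoll_lipschitz : exists2 L : R, 0 <= L & forall x y, `|umoll x - umoll y| <= L * `|x - y|.
Proof.
have [L L0 HL] := moll_lipschitz r_gt0 mE k0; exists (L / bmass); first by rewrite divr_ge0// ltW.
move=> x y; rewrite /umoll -mulrBl normrM [X in _ * X]ger0_norm ?invr_ge0 ?(ltW c0)//.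
by rewrite mulrAC ler_wpM2r// invr_ge0 ltW.
Qed.

Lemma smooth_umoll : smooth_fun umoll.
Proof.
rewrite (_ : umoll = fun x => bmass^-1 * moll r E k0 x); last first.
  by apply/funext => x; rewrite mulrC.
apply: smoothZ; exact: smooth_moll.
Qed.

Lemma measurable_umoll : measurable_fun setT umoll.
Proof.
by apply: continuous_measurable_rV; apply: smooth_fun_continuous; exact: smooth_umoll.
Qed.

Lemma umoll_derive_lipschitz (i : 'I_n) : exists2 L : R, 0 <= L &
  forall x y, `|'D_(basis_vec i) umoll x - 'D_(basis_vec i) umoll y| <= L * `|x - y|.
Proof.
have [L L0 HL] := moll_lipschitz r_gt0 mE (incr k0 i).
exists (L / bmass); first by rewrite divr_ge0// ltW.
have D x : 'D_(basis_vec i) umoll x = - moll r E (incr k0 i) x / bmass.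
  have D := moll_is_derive r_gt0 mE k0 i x.
  rewrite (_ : umoll = bmass^-1 *: moll r E k0); last first.
    by apply/funext => z; rewrite /umoll mulrC.
  have := is_deriveZ (bmass^-1) D => /@derive_val ->.
  by rewrite /GRing.scale/= mulrC.
move=> x y; rewrite !D -mulrBl normrM [X in _ * X]ger0_norm ?invr_ge0 ?(ltW c0)//.
by rewrite mulrAC ler_wpM2r ?invr_ge0 ?(ltW c0)// -opprD normrN.
Qed.

(** The average sees only points within [r < q] of [x]. Used by contraposition: a value strictly
    between 0 and 1 forces mass of both [E] and its complement near [x]. *)
Let umoll_const (a : R) (S : set V) x (q : R) : measurable S -> r < q ->
  (forall y, ~ S y -> \1_E y = a) -> mu (S `&` ball x q) = 0%E -> umoll x = a.
Proof.
move=> mS rq Sa m0.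
have mB : measurable (S `&` ball x q) by apply: measurableI => //; exact: measurable_rV_ball.
have mBx := measurable_shift x mB.
rewrite umollE [RHS]bker_cst; congr fine; apply: ae_eq_integral => //.
- by apply/measurable_EFinP/measurable_funM => //; exact: measurable_bker.
- by apply/measurable_EFinP/measurable_funM => //; exact: measurable_bker.
exists ((fun z => z + x) @^-1` (S `&` ball x q)); split => //.
  by rewrite -m0; exact: lebesgue_rV_shift.
move=> z /= Hz; have [zq|zq] := ltP `|z| q.
  split; last by rewrite rV_ballE/= opprD addrCA subrr addr0 normrN.
  by apply: contrapT => Sz; apply: Hz => _; rewrite addrC Sa.
by exfalso; apply: Hz => _; rewrite bker_out ?mul0r// (lt_le_trans rq).
Qed.

Lemma umoll_gt0_mass x (q : R) : r < q -> 0 < umoll x -> (0 < mu (E `&` ball x q))%E.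
Proof.
move=> rq ux; rewrite lt_neqAle measure_ge0 andbT; apply/eqP => m0.
have := umoll_const mE rq _ (esym m0); move=> /(_ 0) => H.
by move: ux; rewrite H ?ltxx// => y Ey; rewrite indicE memNset.
Qed.

Lemma umoll_lt1_mass x (q : R) : r < q -> umoll x < 1 -> (0 < mu (~` E `&` ball x q))%E.
Proof.
move=> rq ux; rewrite lt_neqAle measure_ge0 andbT; apply/eqP => m0.
have := umoll_const (measurableC mE) rq _ (esym m0); move=> /(_ 1) => H.
by move: ux; rewrite H ?ltxx// => y /contrapT Ey; rewrite indicE mem_set.
Qed.

(** Far from the origin the average at [x] sees only the part of [E] outside a large ball, whose
    measure is as small as desired. *)
Lemma umoll_bounded_level (e : R) : 0 < e -> (mu E < +oo)%E -> bounded_set [set x | e < umoll x].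
Proof.
move=> e0 Eoo; have [C C0 HC] := kb_bound.
(* The density is at most [C / bmass], so a tail of measure [e'] contributes at most [e]. *)
pose e' := e * bmass / C; have e'0 : 0 < e' by rewrite divr_gt0// mulr_gt0.
have [k Hk] := tail_small mE Eoo e'0.
exists (k.+1%:R + r *+ 2); split; first exact: num_real.
move=> M HM x /= ux; rewrite leNgt; apply/negP => xM.
move: ux; apply/negP; rewrite -leNgt umollE -lee_fin.
pose T := E `\` ball (0 : V) k.+1%:R.
have mT : measurable T by apply: measurableD => //; exact: measurable_rV_ball.
have mTx := measurable_shift x mT.
rewrite /Rintegral fineK; last exact: integrable_fin_num (bker_phi_int (mshift x) _).
apply: (@le_trans _ _ (\int[mu]_z ((C / bmass)%:E * (\1_((fun z => (z + x)%R) @^-1` T) z)%:E))%E).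
  apply: ge0_le_integralT => //.
  - apply/measurable_EFinP/measurable_funM => //; exact: measurable_bker.
  - by apply: measurable_funeM; apply/measurable_EFinP; exact: measurable_ind.
  - by move=> z; rewrite lee_fin mulr_ge0// bker_ge0.
  move=> z _; rewrite -EFinM lee_fin /bker mulrAC [X in _ <= X]mulrAC ler_wpM2r ?invr_ge0 ?(ltW c0)//.
  have [zr|zr] := ltP `|z| (r *+ 2); last first.
    rewrite /kb (kbump_out r_gt0) ?mul0r; last by rewrite (lt_le_trans _ zr)// mulr2n ltrDl r_gt0.
    by rewrite mulr_ge0// ltW.
  apply: ler_pM => //.
    by rewrite (le_trans (HC z))// ler_piMr ?(ltW C0).
  rewrite !indicE; have [/set_mem Exz|//] := boolP (x + z \in E).
  rewrite mem_set//; split; first by rewrite addrC.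
  rewrite rV_ballE/= sub0r normrN; apply/negP; rewrite -leNgt.
  have := ler_normB (z + x) z; rewrite addrAC subrr add0r => H1.
  by move: xM HM H1 zr => /= *; lra.
rewrite ge0_integralZl_EFin//; last 2 first.
- by apply/measurable_EFinP; exact: measurable_ind.
- by rewrite divr_ge0// ltW.
rewrite integral_indic// setIT (_ : _ ((fun z : V => _) @^-1` T) = mu T); last exact: lebesgue_rV_shift.
rewrite (@le_trans _ _ ((C / bmass)%:E * e'%:E)%E)//.
  by rewrite lee_wpmul2l ?lee_fin ?divr_ge0// ltW.
rewrite -EFinM lee_fin /e' le_eqVlt; apply/orP; left; apply/eqP.
by field; rewrite !gt_eqF.
Qed.

End mollified_indicator.

(** * Perimeters *)

Section perimeter_pint.
Context {R : realType} {n : nat}.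
Notation mu := (lebesgue_rV R n).
Notation lam := (@lebesgue_measure R).
Notation V := 'rV[R]_n.
Variable s : R.
Hypotheses (s0 : 0 < s) (s1 : s < 1).
Implicit Types (A B E F Z : set V).
Local Open Scope ereal_scope.

(** Both domains are exchanged for representatives modulo [Z], and Tonelli's theorem turns the
    iterated integral into one over pairs. *)
Lemma L_s_pint A B A' B' Z : leb_measurable A -> leb_measurable B ->
  measurable A' -> measurable B' -> measurable Z -> mu Z = 0 ->
  A `+` A' `<=` Z -> B `+` B' `<=` Z ->
  L_s s A B = pint s (fun p => \1_A' p.1 * \1_B' p.2)%R.
Proof.
move=> mA mB mA' mB' mZ Z0 AZ BZ.
have mk x : measurable_fun setT (fun y : V => (kern s (x - y)%R)%:E).
  apply/measurable_EFinP.
  apply: (measurableT_comp (f := kern s) (g := fun y : V => (x - y)%R)).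
    exact: measurable_kern.
  by apply: (measurableT_comp measurable_rV_sub (g := fun y : V => (x, y))); exact: measurable_fun_pair.
have k0 (x y : V) : 0 <= (kern s (x - y)%R)%:E by rewrite lee_fin kern_ge0.
have mg : measurable_fun setT (fun p : V * V => \1_A' p.1 * \1_B' p.2 : R)%R.
  by apply: measurable_funM; [exact: measurable_ind_fst|exact: measurable_ind_snd].
have g0 (p : V * V) : (0 <= \1_A' p.1 * \1_B' p.2 :> R)%R by rewrite mulr_ge0.
have mB2 : measurable_fun setT (fun p : V * V => \1_B' p.2 : R) by exact: measurable_ind_snd.
have B0 (p : V * V) : (0 <= (\1_B' p.2 : R))%R by [].
have mH := @measurable_fun_fubini_tonelli_F _ _ V V R mu _ (measurable_pkern s mB2) (pkern_ge0 s B0).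
pose H x := \int[mu]_(y in B') (kern s (x - y)%R)%:E.
have HE x : H x = \int[mu]_y (\1_B' y * kern s (x - y)%R)%:E.
  rewrite /H integral_mkcond epatch_indic; apply: eq_integral => y _.
  by rewrite EFinM muleC.
have mH' : measurable_fun setT H.
  rewrite (_ : H = fun x => \int[mu]_y (\1_B' y * kern s (x - y)%R)%:E)//.
  exact/funext.
rewrite /L_s (pint_fubini1 s mg g0).
transitivity (\int[leb R n]_(x in A) H x).
  have HL : (fun x => \int[leb R n]_(y in B) (kern s (x - y)%R)%:E) = H.
    by apply/funext => x; rewrite /H; exact: (ge0_integral_leb_mod_null mB mB' mZ Z0 BZ (mk x) (k0 x)).
  by rewrite -HL.
have H0 x : 0 <= H x by apply: integral_ge0.
rewrite (ge0_integral_leb_mod_null mA mA' mZ Z0 AZ mH' H0).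
rewrite integral_mkcond epatch_indic; apply: eq_integral => x _.
rewrite HE muleC -ge0_integralZl_EFin//; last 2 first.
- by move=> y _; rewrite lee_fin mulr_ge0// kern_ge0.
- apply/measurable_EFinP/measurable_funM; first exact: measurable_ind.
  by have /measurable_EFinP := mk x.
by apply: eq_integral => y _; rewrite -EFinM mulrA.
Qed.

(** Its indicator [1_F(x) (1 - 1_F(y))] is the integrand of the perimeter of [F], up to the
    kernel. *)
Definition jset F : set (V * V) := [set p | F p.1 /\ ~ F p.2].

Lemma measurable_jset F : measurable F -> measurable (jset F).
Proof.
move=> mF; apply: measurableI; first exact: measurable_fst_pre.
by apply: (@measurable_snd_pre R n (~` F)); exact: measurableC.
Qed.

(** The three terms of [P_s] split the ordered pairs from [E] to its complement, with at least one
    point in [A], according to which of the points are in [A]. *)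
Lemma P_s_pint A E E' Z : leb_measurable E -> measurable E' -> measurable A ->
  measurable Z -> mu Z = 0 -> E `+` E' `<=` Z ->
  P_s s E A = pint s \1_(Dm A `&` jset E').
Proof.
move=> mE mE' mA mZ Z0 EZ.
have mAl := measurable_lebT mA.
have mEC : leb_measurable (~` E) := measurableC mE.
have mEI : leb_measurable (E `&` A) := measurableI _ _ mE mAl.
have mED : leb_measurable (E `\` A) := measurableD mE mAl.
have mECI : leb_measurable (~` E `&` A) := measurableI _ _ mEC mAl.
have mECD : leb_measurable (~` E `\` A) := measurableD mEC mAl.
have mEC' := measurableC mE'.
have nE x : ~ Z x -> E x <-> E' x.
  move=> Zx; split => Ex; apply: contrapT => Ex'; apply: Zx; apply: EZ; [by left|by right].
have sub (S S' : set V) : (forall x, ~ Z x -> S x <-> S' x) -> S `+` S' `<=` Z.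
  move=> H x [] [H1 H2]; apply: contrapT => Zx; apply: H2; exact/(H x Zx).
rewrite /P_s.
have LE (S T S' T' : set V) : leb_measurable S -> leb_measurable T ->
    measurable S' -> measurable T' -> (forall x, ~ Z x -> S x <-> S' x) ->
    (forall x, ~ Z x -> T x <-> T' x) ->
    L_s s S T = pint s (fun p => \1_S' p.1 * \1_T' p.2)%R.
  by move=> *; apply: L_s_pint mZ Z0 _ _ => //; exact: sub.
rewrite (LE (E `&` A) (~` E `&` A) (E' `&` A) (~` E' `&` A))
  ?(LE (E `&` A) (~` E `\` A) (E' `&` A) (~` E' `\` A))
  ?(LE (E `\` A) (~` E `&` A) (E' `\` A) (~` E' `&` A))//;
  try by [apply: measurableI|apply: measurableD|move=> x /nE/=; tauto].
have m1 (S S' : set V) : measurable S -> measurable S' ->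
    measurable_fun setT (fun p : V * V => \1_S p.1 * \1_S' p.2 : R)%R.
  by move=> mS mS'; apply: measurable_funM; [exact: measurable_ind_fst|exact: measurable_ind_snd].
have g0 (S S' : set V) (p : V * V) : (0 <= \1_S p.1 * \1_S' p.2 :> R)%R by rewrite mulr_ge0.
have M1 := m1 _ _ (measurableI _ _ mE' mA) (measurableI _ _ mEC' mA).
have M2 := m1 _ _ (measurableI _ _ mE' mA) (measurableD mEC' mA).
have M3 := m1 _ _ (measurableD mE' mA) (measurableI _ _ mEC' mA).
rewrite -(pintD s M1 M2 (g0 _ _) (g0 _ _)).
rewrite -(pintD s (measurable_funD M1 M2) M3 _ (g0 _ _)); last by move=> p; rewrite addr_ge0.
congr pint; apply/funext => -[x y] /=.
have iE (S : set V) z : z \in S = `[< S z >] by apply/idP/idP => [/set_mem/asboolP|/asboolP/mem_set].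
have iE2 (S : set (V * V)) z : z \in S = `[< S z >] by apply/idP/idP => [/set_mem/asboolP|/asboolP/mem_set].
rewrite !indicE !iE iE2.
rewrite (_ : (Dm A `&` jset E') (x, y) = ((A x \/ A y) /\ (E' x /\ ~ E' y)))//.
rewrite /setI /setD /setC /mkset !asbool_and !asbool_or !asbool_neg.
by case: `[< E' x >]; case: `[< E' y >]; case: `[< A x >]; case: `[< A y >];
  rewrite /= ?mulr0 ?mul0r ?mulr1 ?addr0 ?add0r.
Qed.

Lemma indDm_swap A (p : V * V) : \1_(Dm A) (p.2, p.1) = \1_(Dm A) p :> R.
Proof.
rewrite !indicE; congr (_%:R); congr nat_of_bool.
by apply/idP/idP => /set_mem[]/= H; apply/mem_set; [right|left|right|left].
Qed.

Lemma oscE_le E (p : V * V) : (oscE E p <= \1_(jset E) p + \1_(jset E) (p.2, p.1) :> R)%R.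
Proof.
rewrite /oscE !indicE.
have [E1|E1] := boolP (p.1 \in E); have [E2|E2] := boolP (p.2 \in E).
- by rewrite subrr normr0 addr_ge0.
- rewrite subr0 normr1 mem_set ?lerDl//; split; first exact: set_mem.
  by move=> /mem_set; apply/negP.
- rewrite sub0r normrN normr1 addrC mem_set ?lerDl//; split => /=; first exact: set_mem.
  by move=> /mem_set; apply/negP.
- by rewrite subrr normr0 addr_ge0.
Qed.

Lemma pint_oscE_lty W E : measurable W -> measurable E ->
  pint s \1_(Dm W `&` jset E) < +oo -> pint s (fun p => \1_(Dm W) p * oscE E p)%R < +oo.
Proof.
move=> mW mE Woo; have mD := measurable_Dm mW; have mJ := measurable_jset mE.
have mg : measurable_fun setT (\1_(Dm W `&` jset E) : V * V -> R).
  by apply: measurable_ind; exact: measurableI.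
apply: (@le_lt_trans _ _ (pint s (fun p => \1_(Dm W `&` jset E) p + \1_(Dm W `&` jset E) (p.2, p.1))%R)).
  apply: pint_le.
  - by apply: measurable_funM; [exact: measurable_ind|exact: measurable_oscE].
  - apply: measurable_funD => //; exact: (measurableT_comp mg measurable_pswap).
  - by move=> p; rewrite mulr_ge0// /oscE.
  - move=> p; rewrite (le_trans (ler_wpM2l _ (oscE_le E p)))// mulrDr lerD//.
      by rewrite indicI.
    by rewrite indicI/= indDm_swap.
by rewrite pint_sym2// lte_mul_pinfty ?lee_fin.
Qed.

(** The factor 2 accounts for either point being the one in [A]. It serves twice: for the small
    perturbation, and for the perturbed mollification itself, whose superlevel sets thereby get
    finite perimeter in balls. *)
Lemma pint_lipschitz A (f : V -> R) (C : R) : measurable A -> measurable_fun setT f ->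
  (0 <= C)%R -> (forall x y, `|f x - f y| <= C * Num.min 1 `|y - x|)%R ->
  pint s (fun p => \1_(Dm A) p * `|f p.1 - f p.2|)%R <=
  2%:E * (mu A * (C%:E * \int[mu]_z (Num.min 1 `|z| * kern s z)%:E)).
Proof.
move=> mA mf C0 Cf.
pose h (z : V) : R := Num.min 1%R `|z|%R.
have h0 z : (0 <= h z)%R by rewrite le_min ler01 normr_ge0.
have mh : measurable_fun setT h.
  apply: measurable_minr => //; apply: continuous_measurable_rV; exact: norm_continuous.
have mCh : measurable_fun setT (fun z => C * h z)%R by exact: measurable_funM.
have Ch0 z : (0 <= C * h z)%R by rewrite mulr_ge0.
pose g (p : V * V) : R := (\1_A p.1 * (C * h (p.2 - p.1)))%R.
have mg : measurable_fun setT g.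
  apply: measurable_funM; first exact: measurable_ind_fst.
  apply: (measurableT_comp mCh); exact: (measurableT_comp measurable_rV_sub measurable_pswap).
have g0 p : (0 <= g p)%R by rewrite mulr_ge0.
apply: (@le_trans _ _ (pint s (fun p => g p + g (p.2, p.1))%R)).
  apply: pint_le.
  - apply: measurable_funM; first by apply: measurable_ind; exact: measurable_Dm.
    apply: measurableT_comp => //; apply: measurable_funB.
      exact: (measurableT_comp mf measurable_fst).
    exact: (measurableT_comp mf measurable_snd).
  - by apply: measurable_funD => //; exact: (measurableT_comp mg measurable_pswap).
  - by move=> p; rewrite mulr_ge0.
  - move=> p; rewrite /g/= (_ : h (p.1 - p.2)%R = h (p.2 - p.1)%R); last by rewrite /h distrC.
    rewrite -mulrDl; apply: ler_pM => //; exact: indDm_le.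
rewrite pint_sym2// lee_wpmul2l ?lee_fin//.
rewrite (pint_fst s mA mCh Ch0) lee_wpmul2l//.
rewrite le_eqVlt; apply/orP; left; apply/eqP.
rewrite -ge0_integralZl_EFin//.
- by apply: eq_integral => z _; rewrite -EFinM mulrA.
- by move=> z _; rewrite lee_fin mulr_ge0// kern_ge0.
- by apply/measurable_EFinP/measurable_funM => //; exact: measurable_kern.
Qed.

(** The increment is at most the [bker] average of [incrE E z]; Tonelli moves this average outside,
    where only [|z| <= r] carries weight. *)
Lemma umoll_pint_small A E (r : R) (e : \bar R) : measurable A -> measurable E ->
  (0 < r)%R -> 0 <= e ->
  (forall z, (`|z| <= r)%R -> pint s (fun p => \1_(Dm A) p * incrE E z p)%R <= e) ->
  pint s (fun p => \1_(Dm A) p *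
    `|(umoll r E p.1 - \1_E p.1) - (umoll r E p.2 - \1_E p.2)|)%R <= e.
Proof.
move=> mA mE r0 e0 He.
pose F (pz : (V * V) * V) : R := (\1_(Dm A) pz.1 * incrE E pz.2 pz.1 * kern s (pz.1.1 - pz.1.2))%R.
have madd := @measurable_rV_add R n.
have mi := measurable_ind (R := R) mE.
have m1 : measurable_fun setT (fun pz : (V * V) * V => pz.1.1).
  exact: (measurableT_comp measurable_fst measurable_fst).
have m2 : measurable_fun setT (fun pz : (V * V) * V => pz.1.2).
  exact: (measurableT_comp measurable_snd measurable_fst).
have m3 : measurable_fun setT (fun pz : (V * V) * V => pz.2).
  exact: measurable_snd.
have mF : measurable_fun setT F.
  apply: measurable_funM; last first.
    apply: (measurableT_comp (measurable_kern s)).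
    exact: (measurableT_comp measurable_rV_sub measurable_fst).
  apply: measurable_funM.
    by apply: (measurableT_comp (measurable_ind _) measurable_fst); exact: measurable_Dm.
  apply: measurableT_comp => //; apply: measurable_funB; apply: measurable_funB.
  - apply: (measurableT_comp mi); apply: (measurableT_comp madd (g := fun pz : (V * V) * V => (pz.1.1, pz.2))).
    exact: measurable_fun_pair.
  - exact: (measurableT_comp mi m1).
  - apply: (measurableT_comp mi); apply: (measurableT_comp madd (g := fun pz : (V * V) * V => (pz.1.2, pz.2))).
    exact: measurable_fun_pair.
  - exact: (measurableT_comp mi m2).
have F0 pz : (0 <= F pz)%R by rewrite !mulr_ge0// ?kern_ge0// /incrE.
have mb := measurable_bker (n := n) r.
have b0 z := bker_ge0 (n := n) r0 z.
have HF z : bker r z != 0%R -> \int[mu \x mu]_t (F (t, z))%:E <= e.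
  move=> bz; apply: He; rewrite leNgt; apply/negP => /(bker_out r0) bz0.
  by rewrite bz0 eqxx in bz.
have K := @kernel_average_le R n _ (V * V)%type (prodm mu mu) (bker r) F e mb b0 (bker_integral r0) mF F0 HF e0.
apply: le_trans K.
have mf : measurable_fun setT (fun tz : (V * V) * V => (bker r tz.2 * F tz)%:E).
  by apply/measurable_EFinP/measurable_funM => //; exact: (measurableT_comp mb measurable_snd).
have f0 tz : 0 <= (bker r tz.2 * F tz)%:E by rewrite lee_fin mulr_ge0.
have mu1 := measurable_umoll r0 mE.
have mu2 : measurable_fun setT (fun x => umoll r E x - \1_E x)%R by exact: measurable_funB.
apply: ge0_le_integralT => //.
- apply: measurable_pkern; apply: measurable_funM; first by apply: measurable_ind; exact: measurable_Dm.
  apply: measurableT_comp => //; apply: measurable_funB.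
    exact: (measurableT_comp mu2 measurable_fst).
  exact: (measurableT_comp mu2 measurable_snd).
- exact: (@measurable_fun_fubini_tonelli_F _ _ (V * V)%type V R mu _ mf f0).
- by move=> p; rewrite lee_fin !mulr_ge0// kern_ge0.
move=> p _; rewrite mulrAC EFinM.
pose c := (\1_(Dm A) p * kern s (p.1 - p.2))%R.
have c0 : (0 <= c)%R by rewrite mulr_ge0// kern_ge0.
apply: (@le_trans _ _ (c%:E * \int[mu]_z (bker r z * incrE E z (p.1, p.2))%:E)).
  by rewrite lee_wpmul2l ?lee_fin//; exact: umoll_incr_le.
rewrite -ge0_integralZl_EFin//.
- rewrite le_eqVlt; apply/orP; left; apply/eqP; apply: eq_integral => z _.
  by rewrite -EFinM /F /c/= /incrE/=; congr EFin; ring.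
- by move=> z _; rewrite lee_fin mulr_ge0// /incrE.
- apply/measurable_EFinP/measurable_funM => //.
  have mshift (x : V) : measurable_fun setT (fun z : V => \1_E (x + z)%R : R).
    apply: (measurableT_comp mi); apply: (measurableT_comp madd (g := fun z : V => (x, z))).
    exact: measurable_fun_pair.
  by apply: measurableT_comp => //; apply: measurable_funB; apply: measurable_funB.
Qed.

Lemma umoll_int_small B E (r : R) (e : \bar R) : measurable B -> measurable E ->
  (0 < r)%R -> 0 <= e -> (forall z, (`|z| <= r)%R -> mu (shiftD E z `&` B) <= e) ->
  \int[mu]_x (\1_B x * `|umoll r E x - \1_E x|)%:E <= e.
Proof.
move=> mB mE r0 e0 He.
pose F (pz : V * V) : R := (\1_B pz.1 * `|\1_E (pz.1 + pz.2) - \1_E pz.1|)%R.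
have madd := @measurable_rV_add R n.
have mi := measurable_ind (R := R) mE.
have mF : measurable_fun setT F.
  apply: measurable_funM; first exact: measurable_ind_fst.
  apply: measurableT_comp => //; apply: measurable_funB; last exact: measurable_ind_fst.
  exact: (measurableT_comp mi madd).
have F0 pz : (0 <= F pz)%R by rewrite mulr_ge0.
have mb := measurable_bker (n := n) r.
have b0 z := bker_ge0 (n := n) r0 z.
have HF z : bker r z != 0%R -> \int[mu]_t (F (t, z))%:E <= e.
  move=> bz; apply: (@le_trans _ _ (mu (shiftD E z `&` B))); last first.
    apply: He; rewrite leNgt; apply/negP => /(bker_out r0) bz0.
    by rewrite bz0 eqxx in bz.
  have mS := measurable_shiftD z mE.
  rewrite -[shiftD E z `&` B]setIT -integral_indic//; last exact: measurableI.
  apply: ge0_le_integralT => //.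
  - apply/measurable_EFinP; apply: (measurableT_comp mF (g := fun x : V => (x, z))).
    exact: measurable_fun_pair.
  - by apply/measurable_EFinP/measurable_ind; exact: measurableI.
  - by move=> x; rewrite lee_fin.
  - move=> x _; rewrite lee_fin /F/= indicI mulrC ler_wpM2r//.
    exact: ind_shiftD_le.
have K := @kernel_average_le R n _ V mu (bker r) F e mb b0 (bker_integral r0) mF F0 HF e0.
apply: le_trans K.
have mf : measurable_fun setT (fun tz : V * V => (bker r tz.2 * F tz)%:E).
  by apply/measurable_EFinP/measurable_funM => //; exact: (measurableT_comp mb measurable_snd).
have f0 tz : 0 <= (bker r tz.2 * F tz)%:E by rewrite lee_fin mulr_ge0.
have mu1 := measurable_umoll r0 mE.
have mu2 : measurable_fun setT (fun x => umoll r E x - \1_E x)%R by exact: measurable_funB.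
apply: ge0_le_integralT => //.
- apply/measurable_EFinP/measurable_funM; first exact: measurable_ind.
  exact: measurableT_comp.
- exact: (@measurable_fun_fubini_tonelli_F _ _ V V R mu _ mf f0).
move=> x _; rewrite EFinM.
apply: (@le_trans _ _ ((\1_B x)%:E * \int[mu]_z (bker r z * `|\1_E (x + z) - \1_E x|)%:E)).
  by rewrite lee_wpmul2l ?lee_fin//; exact: umoll_diff_le.
rewrite -ge0_integralZl_EFin//.
- rewrite le_eqVlt; apply/orP; left; apply/eqP; apply: eq_integral => z _.
  by rewrite -EFinM /F/= mulrCA.
- by move=> z _; rewrite lee_fin mulr_ge0.
- apply/measurable_EFinP/measurable_funM => //; apply: measurableT_comp => //.
  apply: measurable_funB => //; apply: (measurableT_comp mi).
  by apply: (measurableT_comp madd (g := fun z : V => (x, z))); exact: measurable_fun_pair.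
Qed.

End perimeter_pint.

Section atan_pert_bounds.
Context {R : realType} {n : nat}.
Implicit Types (a x y : 'rV[R]_n).

Lemma atan_bound2 (x : R) : `|atan x| <= 2.
Proof.
have := atan_ltpi2 x; have := atan_gtNpi2 x; have := @pihalf_lt2 R.
by rewrite ler_norml => *; apply/andP; split; lra.
Qed.

Lemma atan_pert_bound a x : `|atan_pert a x| <= n%:R * `|a| * 2.
Proof.
rewrite (le_trans (ler_norm_sum _ _ _))// -mulrA -[X in X%:R]card_ord -sum1_card natr_sum mulr_suml.
apply: ler_sum => i _; rewrite mul1r normrM.
by apply: ler_pM => //; [exact: coord_le_norm|exact: atan_bound2].
Qed.

(** Twice the sup bound at distance at least 1, the Lipschitz bound below it: the form that
    [pint_lipschitz] takes. *)
Lemma atan_pert_diff a x y :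
  `|atan_pert a x - atan_pert a y| <= n%:R * `|a| * 4 * Num.min 1 `|y - x|.
Proof.
have na0 : 0 <= n%:R * `|a| by rewrite mulr_ge0.
have [xy|xy] := leP 1 `|y - x|.
  rewrite mulr1 (le_trans (ler_normB _ _))//.
  have := atan_pert_bound a x; have := atan_pert_bound a y; lra.
apply: (@le_trans _ _ (n%:R * `|a| * `|y - x|)); last first.
  by rewrite ler_wpM2r// ler_peMr//; lra.
rewrite /atan_pert -sumrB (le_trans (ler_norm_sum _ _ _))//.
rewrite -mulrA -[X in X%:R]card_ord -sum1_card natr_sum mulr_suml.
apply: ler_sum => i _; rewrite mul1r -mulrBr normrM.
apply: ler_pM => //; first exact: coord_le_norm.
rewrite distrC (le_trans (atan_lipschitz _ _))//.
by have := coord_le_norm (y - x) i; rewrite !mxE.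
Qed.

Lemma smooth_atan_pert a : smooth_fun (atan_pert a).
Proof. by apply: smooth_sum => i; apply: smoothZ; apply: smooth_coord => k; exact: Ck_atan. Qed.

Lemma is_derive_atan_pert a x (i : 'I_n) :
  is_derive x (basis_vec i) (atan_pert a) (a ord0 i / (1 + x ord0 i ^+ 2)).
Proof.
have -> : atan_pert a = \sum_(j < n) (fun x => a ord0 j * atan (x ord0 j)).
  by apply/funext => y; rewrite fct_sumE.
have -> : a ord0 i / (1 + x ord0 i ^+ 2) =
    \sum_(j < n) a ord0 j *: (if i == j then (1 + x ord0 j ^+ 2)^-1 else 0).
  by rewrite (bigD1 i)//= eqxx big1 ?addr0// => j /negbTE; rewrite eq_sym => ->; rewrite scaler0.
apply: is_derive_sum => j; apply: is_deriveZ.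
apply: is_derive_coord; exact: is_derive1_atan.
Qed.

End atan_pert_bounds.

(** * Errors of superlevel sets averaged over the level *)

Section superlevel.
Context {R : realType} {n : nat}.
Notation mu := (lebesgue_rV R n).
Notation lam := (@lebesgue_measure R).
Notation V := 'rV[R]_n.
Variable s : R.
Hypotheses (s0 : 0 < s) (s1 : s < 1).
Variables (w : V -> R) (E : set V).
Hypothesis mw : measurable_fun setT w.
Hypothesis mE : measurable E.
Local Open Scope ereal_scope.

Definition suplevel (t : R) : set V := [set x | (t < w x)%R].

(** With [set0] in place of [E] this reduces to the jump sets of the superlevel sets themselves. *)
Definition jump_levels : set (measurableTypeR R * (V * V)) :=
  [set tp | window tp.1 /\ (jset (suplevel tp.1) `+` jset E) tp.2].

Definition diff_levels : set (measurableTypeR R * V) :=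
  [set tx | window tx.1 /\ (suplevel tx.1 `+` E) tx.2].

Let mlt d (T : measurableType d) (f g : T -> R) : measurable_fun setT f ->
  measurable_fun setT g -> measurable [set x | (f x < g x)%R].
Proof.
move=> mf mg; have := measurable_funB mg mf measurableT (measurable_itv `]0%R, +oo[).
rewrite setTI (_ : _ @^-1` _ = [set x | (f x < g x)%R])//.
by apply/seteqP; split => x /=; rewrite in_itv/= andbT subr_gt0.
Qed.

Let mwindow : measurable (window : set (measurableTypeR R)).
Proof. exact: measurable_itv. Qed.

Lemma measurable_suplevel t : measurable (suplevel t).
Proof. exact: mlt. Qed.

Lemma measurable_jump_levels : measurable jump_levels.
Proof.
have m1 : measurable_fun setT (fun tp : measurableTypeR R * (V * V) => w tp.2.1).
  apply: (measurableT_comp mw); exact: (measurableT_comp measurable_fst measurable_snd).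
have m2 : measurable_fun setT (fun tp : measurableTypeR R * (V * V) => w tp.2.2).
  apply: (measurableT_comp mw); exact: (measurableT_comp measurable_snd measurable_snd).
have J1 : measurable [set tp : measurableTypeR R * (V * V) | jset (suplevel tp.1) tp.2].
  apply: measurableI; first exact: mlt.
  by apply: measurableC; exact: mlt.
have J2 : measurable [set tp : measurableTypeR R * (V * V) | jset E tp.2].
  by rewrite -[X in measurable X]setTI; apply: measurable_snd => //; exact: measurable_jset.
apply: measurableI.
  by rewrite -[X in measurable X]setTI; exact: measurable_fst.
by apply: measurableU; exact: measurableD.
Qed.

Lemma measurable_diff_levels : measurable diff_levels.
Proof.
have m1 : measurable_fun setT (fun tp : measurableTypeR R * V => w tp.2).
  exact: (measurableT_comp mw measurable_snd).
have J1 : measurable [set tp : measurableTypeR R * V | suplevel tp.1 tp.2] by exact: mlt.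
have J2 : measurable [set tp : measurableTypeR R * V | E tp.2].
  by rewrite -[X in measurable X]setTI; exact: measurable_snd.
apply: measurableI.
  by rewrite -[X in measurable X]setTI; exact: measurable_fst.
by apply: measurableU; exact: measurableD.
Qed.

Lemma jump_average (q : V * V -> R) : measurable_fun setT q -> (forall p, 0 <= q p)%R ->
  (forall x, - 4^-1 <= w x <= 5 / 4)%R ->
  measurable_fun setT (fun t : measurableTypeR R =>
     pint s (fun p => \1_jump_levels (t, p) * q p)%R) /\
  \int[lam]_t pint s (fun p => \1_jump_levels (t, p) * q p)%R <=
  pint s (fun p => `|(w p.1 - \1_E p.1) - (w p.2 - \1_E p.2)| * q p)%R.
Proof.
move=> mq q0 wb.
pose c (p : V * V) : R := `|(w p.1 - \1_E p.1) - (w p.2 - \1_E p.2)|%R.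
have mwE : measurable_fun setT (fun x => w x - \1_E x)%R.
  by apply: measurable_funB => //; exact: measurable_ind.
have mc : measurable_fun setT c.
  apply: measurableT_comp => //; apply: measurable_funB.
    exact: (measurableT_comp mwE measurable_fst).
  exact: (measurableT_comp mwE measurable_snd).
have c0 p : (0 <= c p)%R by rewrite /c.
pose qk (p : V * V) : R := (q p * kern s (p.1 - p.2))%R.
have mqk : measurable_fun setT qk by apply/measurable_EFinP; exact: measurable_pkern.
have qk0 p : (0 <= qk p)%R by rewrite mulr_ge0// kern_ge0.
have Sc p : lam (ysection jump_levels p) <= (c p)%:E.
  rewrite /c [X in (w p.1 - X)%R]indicE [X in (_ - (w p.2 - X))%R]indicE.
  apply: level_jump_measure_le => //; first exact: measurable_ysection measurable_jump_levels.
  move=> t; rewrite /ysection/= => /set_mem[/= It J]; split => //.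
  apply/eqP => H; move: J; rewrite /jset /suplevel/=.
  have E1 : E p.1 <-> p.1 \in E by split => [/mem_set|/set_mem].
  have E2 : E p.2 <-> p.2 \in E by split => [/mem_set|/set_mem].
  have W2 : ~ (t < w p.2)%R <-> (w p.2 <= t)%R by split => [/negP|]; rewrite leNgt => // /negP.
  rewrite /setD /mkset => -[[[a b] c']|[[a b] c']].
    move: H; rewrite a (W2.1 b)/= => /esym/andP[/E1 e1 e2].
    by apply: c'; split => // /E2 e2'; rewrite e2' in e2.
  move: H; have -> : (p.1 \in E) && (p.2 \notin E).
    by rewrite (E1.1 a)/=; apply/negP => /E2.
  by move=> /andP[t1 t2]; apply: c'; split => //; apply/W2.
have [H1 H2] := level_average_le (prodm mu mu) measurable_jump_levels mqk qk0 mc c0 Sc.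
have E1 : (fun t : measurableTypeR R => pint s (fun p => \1_jump_levels (t, p) * q p)%R)
    = (fun t => \int[prodm mu mu]_p (\1_jump_levels (t, p) * qk p)%:E).
  apply/funext => t; apply: eq_integral => p _; by rewrite /qk mulrA.
rewrite E1; split => //; apply: (le_trans H2).
rewrite le_eqVlt; apply/orP; left; apply/eqP; apply: eq_integral => p _.
by rewrite /qk mulrA.
Qed.

Lemma diff_average (q : V -> R) : measurable_fun setT q -> (forall x, 0 <= q x)%R ->
  measurable_fun setT (fun t : measurableTypeR R =>
     \int[mu]_x (\1_diff_levels (t, x) * q x)%:E) /\
  \int[lam]_t \int[mu]_x (\1_diff_levels (t, x) * q x)%:E <=
  \int[mu]_x (`|w x - \1_E x| * q x)%:E.
Proof.
move=> mq q0.
have mc : measurable_fun setT (fun x => `|w x - \1_E x|%R).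
  by apply: measurableT_comp => //; apply: measurable_funB => //; exact: measurable_ind.
apply: level_average_le => //; first exact: measurable_diff_levels.
move=> x; rewrite [X in (w x - X)%R]indicE.
apply: level_measure_le; first exact: measurable_ysection measurable_diff_levels.
move=> t; rewrite /ysection/= => /set_mem[/= It J]; split => //.
apply/eqP => H; move: J; rewrite /suplevel/= H.
have E1 : E x <-> x \in E by split => [/mem_set|/set_mem].
by move=> [[a b]|[a b]]; apply: b; apply/E1.
Qed.

End superlevel.

(** * Choice of the level *)

(** Under a product of two weights each summand keeps the weight suited to it: below, [A] or [B] for
    the mollification error and the set [U] of finite measure for the perturbation. *)
Lemma norm_sum_weight_le (R : realDomainType) (x y a b : R) : 0 <= a <= 1 -> 0 <= b <= 1 ->
  `|x + y| * (a * b) <= a * `|x| + b * `|y|.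
Proof.
move=> /andP[a0 a1] /andP[b0 b1].
apply: (@le_trans _ _ ((`|x| + `|y|) * (a * b))); first by rewrite ler_wpM2r ?mulr_ge0 ?ler_normD.
rewrite mulrDl lerD//.
  by rewrite mulrA [`|x| * a]mulrC ler_piMr ?mulr_ge0.
by rewrite mulrC -mulrA ler_piMl ?mulr_ge0.
Qed.

Lemma quad_split (R : comNzRingType) (u1 u2 f1 f2 i1 i2 : R) :
  (u1 + f1 - i1) - (u2 + f2 - i2) = (u1 - i1 - (u2 - i2)) + (f1 - f2).
Proof. by ring. Qed.

Lemma unit_diff_le1 (R : realDomainType) (x y : R) : 0 <= x <= 1 -> 0 <= y <= 1 -> `|x - y| <= 1.
Proof. by move=> /andP[? ?] /andP[? ?]; rewrite ler_norml; apply/andP; split; lra. Qed.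

Lemma unit_pert_bounds (R : realFieldType) (x y : R) : 0 <= x <= 1 -> `|y| <= 8^-1 ->
  - 4^-1 <= x + y <= 5 / 4.
Proof. by rewrite ler_norml => /andP[? ?] /andP[? ?]; apply/andP; split; lra. Qed.

Section good_level.
Context {R : realType} {n : nat}.
Notation mu := (lebesgue_rV R n).
Notation lam := (@lebesgue_measure R).
Notation V := 'rV[R]_n.
Variable s : R.
Hypotheses (s0 : 0 < s) (s1 : s < 1).
Local Open Scope ereal_scope.

Lemma shiftD_small_in E B (e : R) : measurable E -> measurable B ->
  (exists2 M : R, (0 < M)%R & B `<=` ball (0%R : V) M) \/ mu E < +oo -> (0 < e)%R ->
  exists2 q : R, (0 < q)%R & forall z, (`|z| < q)%R -> mu (shiftD E z `&` B) <= e%:E.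
Proof.
move=> mE mB [[M M0 BM]|Eoo] e0.
  have [q q0 Hq] := shift_continuous mE M0 e0; exists q => // z /Hq /ltW.
  apply: le_trans; apply: le_measure; rewrite ?inE; last exact: setIS.
    by apply: measurableI => //; exact: measurable_shiftD.
  by apply: measurableI; [exact: measurable_shiftD|exact: measurable_rV_ball].
have [q q0 Hq] := shiftD_small mE Eoo e0; exists q => // z /Hq /ltW.
apply: le_trans; apply: le_measure; rewrite ?inE; last exact: subIsetl.
  by apply: measurableI => //; exact: measurable_shiftD.
exact: measurable_shiftD.
Qed.

Lemma bounded_set_lty (S : set V) : measurable S -> bounded_set S -> mu S < +oo.
Proof.
move=> mS [M [_ SM]].
pose K := (Num.max 0 M + 1)%R; have K0 : (0 < K)%R by rewrite ltr_wpDl// le_max lexx.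
have MK : (M < K)%R by rewrite ltr_pwDr// le_max lexx orbT.
apply: (@le_lt_trans _ _ (mu (ball (0%R : V) (K + 1)%R))).
  apply: le_measure; rewrite ?inE//; first exact: measurable_rV_ball.
  move=> x /(SM _ MK)/= xM; rewrite rV_ballE/= sub0r normrN (le_lt_trans xM)//.
  by rewrite ltrDl.
by rewrite lebesgue_rV_ball ?ltry// addr_gt0.
Qed.

Definition pert_moll (r : R) (E : set V) (a : V) (x : V) : R :=
  (umoll r E x + atan_pert a x)%R.

Lemma good_level (A W E B : set V) (rho eps delta : R) :
  measurable A -> measurable W -> measurable E -> measurable B ->
  (0 < rho)%R -> (forall x z, A x -> (`|z| < rho)%R -> W (x + z)%R) ->
  pint s \1_(Dm W `&` jset E) < +oo ->
  (mu A < +oo /\ exists2 M : R, (0 < M)%R & B `<=` ball (0%R : V) M) \/ mu E < +oo ->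
  (0 < eps)%R -> (0 < delta)%R ->
  exists r a t, let F := suplevel (pert_moll r E a) t in
    [/\ (0 < r < eps)%R, window t, (n%:R * `|a| * 2 <= 8^-1)%R &
    [/\ forall x, pert_moll r E a x = t ->
          exists i, ('D_(basis_vec i) (umoll r E) x + a ord0 i / (1 + x ord0 i ^+ 2) != 0)%R,
        pint s (fun p => \1_(Dm A) p * \1_(jset F `+` jset E) p)%R < delta%:E,
        mu ((F `+` E) `&` B) < delta%:E &
        forall k : nat, pint s \1_(Dm (ball (0%R : V) k.+1%:R) `&` jset F) < +oo]].
Proof.
move=> mA mW mE mB rho0 AW Woo AB eps0 d0.
(* Mollification and perturbation each enter the perimeter error and the measure error: four terms
   of size [delta / 16], together below the [delta / 2] that [exists_good_level] asks for. *)
pose e8 := (delta / 16)%R; have e80 : (0 < e8)%R by rewrite divr_gt0.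
have h8 : (8^-1 + 8^-1 <= 4^-1 :> R)%R by lra.
have e8d : (e8 + e8 + (e8 + e8) < delta / 2)%R by rewrite /e8; lra.
have [q1 q10 Hq1] : exists2 q : R, (0 < q)%R & forall z, (`|z| < q)%R ->
    pint s (fun p => \1_(Dm A) p * incrE E z p)%R <= e8%:E.
  apply: (translate_small s0 s1 mA mW mE rho0 AW _ _ e80); first exact: pint_oscE_lty.
  by case: AB => [[]|]; [left|right].
have [q2 q20 Hq2] : exists2 q : R, (0 < q)%R & forall z, (`|z| < q)%R ->
    mu (shiftD E z `&` B) <= e8%:E.
  by apply: shiftD_small_in => //; case: AB => [[]|]; [left|right].
pose m := Num.min eps (Num.min q1 q2).
have m0 : (0 < m)%R by rewrite !lt_min eps0 q10.
pose r := (m / 2)%R.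
have r0 : (0 < r)%R by rewrite divr_gt0.
have rm : (r < m)%R by rewrite /r; lra.
have reps : (r < eps)%R by rewrite (lt_le_trans rm)// ge_min lexx.
have rq1 : (r < q1)%R by rewrite (lt_le_trans rm)// !ge_min lexx orbT.
have rq2 : (r < q2)%R by rewrite (lt_le_trans rm)// !ge_min lexx !orbT.
have T1 := umoll_pint_small mA mE r0 (ltW (e80 : 0 < e8%:E))
  (fun z zr => Hq1 z (le_lt_trans zr rq1)).
have T2 := umoll_int_small mB mE r0 (ltW (e80 : 0 < e8%:E))
  (fun z zr => Hq2 z (le_lt_trans zr rq2)).
have mu1 := measurable_umoll r0 mE.
(* A set of finite measure carrying everything that matters: if [mu A] may be
   infinite, then off [U] the superlevel sets agree with [E]. *)
have [U [mU Uoo HU]] : exists U : set V, [/\ measurable U, mu U < +oo &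
    (A `<=` U /\ B `<=` U) \/ (forall x, ~ U x -> ~ E x /\ (umoll r E x <= 8^-1)%R)].
  case: AB => [[Aoo [M M0 BM]]|Eoo].
    exists (A `|` B); split; [exact: measurableU| |by left; split => x; [left|right]].
    rewrite (le_lt_trans (measureU2 _ _ _))// lte_add_pinfty//.
    apply: (@le_lt_trans _ _ (mu (ball (0%R : V) M))).
      by apply: le_measure; rewrite ?inE//; exact: measurable_rV_ball.
    by rewrite lebesgue_rV_ball// ltry.
  have mS : measurable [set x | (8^-1 < umoll r E x)%R].
    by apply: (measurable_suplevel (w := umoll r E)).
  exists (E `|` [set x | (8^-1 < umoll r E x)%R]); split; first exact: measurableU.
    rewrite (le_lt_trans (measureU2 _ _ _))// lte_add_pinfty//.
    by apply: bounded_set_lty => //; apply: umoll_bounded_level.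
  by right => x /not_orP[Ex /negP]; rewrite -leNgt.
pose J := \int[mu]_z (Num.min 1 `|z| * kern s z)%:E.
have J0 : 0 <= J.
  by apply: integral_ge0 => z _; rewrite lee_fin mulr_ge0 ?kern_ge0// le_min ler01 normr_ge0.
have Jfin : J \is a fin_num by rewrite ge0_fin_numE// kern_integral_lty.
have Ufin : mu U \is a fin_num by rewrite ge0_fin_numE.
pose j := fine J; pose v := fine (mu U).
have j0 : (0 <= j)%R by exact: fine_ge0.
have v0 : (0 <= v)%R by exact: fine_ge0.
(* With [|a| < alpha], the number [N = n |a|] satisfies [16 N (v + 1) (j + 1) <= m1]. This gives
   [2 N <= 1/8] for the size of the perturbation, [8 N v j <= e8] for its seminorm over [U] and
   [2 N v <= e8] for its integral over [U]. *)
pose m1 := Num.min 1%R e8.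
have m10 : (0 < m1)%R by rewrite lt_min ltr01.
pose alpha := (m1 / (16 * (n%:R + 1) * ((v + 1) * (j + 1))))%R.
have vj : (0 < (v + 1) * (j + 1))%R by rewrite mulr_gt0// ltr_wpDl.
have n1 : (0 < n%:R + 1 :> R)%R by rewrite ltr_wpDl.
have alpha0 : (0 < alpha)%R by rewrite divr_gt0// mulr_gt0// mulr_gt0.
have [a aalpha [Z [mZ Z0 HZ]]] := generic_regular_value (umoll_lipschitz r0 mE)
  (fun i => umoll_derive_lipschitz r0 mE i) alpha0.
pose N := (n%:R * `|a|)%R.
have N0 : (0 <= N)%R by rewrite mulr_ge0.
have NK : (16 * N * ((v + 1) * (j + 1)) <= m1)%R.
  rewrite -ler_pdivlMr//.
  apply: (@le_trans _ _ (16 * (n%:R + 1) * alpha)%R).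
    rewrite -!mulrA ler_pM2l//; apply: ler_pM => //; last exact: ltW.
    by rewrite lerDl.
  rewrite /alpha le_eqVlt; apply/orP; left; apply/eqP; field.
  by rewrite !gt_eqF// ltr_wpDl.
have N1 : (16 * N <= m1)%R.
  apply: le_trans NK; rewrite ler_peMr ?mulr_ge0//.
  by rewrite -[leLHS]mulr1; apply: ler_pM => //; rewrite lerDr.
have Nv : (16 * N * v <= m1)%R.
  apply: le_trans NK; rewrite ler_wpM2l ?mulr_ge0//.
  by rewrite -[leLHS]mulr1; apply: ler_pM => //; rewrite ?lerDl ?lerDr.
have Nvj : (16 * N * (v * j) <= m1)%R.
  by apply: le_trans NK; rewrite ler_wpM2l ?mulr_ge0//; apply: ler_pM => //; rewrite lerDl.
have m11 : (m1 <= 1)%R by rewrite ge_min lexx.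
have m1e : (m1 <= e8)%R by rewrite ge_min lexx orbT.
have N8 : (N * 2 <= 8^-1)%R by lra.
have Nvj8 : (2 * (v * (N * 4 * j)) <= e8)%R.
  by have H := mulr_ge0 N0 (mulr_ge0 v0 j0); have H1 := le_trans Nvj m1e; lra.
have Nv8 : (v * (N * 2) <= e8)%R.
  by have H := mulr_ge0 N0 v0; have H1 := le_trans Nv m1e; lra.
pose w := pert_moll r E a.
pose f := atan_pert a.
have fb x : (`|f x| <= 8^-1)%R by rewrite (le_trans (atan_pert_bound a x)).
have mf : measurable_fun setT f.
  by apply: continuous_measurable_rV; apply: smooth_fun_continuous; exact: smooth_atan_pert.
have mw : measurable_fun setT w by exact: measurable_funD.
have wE x : w x = (umoll r E x + f x)%R by [].
have wb x : (- 4^-1 <= w x <= 5 / 4)%R.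
  by rewrite wE; apply: unit_pert_bounds => //; rewrite umoll_ge0// umoll_le1.
have [L L0 HL] := umoll_lipschitz r0 mE.
(* [L + 1] covers the mollification, which is [L]-Lipschitz with values in [0, 1]; [N * 4] covers
   the perturbation. *)
pose C := (L + 1 + N * 4)%R.
have C0 : (0 <= C)%R by rewrite !addr_ge0// mulr_ge0.
have wC x y : (`|w x - w y| <= C * Num.min 1 `|y - x|)%R.
  rewrite !wE opprD addrACA.
  rewrite (le_trans (ler_normD _ _))// /C [leRHS]mulrDl; apply: lerD; last exact: atan_pert_diff.
  have [xy|xy] := leP 1%R `|y - x|%R.
    rewrite mulr1 (@le_trans _ _ 1%R)//; last by rewrite lerDr.
    by apply: unit_diff_le1; rewrite umoll_ge0// umoll_le1.
  by rewrite (le_trans (HL x y))// distrC ler_wpM2r// lerDl.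
(* The factor for [A] bounds the mollification error, the factor for [U] the perturbation; the
   latter is removed again at the chosen level. *)
pose qA (p : V * V) : R := (\1_(Dm A) p * \1_(Dm U) p)%R.
have mDA := measurable_Dm mA; have mDU := measurable_Dm mU.
have mqA : measurable_fun setT qA by apply: measurable_funM; exact: measurable_ind.
have qA0 p : (0 <= qA p)%R by rewrite mulr_ge0.
pose qB (x : V) : R := (\1_B x * \1_U x)%R.
have mqB : measurable_fun setT qB by apply: measurable_funM; exact: measurable_ind.
have qB0 p : (0 <= qB p)%R by rewrite mulr_ge0.
have i01 (T : Type) (S : set T) x : (0 <= (\1_S x : R) <= 1)%R.
  by rewrite indicE; case: (_ \in _); rewrite ?lexx ?ler01.
have [mG HG] := jump_average s mw mE mqA qA0 wb.
have [mLf HLf] := diff_average mw mE mqB qB0.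
have msub (u : V -> R) : measurable_fun setT u ->
    measurable_fun setT (fun p : V * V => `|u p.1 - u p.2|%R).
  move=> mu0; apply: measurableT_comp => //; apply: measurable_funB.
    exact: (measurableT_comp mu0 measurable_fst).
  exact: (measurableT_comp mu0 measurable_snd).
have mwE : measurable_fun setT (fun x => w x - \1_E x)%R.
  by apply: measurable_funB => //; exact: measurable_ind.
have muE : measurable_fun setT (fun x => umoll r E x - \1_E x)%R.
  by apply: measurable_funB => //; exact: measurable_ind.
have BG : pint s (fun p => `|(w p.1 - \1_E p.1) - (w p.2 - \1_E p.2)| * qA p)%R <= (e8 + e8)%:E.
  pose g1 (p : V * V) : R := (\1_(Dm A) p * `|(umoll r E p.1 - \1_E p.1) - (umoll r E p.2 - \1_E p.2)|)%R.
  pose g2 (p : V * V) : R := (\1_(Dm U) p * `|f p.1 - f p.2|)%R.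
  have mg1 : measurable_fun setT g1.
    by apply: measurable_funM; [exact: measurable_ind|exact: (msub _ muE)].
  have mg2 : measurable_fun setT g2.
    by apply: measurable_funM; [exact: measurable_ind|exact: msub].
  have g10 p : (0 <= g1 p)%R by rewrite mulr_ge0.
  have g20 p : (0 <= g2 p)%R by rewrite mulr_ge0.
  apply: (@le_trans _ _ (pint s (fun p => g1 p + g2 p)%R)).
    apply: pint_le.
    - by apply: measurable_funM => //; exact: (msub _ mwE).
    - exact: measurable_funD.
    - by move=> p; rewrite mulr_ge0.
    - move=> p; rewrite !wE (_ : _ - _ = (umoll r E p.1 - \1_E p.1 - (umoll r E p.2 - \1_E p.2))
        + (f p.1 - f p.2))%R; last exact: quad_split.
      apply: norm_sum_weight_le; exact: i01.
  rewrite (pintD s mg1 mg2 g10 g20) EFinD leeD//.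
  have N40 : (0 <= N * 4)%R by rewrite mulr_ge0.
  apply: (le_trans (pint_lipschitz s mU mf N40 (atan_pert_diff a))).
  rewrite -/J -(fineK Jfin) -(fineK Ufin) -/j -/v -!EFinM lee_fin.
  exact: Nvj8.
have BL : \int[mu]_x (`|w x - \1_E x| * qB x)%:E <= (e8 + e8)%:E.
  pose g1 (x : V) : R := (\1_B x * `|umoll r E x - \1_E x|)%R.
  pose g2 (x : V) : R := (\1_U x * (N * 2))%R.
  have mg1 : measurable_fun setT g1.
    by apply: measurable_funM; [exact: measurable_ind|exact: measurableT_comp].
  have mg2 : measurable_fun setT g2.
    by apply: measurable_funM; [exact: measurable_ind|exact: measurable_cst].
  have g10 p : (0 <= g1 p)%R by rewrite mulr_ge0.
  have g20 p : (0 <= g2 p)%R by rewrite !mulr_ge0.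
  apply: (@le_trans _ _ (\int[mu]_x ((g1 x)%:E + (g2 x)%:E))).
    apply: ge0_le_integralT => //.
    - by apply/measurable_EFinP/measurable_funM => //; exact: measurableT_comp.
    - by apply: emeasurable_funD; exact/measurable_EFinP.
    - by move=> p; rewrite lee_fin mulr_ge0.
    - move=> x _; rewrite -EFinD lee_fin /g1 /g2 /qB.
      rewrite wE (addrAC (umoll r E x)); apply: (le_trans (norm_sum_weight_le _ _ (i01 _ B x) (i01 _ U x))).
      by rewrite lerD2l ler_wpM2l//; exact: atan_pert_bound.
  rewrite ge0_integralD//; [|by move=> x _; rewrite lee_fin|exact/measurable_EFinP
    |by move=> x _; rewrite lee_fin|exact/measurable_EFinP].
  rewrite EFinD leeD// /g2; under eq_integral do rewrite EFinM.
  rewrite ge0_integralZr//; [|by apply/measurable_EFinP; exact: measurable_ind|by rewrite lee_fin mulr_ge0].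
  have -> : \int[mu]_x (\1_U x)%:E = v%:E by rewrite integral_indic// setIT; exact/esym/fineK.
  rewrite -EFinM lee_fin.
  exact: Nv8.
pose h (t : measurableTypeR R) := pint s (fun p => \1_(jump_levels w E) (t, p) * qA p)%R +
  \int[mu]_x (\1_(diff_levels w E) (t, x) * qB x)%:E.
have Gp0 t : 0 <= pint s (fun p => \1_(jump_levels w E) (t, p) * qA p)%R.
  by apply: pint_ge0 => p; rewrite mulr_ge0.
have Lp0 t : 0 <= \int[mu]_x (\1_(diff_levels w E) (t, x) * qB x)%:E.
  by apply: integral_ge0 => p _; rewrite lee_fin mulr_ge0.
have mh : measurable_fun setT h by exact: emeasurable_funD.
have h0 t : 0 <= h t by rewrite adde_ge0.
have hint : \int[lam]_t h t < (delta / 2)%:E.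
  rewrite /h ge0_integralD//.
  apply: (@le_lt_trans _ _ ((e8 + e8)%:E + (e8 + e8)%:E)).
    by apply: leeD; [exact: le_trans HG BG|exact: le_trans HLf BL].
  by rewrite -EFinD lte_fin.
(* Finiteness in every ball for almost every level: [w] is bounded and Lipschitz, so its seminorm
   over pairs touching a ball is finite and bounds the average perimeter of the superlevel sets
   there. *)
pose Bk (k : nat) := ball (0%R : V) k.+1%:R.
have mBk k : measurable (Bk k) by exact: measurable_rV_ball.
pose H k (t : measurableTypeR R) := pint s (fun p => \1_(jump_levels w set0) (t, p) * \1_(Dm (Bk k)) p)%R.
have aeH : {ae lam, forall t : measurableTypeR R, ~ Z t /\ forall k, H k t < +oo}.
  have aeZ : {ae lam, forall t : measurableTypeR R, ~ Z t}.
    by exists Z; split => // t /= /contrapT.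
  apply: filterS2 aeZ (_ : {ae lam, forall t : measurableTypeR R, forall k, H k t < +oo}).
    by move=> t; split.
  apply: ae_foralln => k.
  have mDk := measurable_ind (R := R) (measurable_Dm (mBk k)).
  have Dk0 p : (0 <= \1_(Dm (Bk k)) p :> R)%R by [].
  have [mHk HHk] := jump_average s mw measurable0 mDk Dk0 wb.
  have Hk0 t : 0 <= H k t by apply: pint_ge0 => p; rewrite mulr_ge0.
  have iH : lam.-integrable setT (H k).
    apply/integrableP; split => //.
    under eq_integral do rewrite gee0_abs//.
    apply: le_lt_trans HHk _.
    apply: (@le_lt_trans _ _ (pint s (fun p => \1_(Dm (Bk k)) p * `|w p.1 - w p.2|)%R)).
      apply: pint_le.
      - apply: measurable_funM => //; apply: (msub (fun x => w x - \1_set0 x)%R).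
        by apply: measurable_funB => //; exact: measurable_ind.
      - by apply: measurable_funM => //; exact: msub.
      - by move=> p; rewrite mulr_ge0.
      - by move=> p; rewrite !indic0 !subr0 mulrC.
    apply: le_lt_trans (pint_lipschitz s (mBk k) mw C0 wC) _.
    rewrite -/J -(fineK Jfin) (_ : mu (Bk k) = ((k.+1%:R *+ 2) ^+ n)%:E) ?ltry//.
    by rewrite /Bk lebesgue_rV_ball.
  have := integrable_ae measurableT iH; apply: filterS => t /(_ I).
  by rewrite ge0_fin_numE.
have [t [It [Zt Ht] ht]] := exists_good_level aeH mh h0 hint d0.
exists r, a, t; split => //; first by rewrite r0.
set F := suplevel _ _.
have mF : measurable F by exact: measurable_suplevel.
have mJ : measurable (jset F `+` jset E).
  have m2 := measurable_jset mF; have m3 := measurable_jset mE.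
  by apply: measurableU; exact: measurableD.
have JE (G : set V) (p : V * V) : \1_(jump_levels w G) (t, p) = \1_(jset F `+` jset G) p :> R.
  rewrite !indicE; congr (_%:R); congr nat_of_bool.
  by apply/idP/idP => /set_mem; [move=> [_ ?]; exact/mem_set|move=> ?; apply/mem_set].
have LE (x : V) : \1_(diff_levels w E) (t, x) = \1_(F `+` E) x :> R.
  rewrite !indicE; congr (_%:R); congr nat_of_bool.
  by apply/idP/idP => /set_mem; [move=> [_ ?]; exact/mem_set|move=> ?; apply/mem_set].
have t4 : (4^-1 <= t)%R by move: It; rewrite /window/= in_itv/= => /andP[].
(* Off [U], in the second case, both [umoll] and the perturbation are at most 1/8, so
   [w <= 1/4 <= t] and the point is outside [F] as well as [E]. *)
have offU x : (forall y, ~ U y -> ~ E y /\ (umoll r E y <= 8^-1)%R) -> ~ U x -> ~ E x /\ ~ F x.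
  move=> H' /H'[Ex ux]; split => //; rewrite /F /suplevel/=; apply/negP; rewrite -leNgt.
  have := fb x; rewrite -/w wE ler_norml => /andP[_].
  by move=> fx; rewrite (le_trans (lerD ux fx))// (le_trans _ t4).
split.
- by move=> x wx; exact: HZ Zt x wx.
- apply: le_lt_trans ht; rewrite /h; apply: (@le_trans _ _ (pint s (fun p => \1_(jump_levels w E) (t, p) * qA p)%R)); last by rewrite leeDl.
  apply: pint_le.
  - by apply: measurable_funM; exact: measurable_ind.
  - under eq_fun do rewrite JE; apply: measurable_funM => //; exact: measurable_ind.
  - by move=> p; rewrite mulr_ge0.
  - move=> p; rewrite JE /qA.
    have [/set_mem pA|pA] := boolP (p \in Dm A); last first.
      by rewrite [leLHS](_ : _ = 0%R) ?mulr_ge0// indicE (negbTE pA) mul0r.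
    have [/set_mem pJ|pJ] := boolP (p \in (jset F `+` jset E)); last first.
      by rewrite [leLHS](_ : _ = 0%R) ?mulr_ge0// [X in (_ * X)%R]indicE (negbTE pJ) mulr0.
    rewrite mulrC ler_wpM2l// ler_peMr// indicE mem_set//.
    case: HU => [[AU _]|HU]; first by case: pA => /AU; [left|right].
    apply: contrapT => /not_orP[/(offU _ HU)[E1 F1] /(offU _ HU)[E2 F2]].
    by move: pJ => [] [[]].
- apply: le_lt_trans ht; rewrite /h; apply: (@le_trans _ _ (\int[mu]_x (\1_(diff_levels w E) (t, x) * qB x)%:E)); last by rewrite leeDr.
  have mS : measurable (F `+` E) by apply: measurableU; exact: measurableD.
  rewrite -[X in mu X]setIT -integral_indic//; last exact: measurableI.
  apply: ge0_le_integralT => //.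
  - by apply/measurable_EFinP/measurable_ind; exact: measurableI.
  - under eq_fun do rewrite LE; apply/measurable_EFinP/measurable_funM => //; exact: measurable_ind.
  - move=> x _; rewrite LE lee_fin /qB.
    have [/set_mem[xF xB]|xFB] := boolP (x \in ((F `+` E) `&` B)); last first.
      by rewrite [leLHS](_ : _ = 0%R) ?mulr_ge0// indicE (negbTE xFB).
    rewrite indicI/= ler_wpM2l// ler_peMr// indicE mem_set//.
    case: HU => [[_ BU]|HU]; first exact: BU.
    apply: contrapT => /(offU _ HU)[E1 F1].
    by move: xF => [] [].
- move=> k; have := Ht k; rewrite /H; congr (_ < _); congr pint; apply/funext => p.
  rewrite JE mulrC indicI/=; congr (_ * _)%R; rewrite !indicE; congr (_%:R); congr nat_of_bool.
  apply/idP/idP => /set_mem pJ; apply/mem_set; last by left; split => // -[].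
  by case: pJ => [[]|[[]]].
Qed.

End good_level.

(** * Boundaries *)

Section superlevel_smooth.
Context {R : realType} {n : nat}.
Notation V := 'rV[R]_n.
Variables (w : V -> R) (t : R).

Lemma open_suplevel : continuous w -> open (suplevel w t).
Proof. by move/continuousP => cw; apply: (cw [set x | t < x]); exact: open_gt. Qed.

Lemma suplevel_boundary : continuous w ->
  topological_boundary (suplevel w t) `<=` [set x | w x = t].
Proof.
move=> cw x [cx ix]; apply/eqP; rewrite eq_le; apply/andP; split.
  rewrite leNgt; apply/negP => tx; apply: ix.
  by move/open_suplevel: cw => /interior_id ->.
have cl : closed [set y | t <= w y].
  rewrite -openC (_ : ~` _ = w @^-1` [set x | x < t]); last first.
    by apply/seteqP; split => y /=; [move/negP; rewrite -ltNge|rewrite ltNge => /negP].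
  by move/continuousP : cw; apply; exact: open_lt.
by apply: cl; apply: closureS cx => y /ltW.
Qed.

Lemma smooth_open_suplevel : smooth_fun w ->
  (forall x, w x = t -> exists i, 'D_(basis_vec i) w x != 0) ->
  smooth_open (suplevel w t).
Proof.
move=> sw reg; have cw := smooth_fun_continuous sw.
split; first exact: open_suplevel.
move=> x /(suplevel_boundary cw)/reg[i Di].
(* The defining function has to be negative inside, hence [t - w]; near a boundary point one fixed
   partial derivative stays nonzero. *)
pose phi (y : V) := t + (-1) * w y.
have sphi : smooth_fun phi by apply: smoothD; [exact: smooth_cst|exact: smoothZ].
have Dphi y : 'D_(basis_vec i) phi y = - 'D_(basis_vec i) w y.
  have D := smooth_fun_is_derive i y sw.
  have D1 := is_deriveD (is_derive_cst t y (basis_vec i)) (is_deriveZ (-1) D).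
  by rewrite (@derive_val _ _ _ _ _ _ _ D1) add0r scaleN1r.
exists [set y | 'D_(basis_vec i) phi y != 0], phi; split.
- have /continuousP cD := @smooth_fun_derive _ _ _ i sphi.
  by apply: (cD [set y : R | y != 0]); exact: open_neq.
- by rewrite /= Dphi oppr_eq0.
- exact: smooth_fun_on.
- by move=> y yD; exists i.
- apply/seteqP; split => y /=; rewrite /phi mulN1r subr_lt0; first by case.
  by move=> [].
Qed.

End superlevel_smooth.

Section measure_boundary_geometry.
Context {R : realType} {n : nat}.
Notation mu := (lebesgue_rV R n).
Notation V := 'rV[R]_n.
Implicit Types (E S T : set V) (x y z : V).

(** A Lindelof argument: the rational balls that meet [T] in a null set already cover [S], and they
    are countably many. *)
Lemma null_cover T S : measurable T ->
  (forall y, S y -> exists2 rho : R, 0 < rho & mu (T `&` ball y rho) = 0%E) ->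
  mu.-negligible (T `&` S).
Proof.
move=> mT HS.
pose b (p : 'rV[rat]_n * rat) : set V := ball (rat_rV p.1) (ratr p.2).
pose N (k : nat) := if (@unpickle ('rV[rat]_n * rat)%type k) is Some p then
  (if pselect (mu (T `&` b p) = 0%E) then T `&` b p else set0) else set0.
apply: (@negligibleS _ _ _ mu (\bigcup_k N k)).
  move=> y [Ty /HS[rho rho0 Hrho]].
  have rho20 : 0 < rho / 2 by rewrite divr_gt0.
  have [q] := rat_in_itvoo rho20; rewrite in_itv/= => /andP[q1 q2].
  have [c cy] := rat_rV_near y q1.
  exists (pickle (c, q)) => //; rewrite /N pickleK.
  have sub : T `&` b (c, q) `<=` T `&` ball y rho.
    apply: setIS => z cz; apply: (@le_ball _ _ _ (ratr q + ratr q)); first by lra.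
    by apply: ball_triangle cz; exact: ball_sym.
  case: pselect => // Hno; exfalso; apply: Hno.
  apply: (subset_measure0 _ _ sub Hrho).
  - by apply: measurableI => //; exact: measurable_rV_ball.
  - by apply: measurableI => //; exact: measurable_rV_ball.
apply: negligible_bigcup => k; rewrite /N; case: unpickle => [p|]; last exact: negligible_set0.
case: pselect => H; last exact: negligible_set0.
by exists (T `&` b p); split => //; apply: measurableI => //; exact: measurable_rV_ball.
Qed.

(** The measure theoretic exterior of [T]. For measurable [E], the measure theoretic boundary is
    what the exteriors of [E] and of its complement leave over. *)
Definition null_near T : set V :=
  [set y | exists2 rho : R, 0 < rho & mu (T `&` ball y rho) = 0%E].

Lemma open_null_near T : measurable T -> open (null_near T).
Proof.
move=> mT; rewrite openE => y [rho rho0 H].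
have rho20 : 0 < rho / 2 by rewrite divr_gt0.
apply/nbhs_ballP; exists (rho / 2) => //= z yz; exists (rho / 2) => //.
apply: (subset_measure0 (B := T `&` ball y rho)) => //.
- by apply: measurableI => //; exact: measurable_rV_ball.
- by apply: measurableI => //; exact: measurable_rV_ball.
by apply: setIS => u zu; rewrite [rho]splitr; exact: ball_triangle zu.
Qed.

Lemma null_near_disjoint T y : measurable T -> null_near T y -> ~ null_near (~` T) y.
Proof.
move=> mT [r r0 Hr] [q q0 Hq].
pose m := Num.min r q; have m0 : 0 < m by rewrite lt_min r0.
have mb := measurable_rV_ball y m.
have mT' := measurableC mT.
have H1 : mu (T `&` ball y m) = 0%E.
  apply: (subset_measure0 (B := T `&` ball y r)) => //; try exact: measurableI.
    by apply: measurableI => //; exact: measurable_rV_ball.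
  by apply: setIS; apply: le_ball; rewrite ge_min lexx.
have H2 : mu (~` T `&` ball y m) = 0%E.
  apply: (subset_measure0 (B := ~` T `&` ball y q)) => //; try exact: measurableI.
    by apply: measurableI => //; exact: measurable_rV_ball.
  by apply: setIS; apply: le_ball; rewrite ge_min lexx orbT.
have : (mu (ball y m) <= mu (T `&` ball y m) + mu (~` T `&` ball y m))%E.
  rewrite -[X in (mu X <= _)%E](setTI) -(setUv T) setIUl.
  by apply: measureU2; exact: measurableI.
rewrite H1 H2 adde0 lebesgue_rV_ball// lee_fin leNgt exprn_gt0//.
by rewrite mulrn_wgt0.
Qed.

Lemma measurable_eball x (r : R) : measurable (eball x r).
Proof.
rewrite (_ : eball x r = (fun y => enorm (y - x)) @^-1` `]-oo, r[%classic).
  rewrite -[X in measurable X]setTI.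
  exact: (measurableT_comp measurable_enorm (measurable_rVD (- x))).
by apply/seteqP; split => y /=; rewrite in_itv.
Qed.

(** The Euclidean norm is at most [n] times the sup norm; [n.+1] makes the inequality strict. *)
Lemma ball_sub_eball x (r : R) : 0 < r -> ball x (r / n.+1%:R) `<=` eball x r.
Proof.
move=> r0 y; rewrite rV_ballE/= => xy; rewrite /eball/= (le_lt_trans (enorm_le_norm _))//.
rewrite distrC (@le_lt_trans _ _ (n%:R * (r / n.+1%:R)))//.
  by rewrite ler_wpM2l// ltW.
by rewrite -[ltRHS]mulr1 mulrCA ltr_pM2l// ltr_pdivrMr// mul1r ltr_nat.
Qed.

Lemma not_measure_boundary E y : measurable E -> ~ measure_boundary E y ->
  null_near E y \/ null_near (~` E) y.
Proof.
move=> mE /existsNP[r /not_implyP[r0 /negP]].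
have me := measurable_eball y r.
have mEe : measurable (E `&` eball y r) by exact: measurableI.
have -> : leb R n (E `&` eball y r) = mu (E `&` eball y r) by exact: lebE.
have -> : leb R n (eball y r) = mu (eball y r) by exact: lebE.
have fin : (mu (eball y r) < +oo)%E.
  apply: (@le_lt_trans _ _ (mu (ball y r))); last by rewrite lebesgue_rV_ball// ltry.
  apply: le_measure; rewrite ?inE//; first exact: measurable_rV_ball.
  by move=> z; rewrite rV_ballE/eball/= => /(le_lt_trans (le_norm_enorm _)); rewrite distrC.
have rn0 : 0 < r / n.+1%:R by rewrite divr_gt0.
have mb := measurable_rV_ball y (r / n.+1%:R).
rewrite negb_and -!leNgt => /orP[H|H]; [left|right]; exists (r / n.+1%:R) => //.
  apply: (subset_measure0 (B := E `&` eball y r)) => //; first exact: measurableI.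
    by apply: setIS; exact: ball_sub_eball.
  by apply/eqP; rewrite eq_le H measure_ge0.
apply: (subset_measure0 (B := eball y r `\` E)).
- by apply: measurableI => //; exact: measurableC.
- exact: measurableD.
- by move=> z [Ez bz]; split => //; exact: ball_sub_eball.
have e : mu (eball y r `&` E) = mu (eball y r).
  rewrite setIC; apply/eqP; rewrite eq_le H andbT.
  by apply: le_measure; rewrite ?inE//; exact: measurableI.
rewrite measureD//; apply: (etrans (congr1 (fun X => mu (eball y r) - X)%E e)).
by rewrite subee// ge0_fin_numE.
Qed.

(** In a ball free of boundary points the exteriors of [E] and of its complement are disjoint open
    sets covering the ball. Both occur in it, since a set of positive measure in the ball cannot be
    locally null at each of its points, and a segment joining them contradicts connectedness. *)
Lemma measure_boundary_near E x (q : R) : measurable E ->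
  (0 < mu (E `&` ball x q))%E -> (0 < mu (~` E `&` ball x q))%E ->
  exists2 y, measure_boundary E y & ball x q y.
Proof.
move=> mE E1 E0; apply: contrapT => Hno.
have mb := measurable_rV_ball x q.
have cover y : ball x q y -> null_near E y \/ null_near (~` E) y.
  by move=> xy; apply: not_measure_boundary => // Hy; apply: Hno; exists y.
have pick T : measurable T -> (0 < mu (T `&` ball x q))%E ->
    exists2 y, ball x q y & ~ null_near T y.
  move=> mT T0; apply: contrapT => H.
  have [N [mN N0 TN]] : mu.-negligible (T `&` ball x q).
    apply: null_cover => // y xy; apply: contrapT => Hy; apply: H.
    by exists y.
  have : (mu (T `&` ball x q) <= mu N)%E.
    by apply: le_measure; rewrite ?inE//; exact: measurableI.
  have -> : mu N = 0%E by [].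
  by rewrite leNgt T0.
have [y1 xy1 y1E] := pick E mE E1.
have [y0 xy0 y0E] := pick _ (measurableC mE) E0.
have N0 : null_near E y0 by case: (cover _ xy0).
pose seg (tau : R) : V := y0 + tau *: (y1 - y0).
have cseg : continuous seg.
  move=> tau; apply: cvgD; first exact: cvg_cst.
  by apply: cvgZ; [exact: cvg_id|exact: cvg_cst].
have segb tau : `[0, 1]%classic tau -> ball x q (seg tau).
  rewrite /= in_itv/= => /andP[t0 t1]; move: xy0 xy1; rewrite rV_ballE/= => xy0 xy1.
  have -> : x - seg tau = (1 - tau) *: (x - y0) + tau *: (x - y1).
    by apply/rowP => i; rewrite /seg !mxE; ring.
  have t1' : 0 <= 1 - tau by rewrite subr_ge0.
  rewrite (le_lt_trans (ler_normD _ _))// !normrZ !ger0_norm//.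
  have [->|t0'] := eqVneq tau 0; first by rewrite subr0 mul1r mul0r addr0.
  rewrite [ltRHS](_ : q = (1 - tau) * q + tau * q); last by ring.
  by rewrite ler_ltD ?ler_wpM2l ?(ltW xy0)// ltr_pM2l// lt_neqAle eq_sym t0'.
have /continuousP cs := cseg.
have o1 := cs _ (open_null_near mE).
have o2 := cs _ (open_null_near (measurableC mE)).
have i0 : `[0, 1]%classic (0 : R) by rewrite /= in_itv/= lexx ler01.
have i1 : `[0, 1]%classic (1 : R) by rewrite /= in_itv/= lexx ler01.
(* On the segment the exterior of [E] is open, and it is closed as the complement of the other
   exterior. *)
have H : `[0, 1]%classic `&` seg @^-1` null_near E = `[0, 1]%classic.
  apply: (@segment_connected R 0 1).
  - by exists 0; split => //; rewrite /seg/= scale0r addr0.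
  - by exists (seg @^-1` null_near E).
  - exists (~` (seg @^-1` null_near (~` E))); first by rewrite closedC.
    apply/seteqP; split => tau [It Ht]; split; [exact: It| |exact: It|].
      by move=> Ht'; exact: null_near_disjoint Ht Ht'.
    by case: (cover _ (segb _ It)).
have : (`[0, 1]%classic `&` seg @^-1` null_near E) 1 by rewrite H.
by case=> _; rewrite /seg/= scale1r addrCA subrr addr0.
Qed.

End measure_boundary_geometry.

Section approximation.
Context {R : realType} {n : nat}.
Notation mu := (lebesgue_rV R n).
Notation V := 'rV[R]_n.
Variable s : R.
Hypotheses (s0 : 0 < s) (s1 : s < 1).

(** On the boundary [w = t] is in [1/4, 3/4] and the perturbation is at most 1/8, which leaves
    [umoll] strictly between 0 and 1. The divisor [n.+1] converts the sup norm ball into a Euclidean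
    one. *)
Lemma pert_moll_boundary (r : R) (E : set V) (a : V) (t eps : R) :
  measurable E -> 0 < r < eps / n.+1%:R -> 0 < eps -> window t ->
  n%:R * `|a| * 2 <= 8^-1 ->
  topological_boundary (suplevel (pert_moll r E a) t) `<=` tube eps (measure_boundary E).
Proof.
move=> mE /andP[r0 reps] eps0 + a8 x Fx.
have cw : continuous (pert_moll r E a).
  apply: smooth_fun_continuous; apply: smoothD; [exact: smooth_umoll|exact: smooth_atan_pert].
have wx : pert_moll r E a x = t by exact: suplevel_boundary Fx.
rewrite /window/= in_itv/= -wx /pert_moll => /andP[t1 t2].
have /le_trans/(_ a8) := atan_pert_bound a x; rewrite ler_norml => /andP[a1 a2].
have u0 : 0 < umoll r E x by lra.
have u1 : umoll r E x < 1 by lra.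
have [y By xy] := measure_boundary_near mE (umoll_gt0_mass r0 mE reps u0)
  (umoll_lt1_mass r0 mE reps u1).
rewrite /tube/= /edist_set; apply: (@le_lt_trans _ _ (enorm (x - y))%:E).
  by apply: ereal_inf_lbound; exists y.
rewrite lte_fin enorm_subC; exact: ball_sub_eball xy.
Qed.

Lemma smooth_approximation (A W E B : set V) (rho eps delta : R) :
  measurable A -> measurable W -> measurable E -> measurable B ->
  0 < rho -> (forall x z, A x -> `|z| < rho -> W (x + z)) ->
  (pint s \1_(Dm W `&` jset E) < +oo)%E ->
  (mu A < +oo)%E /\ (exists2 M : R, 0 < M & B `<=` ball (0%R : V) M) \/ (mu E < +oo)%E ->
  0 < eps -> 0 < delta ->
  exists F : set V, [/\ smooth_open F,
    topological_boundary F `<=` tube eps (measure_boundary E),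
    (mu E < +oo)%E -> bounded_set F &
    [/\ (pint s (fun p => \1_(Dm A) p * \1_(jset F `+` jset E) p)%R < delta%:E)%E,
        (mu ((F `+` E) `&` B) < delta%:E)%E &
        forall k : nat, (pint s \1_(Dm (ball (0%R : V) k.+1%:R) `&` jset F) < +oo)%E]].
Proof.
move=> mA mW mE mB rho0 AW Woo AB eps0 d0.
have en0 : 0 < eps / n.+1%:R by rewrite divr_gt0.
have [r [a [t [rr It a8 [reg H1 H2 H3]]]]] :=
  good_level s0 s1 mA mW mE mB rho0 AW Woo AB en0 d0.
have /andP[r0 _] := rr.
exists (suplevel (pert_moll r E a) t); split => //.
- apply: smooth_open_suplevel.
    by apply: smoothD; [exact: smooth_umoll|exact: smooth_atan_pert].
  move=> x /reg[i Di]; exists i.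
  have D1 := smooth_fun_is_derive i x (smooth_umoll r0 mE).
  have D := is_deriveD D1 (is_derive_atan_pert a x i).
  by rewrite (@derive_val _ _ _ _ _ _ _ D).
- exact: pert_moll_boundary.
(* A point above the level [t >= 1/4] has [umoll > 1/8], and that set is bounded. *)
- move=> Eoo; have e80 : 0 < 8^-1 :> R by [].
  have [M [Mr HM]] := umoll_bounded_level r0 mE e80 Eoo.
  exists M; split => // K MK x Fx; apply: (HM K MK x); move: Fx.
  rewrite /suplevel/= /pert_moll => tx.
  have /le_trans/(_ a8) := atan_pert_bound a x; rewrite ler_norml => /andP[a1 a2].
  move: It; rewrite /window/= in_itv/= => /andP[t1 t2]; lra.
Qed.

End approximation.

(** * Exhaustion and conclusion *)

Section ereal_sequences.
Context {R : realType}.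
Implicit Types (u : nat -> \bar R) (d : nat -> R).
Local Open Scope ereal_scope.

(** The two bounds are written as sums, so that no difference of extended reals arises. *)
Lemma cvge_dist_le u (P : \bar R) d : (forall h, 0 <= u h) -> 0 <= P -> P < +oo ->
  d @ \oo --> 0%R ->
  (exists N, forall h, (N <= h)%N -> u h <= P + (d h)%:E /\ P <= u h + (d h)%:E) ->
  u @ \oo --> P.
Proof.
move=> u0 P0 Poo d0 [N HN].
have Pfin : P \is a fin_num by rewrite ge0_fin_numE.
rewrite -(fineK Pfin) in HN *; set p := fine P in HN *.
have ufin h : (N <= h)%N -> u h \is a fin_num.
  by move=> /HN[H _]; rewrite ge0_fin_numE// (le_lt_trans H)// -EFinD ltry.
apply/fine_cvgP; split; first by exists N.
apply/cvgrPdist_le => e e0.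
have /cvgrPdist_le/(_ e e0)[M _ HM] := d0.
exists (maxn N M) => // h /=; rewrite geq_max => /andP[Nh Mh].
have := HM h Mh; rewrite sub0r normrN => de.
have [q uq] : exists q, u h = q%:E by exists (fine (u h)); rewrite fineK// ufin.
move: (HN h Nh); rewrite /= uq -!EFinD !lee_fin/= => -[H1 H2].
rewrite (le_trans _ (le_trans (ler_norm (d h)) de))// ler_norml.
by apply/andP; split; lra.
Qed.

(** The limit bounds a tail, and the finitely many other terms are finite. *)
Lemma cvge_sup_lty u (P : \bar R) : P < +oo -> (forall h, u h < +oo) ->
  u @ \oo --> P -> ereal_sup (range u) < +oo.
Proof.
move=> Poo uoo uP.
have [q Pq] : exists q : R, P < q%:E.
  case: P Poo {uP} => [p _|//|_]; first by exists (p + 1)%R; rewrite lte_fin ltrDl.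
  by exists 0%R; rewrite ltNyr.
have [N HN] := cvg_ereal_lt uP Pq.
have [K HK] : exists K : R, forall h, (h < N)%N -> u h <= K%:E.
  elim: (N) => [|k [K HK]]; first by exists 0%R.
  have [v uv] : exists v : R, u k <= v%:E.
    by case: (u k) (uoo k) => [v _|//|_]; [exists v|exists 0%R; rewrite leNye].
  exists (Num.max K v) => h; rewrite ltnS leq_eqVlt => /orP[/eqP ->|/HK hK].
    by rewrite (le_trans uv)// lee_fin le_max lexx orbT.
  by rewrite (le_trans hK)// lee_fin le_max lexx.
apply: (@le_lt_trans _ _ (Num.max K q)%:E); last exact: ltry.
apply: ge_ereal_sup => _ [h _ <-]; have [hN|Nh] := ltnP h N.
  by rewrite (le_trans (HK h hN))// lee_fin le_max lexx.
by rewrite ltW// (lt_le_trans (HN h Nh))// lee_fin le_max lexx orbT.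
Qed.

End ereal_sequences.

Section exhaustion.
Context {R : realType} {n : nat}.
Notation V := 'rV[R]_n.
Variable Om : set V.
Hypothesis oOm : open Om.

(** Points of norm below [h + 1] at distance more than [1 / (h + 1)] from the complement of [Om].
    Asking for some larger radius [r] keeps the set open. *)
Definition exhaust (h : nat) : set V :=
  [set x | `|x| < h.+1%:R /\ exists2 r : R, h.+1%:R^-1 < r & ball x r `<=` Om].

(** The index [(2 * h).+1] doubles the radius and halves the margin, which leaves room for shifts
    shorter than half the old margin. *)
Lemma exhaust_shift h x z : exhaust h x -> `|z| < (2 * h.+1)%:R^-1 ->
  exhaust (2 * h).+1 (x + z).
Proof.
move=> [xh [r hr rO]] zh.
have e2 : ((2 * h).+2)%:R = 2 * h.+1%:R :> R by rewrite -natrM; congr (_%:R); lia.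
have h1 : 1 <= h.+1%:R :> R by rewrite ler1n.
have ih : (2 * h.+1)%:R^-1 = h.+1%:R^-1 / 2 :> R by rewrite natrM invfM mulrC.
rewrite ih in zh.
have i1 : h.+1%:R^-1 <= 1 :> R by rewrite invf_le1.
split.
  rewrite e2; apply: le_lt_trans (ler_normD _ _) _; apply: lt_le_trans (ltrD xh zh) _.
  by move: (h.+1%:R^-1 : R) (h.+1%:R : R) h1 i1 => I H *; lra.
exists (r - h.+1%:R^-1 / 2).
  by rewrite e2 invfM [2^-1 * _]mulrC; move: (h.+1%:R^-1 : R) hr => I *; lra.
move=> y; rewrite rV_ballE/= => xzy; apply: rO; rewrite rV_ballE/=.
have -> : x - y = (x + z - y) - z by rewrite addrAC addrK.
apply: le_lt_trans (ler_normB _ _) _; apply: lt_le_trans (ltrD xzy zh) _.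
by rewrite subrK.
Qed.

Lemma open_exhaust h : open (exhaust h).
Proof.
rewrite openE => x [xh [r hr rO]]; apply/nbhs_ballP.
pose d := Num.min (h.+1%:R - `|x|) ((r - h.+1%:R^-1) / 2).
have d0 : 0 < d by rewrite lt_min subr_gt0 xh divr_gt0// subr_gt0.
exists d => //= y; rewrite rV_ballE/= lt_min => /andP[xy1 xy2].
have [m1 m2] := midf_lt hr.
split.
  have -> : y = x - (x - y) by rewrite opprB addrC subrK.
  apply: le_lt_trans (ler_normB _ _) _; apply: lt_le_trans (ler_ltD (lexx _) xy1) _.
  by rewrite addrC subrK.
exists ((h.+1%:R^-1 + r) / 2) => //.
move=> z; rewrite rV_ballE/= => yz; apply: rO; rewrite rV_ballE/=.
have -> : x - z = (x - y) + (y - z) by rewrite addrA subrK.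
apply: le_lt_trans (ler_normD _ _) _; apply: lt_le_trans (ltrD xy2 yz) _.
by move: (h.+1%:R^-1 : R) => I; lra.
Qed.

Lemma exhaust_compactly h : compactly_contained (exhaust h) Om.
Proof.
split.
  apply: bounded_closed_compact; last exact: closed_closure.
  exists h.+1%:R; split; first exact: num_real.
  move=> M hM x /(_ _ (nbhsx_ballx x (M - h.+1%:R) _))[].
    by rewrite subr_gt0.
  move=> y [[yh _]]; rewrite rV_ballE/= => xy.
  have := ler_normD (x - y) y; rewrite subrK => H; lra.
move=> x cx.
have i0 : 0 < h.+1%:R^-1 :> R by rewrite invr_gt0.
have [y [[yh [r hr rO]]]] := cx _ (nbhsx_ballx x _ i0).
rewrite rV_ballE/= => xy; apply: rO; rewrite rV_ballE/= distrC.
exact: lt_trans hr.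
Qed.

(** If the ball of radius [r] around [x] is in [Om], points within [min(1, r / 2)] of [x] belong to
    [exhaust h] as soon as [h + 1] exceeds [|x| + 1] and [2 / r]; compactness makes the index
    uniform. *)
Lemma exhaust_eventually K : compact K -> K `<=` Om ->
  exists N, forall h, (N <= h)%N -> K `<=` exhaust h.
Proof.
move=> /compact_near_coveringP cK KO.
have [N _ HN] : \forall h \near \oo, K `<=` exhaust h.
  apply: (cK nat \oo (fun h x => exhaust h x)) => x /KO Ox.
  have /nbhs_ballP[r /= r0 rO] : nbhs x Om by apply: open_nbhs_nbhs.
  pose N := maxn (Num.truncn (`|x| + 1)) (Num.truncn ((r / 2)^-1)).
  have r20 : 0 < r / 2 by rewrite divr_gt0.
  pose q := Num.min 1 (r / 2).
  have q0 : 0 < q by rewrite lt_min ltr01.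
  exists (ball x q, [set h | (N <= h)%N]).
    split => /=; [exact: nbhsx_ballx|by exists N].
  move=> [y h] [/=]; rewrite rV_ballE/= lt_min => /andP[xy1 xy2].
  rewrite geq_max => /andP[h1 h2]; split.
    rewrite (@lt_le_trans _ _ (Num.truncn (`|x| + 1)).+1%:R)//; last by rewrite ler_nat ltnS.
    rewrite (le_lt_trans _ (truncnS_gt _))//.
    have := ler_normB x (x - y); rewrite opprB addrC subrK => H; lra.
  exists (r / 2).
    rewrite invf_plt ?posrE// (lt_le_trans (truncnS_gt _))// ler_nat ltnS; exact: h2.
  move=> z; rewrite rV_ballE/= => yz; apply: rO; rewrite rV_ballE/=.
  have -> : x - z = (x - y) + (y - z) by rewrite addrA subrK.
  by rewrite (le_lt_trans (ler_normD _ _))//; lra.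
by exists N => h; exact: HN.
Qed.

End exhaustion.

(** * From single approximations to sequences *)

Section assembly.
Context {R : realType} {n : nat}.
Notation mu := (lebesgue_rV R n).
Notation V := 'rV[R]_n.
Variable s : R.
Hypotheses (s0 : 0 < s) (s1 : s < 1).
Variables (E E' Z : set V).
Hypotheses (mE : leb_measurable E) (mE' : measurable E') (mZ : measurable Z).
Hypotheses (Z0 : mu Z = 0%E) (EZ : E `+` E' `<=` Z).
Implicit Types (A F : set V).
Local Open Scope ereal_scope.

Lemma compactly_contained_ball A B : compactly_contained A B ->
  exists k : nat, A `<=` ball (0%R : V) k.+1%:R.
Proof.
move=> [/compact_bounded[M [_ HM]] _].
exists (Num.truncn (Num.max 0 M + 1)%R) => x Ax.
rewrite rV_ballE/= sub0r normrN (le_lt_trans _ (truncnS_gt _))//.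
apply: HM; last exact: subset_closure.
by rewrite ltr_pwDr// le_max lexx orbT.
Qed.

Lemma measure_boundary_mod_null : measure_boundary E = measure_boundary E'.
Proof.
have H (B : set V) : leb R n (E `&` B) = leb R n (E' `&` B).
  by apply: (leb_eq_mod_null mZ Z0) => y [[[a b] c]|[[a b] c]]; apply: EZ;
    [left|right]; split => // e; apply: c.
by apply/seteqP; split => x Hx r r0; have := Hx r r0; rewrite H.
Qed.

Lemma leb_symdiff F K : leb R n ((F `+` E) `&` K) = leb R n ((F `+` E') `&` K).
Proof.
apply: (leb_eq_mod_null mZ Z0) => y H; apply: EZ; apply: contrapT => nE.
have EE : E y <-> E' y.
  by split => a; apply: contrapT => b; apply: nE; [left|right].
case: H => -[[FE Ky] H2]; apply: H2; split => //; case: FE => -[a b].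
- by left; split => // /EE.
- by right; split => //; exact/EE.
- by left; split => // /EE.
- by right; split => //; exact/EE.
Qed.

Lemma P_s_borel A F : measurable F -> measurable A ->
  P_s s F A = pint s \1_(Dm A `&` jset F).
Proof.
move=> mF mA; apply: (P_s_pint s (Z := set0)) => //; first exact: measurable_lebT.
by move=> x [] [].
Qed.

Lemma P_s_mod_null A : measurable A -> P_s s E A = pint s \1_(Dm A `&` jset E').
Proof. by move=> mA; exact: P_s_pint mZ Z0 EZ. Qed.

Lemma Dm_subset (A B : set V) : A `<=` B -> Dm A `<=` Dm B.
Proof. by move=> AB p [/AB|/AB]; [left|right]. Qed.

Lemma pint_ind_le (S S' : set (V * V)) : measurable S -> measurable S' -> S `<=` S' ->
  pint s \1_S <= pint s \1_S'.
Proof.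
move=> mS mS' SS; apply: pint_le; [exact: measurable_ind|exact: measurable_ind| |] => p //.
by apply: ind_le; exact: SS.
Qed.

(** The error is taken over the larger set [B], so one estimate on [B] compares the perimeters in
    every [A] inside it. *)
Lemma pint_jset_close A B F G : measurable A -> measurable B -> measurable F -> measurable G ->
  A `<=` B ->
  pint s \1_(Dm A `&` jset F) <= pint s \1_(Dm A `&` jset G) +
    pint s (fun p => \1_(Dm B) p * \1_(jset F `+` jset G) p)%R.
Proof.
move=> mA mB mF mG AB.
have mJF := measurable_jset mF; have mJG := measurable_jset mG.
have mDA := measurable_Dm mA; have mDB := measurable_Dm mB.
have mJ : measurable (jset F `+` jset G) by apply: measurableU; exact: measurableD.
have m1 : measurable_fun setT (\1_(Dm A `&` jset G) : V * V -> R).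
  by apply: measurable_ind; exact: measurableI.
have m2 : measurable_fun setT (fun p : V * V => \1_(Dm B) p * \1_(jset F `+` jset G) p : R)%R.
  by apply: measurable_funM; exact: measurable_ind.
have p1 (p : V * V) : (0 <= (\1_(Dm A `&` jset G) p : R))%R by [].
have p2 (p : V * V) : (0 <= (\1_(Dm B) p * \1_(jset F `+` jset G) p : R))%R by rewrite mulr_ge0.
rewrite -(pintD s m1 m2 p1 p2); apply: pint_le => //.
- by apply: measurable_ind; exact: measurableI.
- exact: measurable_funD.
move=> p; rewrite indicE; have [/set_mem[pA pF]|_] := boolP (p \in _); last by rewrite addr_ge0.
have [pG|pG] := pselect (jset G p).
  by rewrite [X in (_ <= X + _)%R]indicE mem_set// lerDl p2.
have pB := Dm_subset AB pA.
rewrite [X in (_ <= _ + X * _)%R]indicE mem_set// mul1r.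
by rewrite [X in (_ <= _ + X)%R]indicE mem_set ?lerDr//; left.
Qed.

(** The common shape of the local and the global case. Perimeters are compared over [A h] and
    measures over [B h], with errors below [harmonic h]; the sets are an exhaustion and balls in the
    local case, the whole space in the global one. *)
Definition good_sequence (Om : set V) (A B Fh : nat -> set V) : Prop :=
  [/\ forall h, measurable (A h) /\ measurable (B h),
      forall K, compact K -> exists N, forall h, (N <= h)%N -> K `<=` B h,
      forall O, compactly_contained O Om -> exists N, forall h, (N <= h)%N -> O `<=` A h &
    [/\ forall h, smooth_open (Fh h),
        forall h, pint s (fun p => \1_(Dm (A h)) p * \1_(jset (Fh h) `+` jset E') p)%R < (harmonic h)%:E,
        forall h, mu ((Fh h `+` E') `&` B h) < (harmonic h)%:E &
        forall h (k : nat), pint s \1_(Dm (ball (0%R : V) k.+1%:R) `&` jset (Fh h)) < +oo]].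

Lemma good_sequence_cvg_P_s (Om : set V) (A B Fh : nat -> set V) O N : good_sequence Om A B Fh -> measurable O ->
  (forall h, (N <= h)%N -> O `<=` A h) -> P_s s E O < +oo ->
  P_s s (Fh h) O @[h --> \oo] --> P_s s E O.
Proof.
move=> [mAB _ _ [sF HP _ _]] mO NO Poo.
have mF h : measurable (Fh h) by apply: measurable_open_rV; case: (sF h).
rewrite (P_s_mod_null mO) in Poo *.
under eq_fun do rewrite (P_s_borel (mF _) mO).
apply: (@cvge_dist_le _ _ _ harmonic) => //.
- by move=> h; apply: pint_ge0.
- exact: pint_ge0.
- exact: cvg_harmonic.
exists N => h Nh; have [mA _] := mAB h.
split.
  apply: (le_trans (pint_jset_close mO mA (mF h) mE' (NO h Nh))).
  by rewrite leeD2l// ltW.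
apply: (le_trans (pint_jset_close mO mA mE' (mF h) (NO h Nh))).
rewrite leeD2l//; apply: le_trans (ltW (HP h)).
by rewrite setYC.
Qed.

Lemma ind_symdiff (F : set V) x : (`|\1_F x - \1_E x| = \1_(F `+` E) x :> R)%R.
Proof.
rewrite !indicE; have [xF|xF] := boolP (x \in F); have [xE|xE] := boolP (x \in E);
  have /negP xF' := xF; have /negP xE' := xE.
- by rewrite subrr normr0 memNset// => -[[_ ]|[_ ]]; apply; exact: set_mem.
- by rewrite subr0 normr1 mem_set//; left; split; [exact: set_mem|move=> /mem_set].
- by rewrite sub0r normrN normr1 mem_set//; right; split; [exact: set_mem|move=> /mem_set].
- by rewrite subrr normr0 memNset// => -[[/mem_set]|[/mem_set]].
Qed.

(** The uniform perimeter bound follows from convergence to a finite limit, as each single term is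
    finite: [O] lies in some ball. *)
Lemma good_sequence_approximates (Om : set V) (A B Fh : nat -> set V) : good_sequence Om A B Fh ->
  locally_finite_P_s s E Om -> approximates s Om Fh E.
Proof.
move=> gs lf; have [mAB KB OA [sF HP HM Hk]] := gs.
have mF h : measurable (Fh h) by apply: measurable_open_rV; case: (sF h).
have cvgO O : open O -> compactly_contained O Om ->
    P_s s (Fh h) O @[h --> \oo] --> P_s s E O.
  move=> oO cO; have [N NO] := OA _ cO.
  by apply: (good_sequence_cvg_P_s gs (measurable_open_rV oO) NO); exact: lf.
split => //.
- move=> K cK; have [N HN] := KB _ cK.
  have mK : measurable K.
    by apply: measurable_closed_rV; apply: compact_closed cK; exact: norm_hausdorff.
  have HE h : \int[leb R n]_(x in K) (`|\1_(Fh h) x - \1_E x : R|)%:E = mu ((Fh h `+` E') `&` K).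
    under eq_integral do rewrite ind_symdiff.
    rewrite integral_indic//.
    - rewrite [LHS]leb_symdiff; apply: lebE; apply: measurableI => //.
      by apply: measurableU; exact: measurableD.
    - exact: measurable_lebT.
    - have mFl := measurable_lebT (mF h).
      by apply: measurableU; exact: measurableD.
  under eq_fun do rewrite HE.
  apply: (@cvge_dist_le _ _ _ harmonic) => //; first exact: cvg_harmonic.
  exists N => h Nh; rewrite add0e; split; last by rewrite adde_ge0 ?lee_fin ?harmonic_ge0.
  apply: le_trans (ltW (HM h)); apply: le_measure; rewrite ?inE.
  - by apply: measurableI => //; apply: measurableU; exact: measurableD.
  - by apply: measurableI; [apply: measurableU; exact: measurableD|case: (mAB h)].
  - by apply: setIS; exact: HN.
- move=> O oO cO; apply: cvge_sup_lty (cvgO _ oO cO); first exact: lf.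
  move=> h; have [k Ok] := compactly_contained_ball cO.
  have mO := measurable_open_rV oO; rewrite (P_s_borel (mF h) mO).
  apply: le_lt_trans (Hk h k); apply: pint_ind_le.
  - by apply: measurableI; [exact: measurable_Dm|exact: measurable_jset].
  - apply: measurableI; [apply: measurable_Dm; exact: measurable_rV_ball|exact: measurable_jset].
  - by apply: setSI; exact: Dm_subset.
Qed.

(** The perimeter of [E] is a limit of perimeters that are bounded by a finite supremum. *)
Lemma approximates_locally_finite (Om : set V) (Fh : nat -> set V) :
  approximates s Om Fh E -> locally_finite_P_s s E Om.
Proof.
move=> [_ sup cvg] O oO cO; have cvgO := cvg O oO cO.
apply: le_lt_trans (sup O oO cO).
rewrite -(cvg_lim _ cvgO)//; apply: lime_le; first by apply/cvg_ex; exists (P_s s E O).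
by apply: nearW => h; apply: ereal_sup_ubound; exists h.
Qed.

(** [W h] is the larger set in which [E] has finite perimeter; it contains all shifts of [A h] by
    less than [rho h]. *)
Lemma exists_good_sequence (Om : set V) (A W B : nat -> set V) (rho : nat -> R) :
  (forall h, measurable (A h) /\ measurable (B h)) -> (forall h, measurable (W h)) ->
  (forall K, compact K -> exists N, forall h, (N <= h)%N -> K `<=` B h) ->
  (forall O, compactly_contained O Om -> exists N, forall h, (N <= h)%N -> O `<=` A h) ->
  (forall h, 0 < rho h)%R ->
  (forall h x z, A h x -> (`|z| < rho h)%R -> W h (x + z)%R) ->
  (forall h, P_s s E (W h) < +oo) ->
  (forall h, mu (A h) < +oo /\ (exists2 M : R, (0 < M)%R & B h `<=` ball (0%R : V) M) \/ mu E' < +oo) ->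
  exists2 Fh : nat -> set V, good_sequence Om A B Fh &
    boundary_within harmonic Fh E /\ (mu E' < +oo -> forall h, bounded_set (Fh h)).
Proof.
move=> mAB mW KB OA rho0 AW Woo AB.
have F h : exists F : set V, [/\ smooth_open F,
    topological_boundary F `<=` tube (harmonic h) (measure_boundary E'),
    mu E' < +oo -> bounded_set F &
    [/\ pint s (fun p => \1_(Dm (A h)) p * \1_(jset F `+` jset E') p)%R < (harmonic h)%:E,
        mu ((F `+` E') `&` B h) < (harmonic h)%:E &
        forall k : nat, pint s \1_(Dm (ball (0%R : V) k.+1%:R) `&` jset F) < +oo]].
  have [mA mB] := mAB h.
  apply: (smooth_approximation s0 s1 mA (mW h) mE' mB (rho0 h) (AW h) _ (AB h));
    try exact: harmonic_gt0.
  by rewrite -P_s_mod_null.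
have [Fh HF] := choice F; exists Fh.
  by split => //; split => h; case: (HF h) => // _ _ _ [].
split => [h|Eoo h]; last by case: (HF h) => _ _ /(_ Eoo).
by rewrite measure_boundary_mod_null; case: (HF h).
Qed.

Lemma locally_finite_approximation (Om : set V) : open Om -> locally_finite_P_s s E Om ->
  exists2 Fh : nat -> set V, forall h, smooth_open (Fh h) &
    approximates s Om Fh E /\ boundary_within harmonic Fh E.
Proof.
move=> oOm lf.
have bA h : bounded_set (exhaust Om h).
  exists h.+1%:R; split; first exact: num_real.
  by move=> M hM x [xh _]; rewrite /= ltW// (lt_trans xh).
have mA h : measurable (exhaust Om h) by apply: measurable_open_rV; exact: open_exhaust.
have [||||||Fh gs [bw _]] := @exists_good_sequence Om (exhaust Om)
  (fun h => exhaust Om (2 * h).+1) (fun h => ball (0%R : V) h.+1%:R)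
  (fun h => (2 * h.+1)%:R^-1)%R
  (fun h => conj (mA h) (measurable_rV_ball _ _)) (fun h => mA _) _ _ _ _ _ _.
- move=> K /compact_bounded[M [_ HM]].
  exists (Num.truncn (Num.max 0 M + 1)%R) => h hM x Kx.
  rewrite rV_ballE/= sub0r normrN.
  apply: (@lt_le_trans _ _ (Num.truncn (Num.max 0 M + 1)).+1%:R)%R; last by rewrite ler_nat ltnS.
  apply: le_lt_trans (truncnS_gt _); apply: HM => //.
  by rewrite ltr_pwDr// le_max lexx orbT.
- move=> O [cO OO]; have [N HN] := exhaust_eventually oOm cO OO.
  by exists N => h Nh; apply: subset_trans (HN h Nh); exact: subset_closure.
- by move=> h; rewrite invr_gt0.
- by move=> h x z; exact: exhaust_shift.
- by move=> h; apply: lf; [exact: open_exhaust|exact: exhaust_compactly].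
- move=> h; left; split; first exact: bounded_set_lty.
  by exists h.+1%:R.
exists Fh; first by case: gs => _ _ _ [].
by split => //; exact: good_sequence_approximates gs lf.
Qed.

(** One sequence with bounded sets and controlled boundaries yields both existence claims for sets
    of finite measure and perimeter. *)
Lemma finite_approximation : leb R n E < +oo -> P_s s E setT < +oo ->
  exists2 Fh : nat -> set V, forall h, smooth_open (Fh h) &
    [/\ approximates s setT Fh E, boundary_within harmonic Fh E,
        cvg_measure_perimeter s Fh E & forall h, bounded_set (Fh h)].
Proof.
move=> Eoo Poo.
have E'oo : mu E' < +oo.
  by move: Eoo; rewrite (leb_eq_mod_null mZ Z0 EZ) lebE.
(* Finite measure of [E'] allows [A], [W] and [B] to be the whole space, so the conditions on shifts
   and exhaustion are trivial. *)
have [Fh gs [bw bd]] := @exists_good_sequence setT (fun=> setT) (fun=> setT) (fun=> setT)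
  (fun=> 1%R) (fun h => conj measurableT measurableT) (fun h => measurableT)
  (fun K _ => ex_intro _ 0%N (fun h _ x _ => I))
  (fun O _ => ex_intro _ 0%N (fun h _ x _ => I)) (fun=> ltr01) (fun h x z _ _ => I)
  (fun=> Poo) (fun=> or_intror E'oo).
have [_ _ _ [sF HP HM _]] := gs.
have mF h : measurable (Fh h) by apply: measurable_open_rV; case: (sF h).
have lf : locally_finite_P_s s E setT.
  move=> O oO cO; have mO := measurable_open_rV oO.
  have mT : measurable [set: V] by exact: measurableT.
  have mJ := measurable_jset mE'.
  move: Poo; rewrite (P_s_mod_null mT) (P_s_mod_null mO); apply: le_lt_trans.
  apply: pint_ind_le; [apply: measurableI => //; exact: measurable_Dm..|].
  by apply: setSI; exact: Dm_subset.
exists Fh => //; split => //.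
- exact: good_sequence_approximates gs lf.
- split; last by apply: (good_sequence_cvg_P_s gs measurableT (N := 0)).
  have HE h : leb R n (Fh h `+` E) = mu (Fh h `+` E').
    rewrite -[Fh h `+` E]setIT leb_symdiff setIT; apply: lebE.
    by apply: measurableU; exact: measurableD.
  under eq_fun do rewrite HE.
  apply: (@cvge_dist_le _ _ _ harmonic) => //; first exact: cvg_harmonic.
  exists 0%N => h _; rewrite add0e; split; last by rewrite adde_ge0 ?lee_fin ?harmonic_ge0.
  by have := ltW (HM h); rewrite setIT.
- exact: bd.
Qed.

End assembly.

Unset Implicit Arguments.

Theorem theorem1p1 (R : realType) (n : nat) (n_gt0 : (0 < n)%N)
    (s : R) (s_gt0 : 0 < s) (s_lt1 : s < 1)
    (E : set 'rV[R]_n) (mE : leb_measurable E) :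
  (forall Omega : set 'rV[R]_n, open Omega ->
     locally_finite_P_s s E Omega <->
     exists (Eh : nat -> set 'rV[R]_n) (eps : nat -> R),
       [/\ forall h, smooth_open (Eh h),
           (forall h, 0 < eps h) /\ eps h @[h --> \oo] --> 0,
           approximates s Omega Eh E &
           boundary_within eps Eh E])
  /\
  ((leb R n E < +oo)%E -> (P_s s E setT < +oo)%E ->
   (exists (Eh : nat -> set 'rV[R]_n) (eps : nat -> R),
      [/\ forall h, smooth_open (Eh h),
          (forall h, 0 < eps h) /\ eps h @[h --> \oo] --> 0,
          approximates s setT Eh E,
          boundary_within eps Eh E &
          cvg_measure_perimeter s Eh E])
   /\
   (exists Eh : nat -> set 'rV[R]_n,
      [/\ forall h, smooth_open (Eh h),
          forall h, bounded_set (Eh h),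
          approximates s setT Eh E &
          cvg_measure_perimeter s Eh E])).
Proof.
(* [E'] contains [E] and lies in the product sigma-algebra; the excess lies in the null set [Z]. *)
have [E' [Z mE' [mZ Z0 sub1 sub2]]] := caratheodory_measurable_approx mE.
have EZ : E `+` E' `<=` Z by move=> x [[/sub1 //]|]; exact: sub2.
have eps0 : (forall h, 0 < harmonic h :> R) /\ harmonic h @[h --> \oo] --> (0 : R).
  by split; [exact: harmonic_gt0|exact: cvg_harmonic].
split => [U oO|Eoo Poo].
  split => [lf|[Eh [eps [_ _ H _]]]]; last exact: approximates_locally_finite H.
  have [Fh sF [aF bF]] := locally_finite_approximation s_gt0 s_lt1 mE mE' mZ Z0 EZ oO lf.
  by exists Fh, harmonic.
have [Fh sF [aF bF cF bd]] := finite_approximation s_gt0 s_lt1 mE mE' mZ Z0 EZ Eoo Poo.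
by split; [exists Fh, harmonic|exists Fh].
Qed.
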